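(* Let $n\ge 2$, $p$ a prime, $b_1\in\mathbb{Z}_p$, and let \begin{align*} V_n(\mathbb{Z}_p)_{a_1 = b_1, p \nmid a_n} &= \{x^n + a_1 x^{n - 1} + \ldots + a_n \in \mathbb{Z}_p[x] : a_1 = b_1, p \nmid a_n\}, \\ V_n(\mathbb{Z}_p)_{p \nmid a_n} &= \{x^n + a_1 x^{n - 1} + \ldots + a_n \in \mathbb{Z}_p[x] : p \nmid a_n\}. \end{align*} For $b\in\mathbb{F}_p$ let $\eta_p(b) = \sum_{\chi \in \widehat{\mathbb{F}_p} \setminus \{1\}} \chi(b)^{-1}$, which equals $p-1$ if $b=0$ and $-1$ if $b\ne 0$. Write $V = V_n(\mathbb{Z}_p)_{a_1 = b_1, p \nmid a_n}$ and $V' = V_n(\mathbb{Z}_p)_{p \nmid a_n}$. If $p = 2$, then $P_1^{\mathrm{sqf}}(V) = 0$ and \begin{align*} P^{\max}(V) &= P^{\max}(V') - \frac{(-1)^n}{2^{n + \lfloor n/2 \rfloor - 1}} \eta_2(\overline{b_1}), \\ P_0^{\mathrm{sqf}}(V) &= P_0^{\mathrm{sqf}}(V') - \frac{(-1)^n}{2^{n - 1}} \eta_2(\overline{b_1}). \end{align*} If $p$ is odd, then \begin{align*} P^{\max}(V) &= P^{\max}(V') + \frac{(-1)^n}{(p - 1) p^{n + \lfloor n/2 \rfloor - 1}} \eta_p(\overline{b_1}), \\ P_0^{\mathrm{sqf}}(V) &= P_0^{\mathrm{sqf}}(V') + \frac{(-1)^n}{(p - 1) p^{n - 1}} \eta_p(\overline{b_1}),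 \\ P_1^{\mathrm{sqf}}(V) &= P_1^{\mathrm{sqf}}(V') - \frac{(-1)^n}{p^n} (n - 1 - p \lfloor n/p \rfloor) \, \eta_p(\overline{b_1}). \end{align*}
   Context: $V_n(\mathbb{Z}_p)$ is the set of monic degree-$n$ polynomials over $\mathbb{Z}_p$; subsets defined by fixing $k$ coefficients and congruence conditions on others are identified with subsets of $\mathbb{Z}_p^{n-k}$ with Haar measure. Densities are ratios of measures: $P_0^{\mathrm{sqf}}$ is the density of $f$ with $p\nmid\mathrm{Disc}(f)$, $P_1^{\mathrm{sqf}}$ the density of $f$ with $v_p(\mathrm{Disc}(f))=1$, and $P^{\max}$ the density of $f$ with $\mathbb{Z}_p[x]/(f(x))$ the maximal order of $\mathbb{Q}_p[x]/(f(x))$. $\overline{b_1}$ is the reduction of $b_1$ mod $p$, and $\widehat{\mathbb{F}_p}$ is the character group of the additive group $\mathbb{F}_p$ with $1$ the trivial character. *)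

(* Defs.v *)
From HB Require Import structures.
From mathcomp Require Import all_boot all_order all_algebra.
From mathcomp Require Import complex.
From mathcomp Require Import all_classical all_reals all_analysis.

Set Implicit Arguments.
Unset Strict Implicit.
Unset Printing Implicit Defensive.

Import Order.TTheory GRing.Theory Num.Theory.

Local Open Scope classical_set_scope.
Local Open Scope ring_scope.

(* Z_p as the inverse limit of the Z/p^k: an element x is the sequence of its *)
(* residues x k, each represented in [0, p^k[. The primality proof is a       *)
(* parameter of the type so that it can carry an integral domain structure.   *)
Definition padic_coherent (p : nat) (u : nat -> int) : Prop :=
  forall k, u k = (u k.+1 %% (p ^ k)%N)%Z.

Record padic_int (p : nat) (p_pr : prime p) := PadicInt {
  residue :> nat -> int;
  _ : `[< padic_coherent p residue >]
}.

Section PadicInt.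
Variables (p : nat) (p_pr : prime p).
Local Notation Zp := (padic_int p_pr).
Local Notation q k := ((p ^ k)%N : int).

HB.instance Definition _ := [isSub for @residue p p_pr].
HB.instance Definition _ := [Choice of padic_int p_pr by <:].

Lemma padic_residueE (x : Zp) k : x k = (x k.+1 %% q k)%Z.
Proof. by case: x => u /= /asboolP /(_ k). Qed.

Lemma padic_eqP (x y : Zp) : (forall k, x k = y k) -> x = y.
Proof. by move=> xy; apply/val_inj/funext. Qed.

Lemma padic_modz (x : Zp) k : (x k %% q k)%Z = x k.
Proof. by rewrite padic_residueE modz_mod. Qed.

Lemma modz_exp (m : int) k l : (k <= l)%N -> ((m %% q l)%Z %% q k)%Z = (m %% q k)%Z.
Proof.
move=> kl; rewrite {2}(divz_eq m (q l)) -(subnK kl) expnD PoszM mulrA modzMDl.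
by rewrite -PoszM.
Qed.

Fact padic_of_subproof (u : nat -> int) :
  (forall k, (u k.+1 %% q k)%Z = (u k %% q k)%Z) ->
  `[< padic_coherent p (fun k => (u k %% q k)%Z) >].
Proof. by move=> hu; apply/asboolP => k /=; rewrite modz_exp // hu. Qed.

Definition padic_of u hu : Zp := PadicInt p_pr (@padic_of_subproof u hu).

Fact padic_const_subproof (m : int) k : (m %% q k)%Z = (m %% q k)%Z.
Proof. by []. Qed.
Fact padic_opp_subproof (x : Zp) k : (- x k.+1 %% q k)%Z = (- x k %% q k)%Z.
Proof. by rewrite (padic_residueE x k) modzNm. Qed.
Fact padic_add_subproof (x y : Zp) k :
  ((x k.+1 + y k.+1) %% q k)%Z = ((x k + y k) %% q k)%Z.
Proof. by rewrite (padic_residueE x k) (padic_residueE y k) modzDm. Qed.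
Fact padic_mul_subproof (x y : Zp) k :
  ((x k.+1 * y k.+1) %% q k)%Z = ((x k * y k) %% q k)%Z.
Proof. by rewrite (padic_residueE x k) (padic_residueE y k) modzMm. Qed.

Definition padic_const (m : int) : Zp :=
  @padic_of (fun=> m) (padic_const_subproof m).
Definition padic_opp (x : Zp) : Zp :=
  @padic_of (fun k => - x k) (padic_opp_subproof x).
Definition padic_add (x y : Zp) : Zp :=
  @padic_of (fun k => x k + y k) (padic_add_subproof x y).
Definition padic_mul (x y : Zp) : Zp :=
  @padic_of (fun k => x k * y k) (padic_mul_subproof x y).

Fact padic_addA : associative padic_add.
Proof. by move=> x y z; apply: padic_eqP => k /=; rewrite modzDmr modzDml addrA. Qed.
Fact padic_addC : commutative padic_add.
Proof. by move=> x y; apply: padic_eqP => k /=; rewrite addrC. Qed.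
Fact padic_add0 : left_id (padic_const 0) padic_add.
Proof. by move=> x; apply: padic_eqP => k /=; rewrite mod0z add0r padic_modz. Qed.
Fact padic_addN : left_inverse (padic_const 0) padic_opp padic_add.
Proof. by move=> x; apply: padic_eqP => k /=; rewrite modzDml addNr. Qed.

HB.instance Definition _ := GRing.isZmodule.Build (padic_int p_pr)
  padic_addA padic_addC padic_add0 padic_addN.

Fact padic_mulA : associative padic_mul.
Proof. by move=> x y z; apply: padic_eqP => k /=; rewrite modzMmr modzMml mulrA. Qed.
Fact padic_mulC : commutative padic_mul.
Proof. by move=> x y; apply: padic_eqP => k /=; rewrite mulrC. Qed.
Fact padic_mul1 : left_id (padic_const 1) padic_mul.
Proof. by move=> x; apply: padic_eqP => k /=; rewrite modzMml mul1r padic_modz. Qed.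
Fact padic_mulDl : left_distributive padic_mul padic_add.
Proof.
by move=> x y z; apply: padic_eqP => k /=; rewrite modzMml modzDm mulrDl.
Qed.
Fact padic_oner_neq0 : padic_const 1 != 0.
Proof.
apply/eqP => /(congr1 (fun x : Zp => x 1%N)) /=.
by rewrite mod0z expn1 modz_small // ltz_nat prime_gt1.
Qed.

HB.instance Definition _ := GRing.Zmodule_isComNzRing.Build (padic_int p_pr)
  padic_mulA padic_mulC padic_mul1 padic_mulDl padic_oner_neq0.

Definition padic_unit : pred Zp := fun x => `[< exists y, y * x = 1 >].
Definition padic_inv (x : Zp) : Zp :=
  if pselect (exists y, y * x = 1) is left h then sval (cid h) else x.

Fact padic_mulVx : {in padic_unit, left_inverse 1 padic_inv *%R}.
Proof.
move=> x /asboolP ux; rewrite /padic_inv.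
by case: pselect => // h; case: cid.
Qed.
Fact padic_unitPl (x y : Zp) : y * x = 1 -> padic_unit x.
Proof. by move=> yx; apply/asboolP; exists y. Qed.
Fact padic_invr_out : {in [predC padic_unit], padic_inv =1 id}.
Proof.
move=> x; rewrite !inE => /asboolP nux; rewrite /padic_inv.
by case: pselect.
Qed.

HB.instance Definition _ := GRing.ComNzRing_hasMulInverse.Build (padic_int p_pr)
  padic_mulVx padic_unitPl padic_invr_out.

Lemma padic_residueD (x : Zp) k l : ((x (l + k)%N) %% q k)%Z = x k.
Proof.
elim: l => [|l IH]; first exact: padic_modz.
rewrite -[RHS]IH (padic_residueE x (l + k)) addSn modz_exp //.
exact: leq_addl.
Qed.

Fact padic_integral (x y : Zp) : x * y = 0 -> (x == 0) || (y == 0).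
Proof.
move=> xy; apply/norP => -[x0 y0].
have nz (z : Zp) : z != 0 -> exists k, z k != 0.
  move=> z0; apply/not_existsP => z0'; move/eqP: z0; apply.
  by apply: padic_eqP => k /=; rewrite mod0z; apply/eqP/negPn/negP/z0'.
have [k xk] := nz _ x0; have [l yl] := nz _ y0.
have ndvd (z : Zp) i j : z i != 0 -> ~~ (p ^ i %| `|z (j + i)%N|)%N.
  rewrite -(padic_residueD z i j); apply: contra => zi.
  by apply/eqP/dvdz_mod0P; rewrite dvdzE.
have := congr1 (fun z : Zp => z (k + l)%N) xy; rewrite /= mod0z.
move=> /dvdz_mod0P; rewrite dvdzE /= abszM => dvd_xy.
have nx := ndvd x k l xk; have ny := ndvd y l k yl.
rewrite addnC in nx; move: nx ny dvd_xy.
move: `|x _|%N `|y _|%N => a b na nb.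
have a0 : (0 < a)%N by case: a na => //; rewrite dvdn0.
have b0 : (0 < b)%N by case: b nb => //; rewrite dvdn0.
move: na nb; rewrite !pfactor_dvdn ?muln_gt0 ?a0 //= -!ltnNge lognM // => ak bl.
by rewrite leqNgt -addnS leq_add // ltnW.
Qed.

HB.instance Definition _ :=
  GRing.ComUnitRing_isIntegral.Build (padic_int p_pr) padic_integral.

End PadicInt.

Section Divisibility.
Variables (p : nat) (p_pr : prime p).
Implicit Types x y : padic_int p_pr.

Definition pdvd (k : nat) x : Prop := exists y, x = p%:R ^+ k * y.

Definition has_valuation x (k : nat) : Prop := pdvd k x /\ ~ pdvd k.+1 x.

Definition reduction x : 'F_p := (x 1%N)%:~R.

End Divisibility.

(* The sets [set y | y = x mod p^k] form a countable basis of the p-adic      *)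
(* topology, so they generate the Borel sigma-algebra of Z_p; the library's   *)
(* product sigma-algebra on tuples is then the Borel one on Z_p^m.            *)
Section Measurable.
Variables (p : nat) (p_pr : prime p).

Definition padic_ball (x : padic_int p_pr) (k : nat) : set (padic_int p_pr) :=
  [set y | y k = x k].

Definition padic_balls : set (set (padic_int p_pr)) :=
  [set B | exists x k, B = padic_ball x k].

Definition padic_display : measure_display.
Proof. exact. Qed.

HB.instance Definition _ := isPointed.Build (padic_int p_pr) 0.

HB.instance Definition _ := @isMeasurable.Build padic_display (padic_int p_pr)
  <<s padic_balls >> (@sigma_algebra0 _ setT padic_balls)
  (@sigma_algebraC _ padic_balls) (@sigma_algebra_bigcup _ setT padic_balls).

End Measurable.

Section Haar.
Variables (R : realType) (p : nat) (p_pr : prime p) (m : nat).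
Local Notation Zpm := (m.-tuple (padic_int p_pr)).

Definition translate (a x : Zpm) : Zpm := [tuple tnth a i + tnth x i | i < m].

(* Haar measures on the compact group Z_p^m, with an arbitrary normalization. *)
Definition is_haar (mu : {measure set Zpm -> \bar R}) : Prop :=
  [/\ (0 < mu setT)%E, (mu setT < +oo)%E &
      forall (a : Zpm) (A : set Zpm), measurable A ->
        mu (translate a @` A) = mu A].

End Haar.

(* The resultant uses the actual degree of f^`(): this is the usual           *)
(* discriminant for f monic over a ring of characteristic 0, such as Z_p.     *)
Definition discriminant (A : idomainType) (f : {poly A}) : A :=
  (-1) ^+ 'C((size f).-1, 2) * resultant f f^`().

Section Orders.
Variables (A : idomainType) (K : algType {fraction A}).

Definition is_order (O : set K) : Prop :=
  [/\ O 1,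
      forall x y, O x -> O y -> O (x - y),
      forall x y, O x -> O y -> O (x * y),
      (exists s : seq K, O = [set x | exists c : 'I_(size s) -> A,
         x = \sum_(i < size s) tofrac (c i) *: s`_i]) &
      forall x, exists2 a : A, a != 0 & O (tofrac a *: x)].

Definition is_maximal_order (O : set K) : Prop :=
  is_order O /\ forall O', is_order O' -> O `<=` O' -> O' = O.

End Orders.

Section Densities.
Variables (R : realType) (p : nat) (p_pr : prime p).
Local Notation Zp := (padic_int p_pr).

Definition frac_poly (f : {poly Zp}) : {poly {fraction Zp}} :=
  map_poly (@tofrac Zp) f.

(* The image of Z_p[x]/(f) in Q_p[x]/(f); f is assumed monic of degree > 0.   *)
Definition equation_order (f : {poly Zp}) : set {poly %/ frac_poly f} :=
  range (fun g : {poly Zp} => in_qpoly (frac_poly f) (frac_poly g)).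

Arguments equation_order : clear implicits.

Definition Vn (n : nat) : set {poly Zp} :=
  [set f | f \is monic /\ size f = n.+1].

(* x^n + a_1 x^(n-1) + ... + a_n for s = [:: a_1; ...; a_n]                   *)
Definition monic_of (s : seq Zp) : {poly Zp} := Poly (rev (1 :: s)).

Definition Vn_an (n : nat) : set {poly Zp} :=
  [set f | Vn n f /\ ~ pdvd 1 f`_0].

Definition Vn_a1_an (n : nat) (b1 : Zp) : set {poly Zp} :=
  [set f | [/\ Vn n f, f`_n.-1 = b1 & ~ pdvd 1 f`_0]].

(* Density of W' in W, where W is a set of monic polynomials whose first      *)
(* coefficients a_1, ..., a_k are the fixed sequence c; W is identified with  *)
(* a subset of Z_p^m, where k + m is the degree.                              *)
Definition density (m : nat) (mu : {measure set m.-tuple Zp -> \bar R})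
    (c : seq Zp) (W W' : set {poly Zp}) : R :=
  fine (mu [set a : m.-tuple Zp | (W `&` W') (monic_of (c ++ a))]) /
  fine (mu [set a : m.-tuple Zp | W (monic_of (c ++ a))]).

Section Specific.
Variables (m : nat) (mu : {measure set m.-tuple Zp -> \bar R}).
Variables (c : seq Zp) (W : set {poly Zp}).

Definition P0_sqf : R :=
  density mu c W [set f | ~ pdvd 1 (discriminant f)].

Definition P1_sqf : R :=
  density mu c W [set f | has_valuation (discriminant f) 1].

Definition P_max : R :=
  density mu c W [set f | is_maximal_order (equation_order f)].

End Specific.

End Densities.

Arguments equation_order {p p_pr} f.
Arguments Vn {p} p_pr n.
Arguments Vn_an {p} p_pr n.
Arguments Vn_a1_an {p p_pr} n b1.

Section Characters.
Variables (R : realType) (p : nat).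

Definition is_character (chi : 'F_p -> R[i]) : Prop :=
  chi 0 = 1 /\ forall a b, chi (a + b) = chi a * chi b.

Definition eta (b : 'F_p) : R[i] :=
  \sum_(chi \in [set chi | is_character chi] `\ cst 1) (chi b)^-1.

End Characters.

(* Main.v *)
(* Write the reduction mod p of a monic f as g = s T^2 with s squarefree, and      *)
(* f = s T^2 + p v mod p^2 for lifts of s and T. Then p does not divide Disc(f) iff *)
(* T = 1; by Dedekind's criterion Z_p[x]/(f) is maximal iff gcd(T, v) = 1; and      *)
(* v_p(Disc(f)) = 1 iff p is odd, T is linear and prime to both s and v. As v is    *)
(* uniformly distributed, each density is the average of a weight w(g) over the     *)
(* monic g of degree n over F_p with g(0) <> 0 and, for V, with prescribed a_1(g).  *)
(* Fourier analysis in a_1 compares the two averages through the sums of            *)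
(* chi(a_1(g)) w(g), chi a nontrivial character of F_p. Since g |-> chi(a_1(g)) is  *)
(* multiplicative with generating series 1 - u, these sums follow from convolution  *)
(* identities, with chi^2 nontrivial for p odd and trivial for p = 2. They do not   *)
(* depend on chi, so they factor out and eta_p(b_1) remains.                        *)
From HB Require Import structures.
Require Import Defs.
From mathcomp Require Import all_boot all_order all_algebra.
From mathcomp Require Import complex.
From mathcomp Require Import all_classical all_reals all_analysis.
From mathcomp Require Import separable finfield.
From mathcomp Require Import zify ring lra.

Set Implicit Arguments.
Unset Strict Implicit.
Unset Printing Implicit Defensive.

Import Order.TTheory GRing.Theory Num.Theory.

Local Open Scope classical_set_scope.
Local Open Scope ring_scope.

(** * Polynomials over a finite field *)

(** Each of the three properties depends only on [f] mod [p ^ 2]. Once the reduction [g = s T ^ 2]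
    is fixed, with [s] squarefree, the second digits of the free coefficients are equidistributed.
    Each density is therefore the average over [g] of a weight: [[T = 1]], [Phi T / p ^ deg T], and,
    for [p] odd, [(1 - 1/p) [deg T = 1, T prime to s]] ([local_weight_unit_discriminant],
    [local_weight_maximal], [local_weight_valuation1], [density_sum]). The arithmetic behind these
    weights is Dedekind's criterion ([maximal_order_dedekind], [dedekind_maximal_order]) and row
    operations on the Sylvester matrix of [f] and its derivative ([resultant_common_factor2],
    [resultant_node]).

    Fixing [a_1] restricts the average to one fiber of [g |-> a_1(g)]. If the sum of
    [chi (a_1 g) w g] takes the same value [K] for every nontrivial [chi], then [p] times the fiber
    sum minus the full sum is [K eta] ([sum_fiber_eta]). There are [(p - 1) p ^ (n - 1)] admissible
    [g], equally shared between the fibers as [n >= 2], so the densities differ by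
    [K eta / ((p - 1) p ^ (n - 1))] ([density_shift]).

    To find [K], let [L(u) = 1 - u] be the series of the sums of [chi (a_1 g)], and [M(z)] the same
    series for [chi ^ 2]: it is [1 - z] for [p] odd and [(1 - z) / (1 - 2 z)] for [p = 2].
    Uniqueness of [g = s T ^ 2] gives the squarefree series [L(u) / M(u ^ 2)]. The totient identity
    gives [M(q z) / M(z)] as the series weighted by [Phi], hence [L(u) / M(u ^ 2 / q)] for
    maximality. For valuation 1, [T = X - c] and [s] avoids the root [c], which divides the
    squarefree series by [1 + chi(-c) u]; the sum over [c] then counts the multiples of [p] up to
    [n]. *)

Section PolyFamilies.
Variable F : finFieldType.
Implicit Types (f g h s t v : {poly F}) (n m k : nat).

Definition polys m : seq {poly F} :=
  [seq Poly (rev t) | t : m.-tuple F].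

Lemma mem_polys m v : (v \in polys m) = (size v <= m)%N.
Proof.
apply/fintype.imageP/idP => [[t _ ->]|v_m].
  by rewrite (leq_trans (size_Poly _)) // size_rev size_tuple.
exists [tuple v`_(m - i.+1) | i < m] => //.
apply/polyP => i; rewrite coef_Poly.
have [im|mi] := ltnP i m; last first.
  by rewrite !nth_default ?(leq_trans v_m) // size_rev size_tuple.
have mim : (m - i.+1 < m)%N by rewrite ltn_subrL (leq_trans _ im).
rewrite nth_rev size_tuple //.
rewrite (nth_map (Ordinal mim)) ?size_enum_ord // nth_enum_ord //.
by rewrite subnSK // subKn // ltnW.
Qed.

Lemma polys_inj m : injective (fun t : m.-tuple F => Poly (rev t)).
Proof.
move=> t u /polyP tu; apply: val_inj => /=; apply: (can_inj revK).
apply: (@eq_from_nth _ 0); first by rewrite !size_rev !size_tuple.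
by move=> i _; have := tu i; rewrite !coef_Poly.
Qed.

Lemma uniq_polys m : uniq (polys m).
Proof. by rewrite map_inj_uniq ?enum_uniq //; apply: polys_inj. Qed.

Lemma size_polys m : size (polys m) = (#|F| ^ m)%N.
Proof. by rewrite size_map -cardE card_tuple. Qed.

Definition monics n : seq {poly F} := [seq 'X^n + v | v <- polys n].

Lemma mem_monics n g : (g \in monics n) = (g \is monic) && (size g == n.+1).
Proof.
apply/mapP/andP => [[v]|[g_mon /eqP g_n]].
  rewrite mem_polys => v_n ->.
  rewrite monicE lead_coefDl ?size_polyXn // lead_coefXn eqxx; split => //.
  by rewrite size_polyDl size_polyXn.
exists (g - 'X^n); last by rewrite addrC subrK.
rewrite mem_polys; apply/leq_sizeP => j nj.
rewrite coefB coefXn; have [->|jn] := eqVneq j n.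
  by move: g_mon => /monicP; rewrite /lead_coef g_n /= => ->; rewrite subrr.
by rewrite subr0 nth_default // g_n ltn_neqAle eq_sym jn.
Qed.

Lemma uniq_monics n : uniq (monics n).
Proof. by rewrite map_inj_uniq ?uniq_polys //; apply: addrI. Qed.

Definition units n : seq {poly F} := [seq g : {poly F} <- monics n | g`_0 != 0].

Lemma mem_units n g :
  (g \in units n) = [&& g`_0 != 0, g \is monic & size g == n.+1].
Proof. by rewrite mem_filter mem_monics. Qed.

Lemma uniq_units n : uniq (units n).
Proof. by rewrite filter_uniq // uniq_monics. Qed.

(** Over a finite field separable and squarefree are the same notion ([squarefree_separable]);
    separability is the one that the gcd with the derivative, hence the discriminant, detects. *)
Definition sqfs n : seq {poly F} := [seq g : {poly F} <- units n | separable_poly g].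

Lemma mem_sqfs n g :
  (g \in sqfs n) = [&& separable_poly g, g`_0 != 0, g \is monic & size g == n.+1].
Proof. by rewrite mem_filter mem_units. Qed.

Lemma uniq_sqfs n : uniq (sqfs n).
Proof. by rewrite filter_uniq // uniq_units. Qed.

Definition units_le n : seq {poly F} :=
  [seq g : {poly F} <- polys n.+1 | (g`_0 != 0) && (g \is monic)].

Lemma mem_units_le n g :
  (g \in units_le n) = [&& g`_0 != 0, g \is monic & (size g <= n.+1)%N].
Proof. by rewrite mem_filter mem_polys andbA. Qed.

Lemma uniq_units_le n : uniq (units_le n).
Proof. by rewrite filter_uniq // uniq_polys. Qed.

Lemma sum_units_le (V : nmodType) n (f : {poly F} -> V) :
  \sum_(t <- units_le n) f t = \sum_(k < n.+1) \sum_(t <- units k) f t.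
Proof.
rewrite (big_tnth _ _ (units_le n)).
rewrite (partition_big (fun i => inord (size (tnth (in_tuple (units_le n)) i)).-1 : 'I_n.+1) xpredT) //=.
apply: eq_bigr => k _.
rewrite -(big_tnth _ _ _ (fun t => inord (size t).-1 == k)) -big_filter.
apply: perm_big; apply: uniq_perm; [exact/filter_uniq/uniq_units_le | exact: uniq_units |].
move=> t; rewrite mem_filter mem_units_le mem_units.
case t0 : (t`_0 != 0) => /=; last by rewrite andbF.
case tm : (t \is monic) => /=; last by rewrite andbF.
have sz : (0 < size t)%N by rewrite size_poly_gt0 monic_neq0.
apply/andP/eqP => [[/eqP <- t_n]|t_k].
  by rewrite inordK prednK.
by rewrite t_k ltn_ord -pred_Sn; split => //; apply/eqP/val_inj; rewrite /= inordK.
Qed.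

End PolyFamilies.

(** * Squarefree decomposition and the totient identity for polynomials *)

Section SquarefreeDecomposition.
Variable F : finFieldType.
Implicit Types (f g h s t u v T : {poly F}) (n m k : nat).

(** A finite field is perfect: Frobenius is injective, hence has an inverse [r]. A zero derivative
    leaves only exponents divisible by [p], and [r] extracts the [p]-th roots of their
    coefficients. *)
Lemma deriv0_expn u (p : nat) :
  p \in [pchar F] -> u^`() = 0 -> exists v, u = v ^+ p.
Proof.
move=> pF u'0; have p_pr := pcharf_prime pF.
have [r rK] : exists r : F -> F, cancel r (fun x => x ^+ p).
  have inj : injective (pFrobenius_aut pF).
    by move=> x y /eqP; rewrite -subr_eq0 -rmorphB expf_eq0 prime_gt0 //= subr_eq0 => /eqP.
  by exists (invF inj) => x; apply: (f_invF inj).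
exists (\poly_(i < size u) r u`_(i * p)%N).
have pP : p \in [pchar {poly F}] by rewrite pchar_poly.
rewrite -[RHS]/(pFrobenius_aut pP _) poly_def rmorph_sum.
apply/polyP => i; rewrite coef_sum.
have E (j : 'I_(size u)) : pFrobenius_aut pP (r u`_(j * p)%N *: 'X^j) = u`_(j * p)%N *: 'X^(j * p).
  by rewrite pFrobenius_autE exprZn rK -exprM.
rewrite (eq_bigr _ (fun j _ => congr1 (fun v : {poly F} => v`_i) (E j))).
under eq_bigr => j _ do rewrite coefZ coefXn.
have [/dvdnP[j ->]|npi] := boolP (p %| i)%N; last first.
  rewrite big1 => [|j _]; last first.
    by case: eqP => [ij|_]; [rewrite ij dvdn_mull in npi | rewrite mulr0].
  have /eqP : u^`()`_i.-1 = 0 by rewrite u'0 coef0.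
  have i0 : (0 < i)%N by case: i npi => //; rewrite dvdn0.
  rewrite coef_deriv prednK // -mulr_natr mulf_eq0 -(dvdn_pcharf pF) (negPf npi) orbF.
  by move/eqP.
have [ju|uj] := ltnP j (size u).
  rewrite (bigD1 (Ordinal ju)) //= eqxx mulr1 big1 ?addr0 // => k kj.
  rewrite eqn_pmul2r ?prime_gt0 // [j == k]eq_sym.
  by have := kj; rewrite -val_eqE /= => /negPf ->; rewrite mulr0.
rewrite nth_default ?big1 // => [k _|]; last by rewrite (leq_trans uj) // leq_pmulr // prime_gt0.
by rewrite eqn_pmul2r ?prime_gt0 // gtn_eqF ?mulr0 // (leq_trans (ltn_ord k)).
Qed.

Lemma squarefree_separable s :
  (forall t, t ^+ 2 %| s -> size t = 1) -> separable_poly s.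
Proof.
move=> sqf; apply/separable_polyP; split.
  by apply/poly_square_freeP => t t1; apply: contra t1 => /sqf ->.
move=> u us u1; apply/negP => /eqP.
have [p p_pr pF] := finPcharP F.
move=> /(deriv0_expn pF)[v uv]; move: u1; rewrite uv.
have /sqf v1 : v ^+ 2 %| s.
  by rewrite (dvdp_trans _ us) // uv dvdp_exp2l // prime_gt1.
move/eqP/size_poly1P: v1 => [a a0 ->].
by rewrite -rmorphXn size_polyC; case: (_ == 0).
Qed.

Lemma monic_scale t : t != 0 -> exists2 c, c != 0 & c *: t \is monic.
Proof.
move=> t0; exists (lead_coef t)^-1; first by rewrite invr_eq0 lead_coef_eq0.
by rewrite monicE lead_coefZ mulVf // lead_coef_eq0.
Qed.

Lemma size_prod_monic s t : s \is monic -> t \is monic ->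
  size (s * t) = ((size s).-1 + (size t).-1).+1.
Proof.
move=> sm tm; rewrite size_Mmonic ?monic_neq0 //.
have : (0 < size s)%N by rewrite size_poly_gt0 monic_neq0.
have : (0 < size t)%N by rewrite size_poly_gt0 monic_neq0.
by case: (size s) (size t) => // k [] // l _ _; rewrite addnS.
Qed.

Lemma size_prod_sqr s t : s \is monic -> t \is monic ->
  size (s * t ^+ 2) = ((size s).-1 + (size t).-1.*2).+1.
Proof.
by move=> sm tm; rewrite size_prod_monic ?monic_exp // size_exp muln2.
Qed.

Lemma monic_size_gt0 s : s \is monic -> (0 < size s)%N.
Proof. by move=> sm; rewrite size_poly_gt0 monic_neq0. Qed.

(** A polynomial that is not separable has a nonconstant square divisor; stripping it lowers the
    degree. *)
Lemma sqf_decomposition g : g \is monic ->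
  exists s T, [/\ g = s * T ^+ 2, s \is monic, T \is monic & separable_poly s].
Proof.
have [n] := ubnP (size g); elim: n g => // n IH g g_n g_mon.
have [gs|ngs] := boolP (separable_poly g).
  by exists g, 1; rewrite expr1n mulr1 monic1.
have [t tg t1] : exists2 t, t ^+ 2 %| g & (size t != 1).
  apply: contrapT => H; case/negP: ngs; apply: squarefree_separable => t tg.
  by apply/eqP/negPn/negP => t1; apply: H; exists t.
have t0 : t != 0.
  by apply: contraTneq tg => ->; rewrite expr0n dvd0p monic_neq0.
have [c c0 ct_mon] := monic_scale t0.
set t' := c *: t in ct_mon.
have t'g : t' ^+ 2 %| g by rewrite exprZn dvdpZl // expf_neq0.
have [h gE] : exists h, g = h * t' ^+ 2.
  by exists (g %/ t' ^+ 2); rewrite divpK.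
have h_mon : h \is monic by rewrite -(monicMr h (monic_exp 2 ct_mon)) -gE.
have t'1 : (1 < size t')%N.
  by rewrite size_scale // ltn_neqAle eq_sym t1 size_poly_gt0.
case: (IH h) => //.
  apply: (@leq_trans (size g)); last by rewrite -ltnS.
  rewrite gE size_prod_sqr // -[X in (X < _)%N](prednK (monic_size_gt0 h_mon)) ltnS.
  by rewrite -[X in (X < _)%N]addn0 ltn_add2l double_gt0 -subn1 subn_gt0.
move=> s [T [hE s_mon T_mon s_sep]]; exists s, (T * t'); split => //.
  by rewrite gE hE exprMn [RHS]mulrA.
by rewrite monicMl.
Qed.

(** After division by the gcd, the cofactor [t'] of [t] is prime to that of [T], so [t' ^ 2] divides
    the squarefree [s] and [t'] is constant. Thus [T] is the largest polynomial whose square divides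
    [s T ^ 2], which makes the decomposition unique. *)
Lemma sqr_dvd_sqf s t T : separable_poly s -> T != 0 ->
  (t ^+ 2 %| s * T ^+ 2) = (t %| T).
Proof.
move=> s_sep T0; apply/idP/idP => [tsT|tT]; last by rewrite dvdp_mull // dvdp_exp2r.
have d0 : gcdp t T != 0 by rewrite gcdp_eq0 (negPf T0) andbF.
have [t' tE] : exists t', t = t' * gcdp t T by exists (t %/ gcdp t T); rewrite divpK ?dvdp_gcdl.
have [T' TE] : exists T', T = T' * gcdp t T by exists (T %/ gcdp t T); rewrite divpK ?dvdp_gcdr.
have t'T' : coprimep t' T'.
  have := dvdpp (gcdp t T); rewrite {2}tE {2}TE.
  move=> H; have : gcdp (t' * gcdp t T) (T' * gcdp t T) %= gcdp t' T' * gcdp t T.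
    by rewrite eqp_sym mulp_gcdl.
  rewrite -tE -TE -[X in X %= _]mul1r eqp_mul2r // => e.
  by rewrite -gcdp_eqp1 eqp_sym.
have : (t' ^+ 2) * (gcdp t T ^+ 2) %| (s * T' ^+ 2) * gcdp t T ^+ 2.
  by rewrite -mulrA -!exprMn -tE -TE.
rewrite dvdp_mul2r ?expf_neq0 //.
rewrite Gauss_dvdpl; last by rewrite coprimep_expl // coprimep_expr.
move=> t's; have := separable_coprime s_sep (u := t') (v := t'); rewrite -expr2 => /(_ t's).
rewrite coprimepp => t'1; rewrite tE.
by have := dvdp_gcdr t T; rewrite -{1}[gcdp t T]mul1r; apply: dvdp_trans; apply: dvdp_mul; rewrite ?dvdpp // dvdp1.
Qed.

Lemma dvdp_monic_eq s t : s \is monic -> t \is monic -> s %| t -> t %| s -> s = t.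
Proof.
move=> sm tm st ts; apply/eqP; rewrite -eqp_monic //; exact/andP.
Qed.

Lemma sum_units_sqf (V : nmodType) n (f : {poly F} -> V) :
  \sum_(g <- units F n) f g =
  \sum_(k < n./2.+1) \sum_(T <- units F k) \sum_(s <- sqfs F (n - k.*2)) f (s * T ^+ 2).
Proof.
transitivity (\sum_(T <- units_le F n./2) \sum_(s <- sqfs F (n - (size T).-1.*2)) f (s * T ^+ 2)); last first.
  rewrite sum_units_le; apply: eq_bigr => k _; apply: eq_big_seq => T.
  by rewrite mem_units => /and3P[_ _ /eqP ->].
rewrite -(big_allpairs_dep (h := fun T s => s * T ^+ 2) (r1 := units_le F n./2)
  (r2 := fun T => sqfs F (n - (size T).-1.*2))).
apply: perm_big; apply: uniq_perm; first exact: uniq_units.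
  apply: allpairs_uniq_dep => [|T _|]; [exact: uniq_units_le | exact: uniq_sqfs |].
  move=> _ _ /allpairsPdep[T [s [TP sP ->]]] /allpairsPdep[U [t [UP tP ->]]] /= e.
  move: TP UP sP tP; rewrite !mem_units_le !mem_sqfs.
  move=> /and3P[_ Tm _] /and3P[_ Um _] /and4P[s_sep _ sm _] /and4P[t_sep _ tm _].
  have TU : T = U.
    apply: dvdp_monic_eq => //.
      by rewrite -(sqr_dvd_sqf T t_sep) ?monic_neq0 // -e dvdp_mull.
    by rewrite -(sqr_dvd_sqf U s_sep) ?monic_neq0 // e dvdp_mull.
  rewrite -TU in e *.
  by rewrite (_ : s = t) //; apply: (mulIf _ e); rewrite expf_neq0 // monic_neq0.
move=> g; apply/idP/allpairsPdep.
  rewrite mem_units => /and3P[g0 gm /eqP gn].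
  have [s [T [gE sm Tm s_sep]]] := sqf_decomposition gm.
  move: g0; rewrite gE expr2 !coef0M !mulf_eq0 !negb_or => /andP[s0 /andP[T0 _]].
  have nE : n = ((size s).-1 + (size T).-1.*2)%N.
    by apply: succn_inj; rewrite -gn gE size_prod_sqr.
  exists T, s; rewrite mem_units_le mem_sqfs T0 s0 Tm sm s_sep -expr2 -gE /=; split => //.
    by rewrite -(prednK (monic_size_gt0 Tm)) ltnS geq_half_double nE leq_addl.
  by rewrite nE addnK prednK ?monic_size_gt0.
case=> T [s []]; rewrite mem_units_le mem_sqfs mem_units => /and3P[T0 Tm T_n].
move=> /and4P[s_sep s0 sm /eqP s_n] ->.
rewrite size_prod_sqr // expr2 !coef0M !mulf_neq0 // !monicMl //= s_n eqSS.
rewrite Tm /= subnK ?eqxx // -geq_half_double -ltnS prednK ?monic_size_gt0 //.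
Qed.

(** Euler's totient: the number of units of [F[x] / (T)]. *)
Definition Phi T : nat := size [seq v <- polys F (size T).-1 | coprimep T v].

Lemma dvdp_common_mul u v s t : coprimep u v ->
  s %| t * u -> s %| t * v -> s %| t.
Proof.
move=> uv su sv; have : s %| gcdp (t * u) (t * v) by rewrite dvdp_gcd su.
rewrite -(eqp_dvdr _ (mulp_gcdr _ _ _)) => H; apply: (dvdp_trans H).
by rewrite -[X in _ %| X]mulr1 dvdp_mul // (eqp_dvdl 1 (_ : _ %= 1)) ?gcdp_eqp1.
Qed.

(** Polynomial analogue of the fact that the totients of the divisors of an integer add up to it: a
    pair [(T, v)] with [deg v < deg T = k] is uniquely a monic gcd [t] times a coprime pair. *)
Lemma sum_units_totient (V : nmodType) k (f : {poly F} -> V) :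
  (\sum_(T <- units F k) f T) *+ (#|F| ^ k) =
  \sum_(j < k.+1) \sum_(t <- units F j) \sum_(T <- units F (k - j)) f (t * T) *+ Phi T.
Proof.
pose pairs j := [seq (T, v) | T <- units F j, v <- polys F j].
transitivity (\sum_(x <- pairs k) f x.1).
  rewrite big_allpairs -sumrMnl; apply: eq_bigr => T _ /=.
  by rewrite big_const_seq count_predT size_polys iter_addr_0.
pose cpairs j := [seq x <- pairs j | coprimep x.1 x.2].
transitivity (\sum_(t <- units_le F k) \sum_(x <- cpairs (k - (size t).-1)%N) f (t * x.1)); last first.
  rewrite sum_units_le; apply: eq_bigr => j _; apply: eq_big_seq => t.
  rewrite mem_units => /and3P[_ _ /eqP ->] /=.
  rewrite big_filter big_mkcond big_allpairs; apply: eq_big_seq => T.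
  rewrite mem_units => /and3P[_ _ /eqP TE] /=.
  rewrite -big_mkcond -big_filter big_const_seq count_predT iter_addr_0.
  by rewrite /Phi TE.
rewrite -(big_allpairs_dep (h := fun t x => (t * x.1, t * x.2)) (r1 := units_le F k)
  (r2 := fun t => cpairs (k - (size t).-1)%N) (F := fun x => f x.1)).
have pairsP j x : (x \in pairs j) = [&& x.1`_0 != 0, x.1 \is monic, size x.1 == j.+1 & (size x.2 <= j)%N].
  apply/allpairsP/idP => [[[T v] /= [TP vP ->]]|xP] /=.
    by rewrite mem_units in TP; rewrite mem_polys in vP; case/and3P: TP => -> -> ->.
  by exists x; rewrite mem_units mem_polys; case/and4P: xP => -> -> ->; case: x.
have uniq_pairs j : uniq (pairs j).
  by apply: allpairs_uniq; rewrite ?uniq_units ?uniq_polys // => -[? ?] [? ?].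
apply: perm_big; apply: uniq_perm => //.
  apply: allpairs_uniq_dep => [|t _|]; [exact: uniq_units_le | exact: filter_uniq |].
  move=> _ _ /allpairsPdep[t [x [tP xP ->]]] /allpairsPdep[u [y [uP yP ->]]] /= [e1 e2].
  move: tP uP xP yP; rewrite !mem_units_le !mem_filter.
  move=> /and3P[_ tm _] /and3P[_ um _] /andP[xco _] /andP[yco _].
  have tu : t = u.
    apply: dvdp_monic_eq => //.
      by apply: (dvdp_common_mul yco); rewrite -?e1 -?e2 dvdp_mulr.
    by apply: (dvdp_common_mul xco); rewrite ?e1 ?e2 dvdp_mulr.
  rewrite -tu in e1 e2 *.
  rewrite (_ : x = y) //; case: x y e1 e2 {xco yco} => [x1 x2] [y1 y2] /=.
  by move=> /(mulfI (monic_neq0 tm)) -> /(mulfI (monic_neq0 tm)) ->.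
move=> [g v]; rewrite pairsP /=; apply/idP/allpairsPdep.
  move=> /and4P[g0 gm /eqP gn vn].
  have d0 : gcdp g v != 0 by rewrite gcdp_eq0 (negPf (monic_neq0 gm)).
  have [c c0 tm] := monic_scale d0.
  set t := c *: gcdp g v in tm.
  have [T gE] : exists T, g = t * T.
    by exists (g %/ t); rewrite mulrC divpK // dvdpZl ?dvdp_gcdl.
  have [w vE] : exists w, v = t * w.
    by exists (v %/ t); rewrite mulrC divpK // dvdpZl ?dvdp_gcdr.
  have Tm : T \is monic by rewrite -(monicMl T tm) -gE.
  have Tw : coprimep T w.
    rewrite -gcdp_eqp1; have : t * gcdp T w %= t * 1.
      apply: eqp_trans (mulp_gcdr _ _ _) _.
      by rewrite -gE -vE mulr1 eqp_sym eqp_scale.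
    by rewrite eqp_mul2l // monic_neq0.
  move: g0; rewrite gE coef0M mulf_eq0 negb_or => /andP[t0 T0].
  have kE : k = ((size t).-1 + (size T).-1)%N.
    by apply: succn_inj; rewrite -gn gE size_prod_monic.
  exists t, (T, w); rewrite mem_units_le mem_filter pairsP t0 T0 tm Tm Tw vE /= kE addKn.
  have t_gt0 := monic_size_gt0 tm; have T_gt0 := monic_size_gt0 Tm.
  split => //; first by rewrite -[X in (X <= _)%N](prednK t_gt0) ltnS leq_addr.
  rewrite prednK // eqxx /=.
  have [->|w0] := eqVneq w 0; first by rewrite size_poly0.
  move: vn; rewrite vE kE mulrC size_Mmonic // -(prednK (monic_size_gt0 tm)) addnS /=.
  by rewrite addnC leq_add2l.
case=> t [[T w] []]; rewrite mem_units_le mem_filter pairsP /= => /and3P[t0 tm tk].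
case/and5P => _ T0 Tm /eqP TE wk [-> ->].
have dk : ((size t).-1 <= k)%N by rewrite -ltnS prednK ?monic_size_gt0.
rewrite coef0M mulf_neq0 // monicMl //= size_prod_monic // TE /= subnKC // eqxx /=.
rewrite Tm; apply: leq_trans (size_polyMleq _ _) _.
by rewrite -(prednK (monic_size_gt0 tm)) addSn -(subnKC dk) leq_add2l.
Qed.

(** Multiplying a separable [s] by [X - c] keeps it separable exactly when [s] does not vanish at
    [c]; [c != 0] keeps the constant coefficient nonzero. *)
Lemma sum_sqfs_root (V : nmodType) n c (f : {poly F} -> V) : c != 0 ->
  \sum_(s <- sqfs F n.+1 | root s c) f s =
  \sum_(s <- sqfs F n | ~~ root s c) f (('X - c%:P) * s).
Proof.
move=> c0; rewrite -big_filter -[RHS]big_filter.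
rewrite -[RHS](big_map (fun s => ('X - c%:P) * s) predT f).
apply: perm_big; apply: uniq_perm; first exact/filter_uniq/uniq_sqfs.
  rewrite map_inj_uniq; first exact/filter_uniq/uniq_sqfs.
  by apply: mulfI; rewrite polyXsubC_eq0.
move=> g; rewrite mem_filter mem_sqfs; apply/idP/mapP.
  case/and5P => gc g_sep g0 gm /eqP gn.
  have [s gE] := factor_theorem _ _ gc.
  have sm : s \is monic by rewrite -(monicMr s (monicXsubC c)) -gE.
  exists s; last by rewrite mulrC.
  move: g_sep g0 gn; rewrite gE separable_root size_prod_monic ?monicXsubC //.
  rewrite (_ : (size ('X - c%:P)).-1 = 1%N) ?size_XsubC // addn1.
  case/andP => s_sep sc; rewrite coef0M mulf_eq0 negb_or => /andP[s0 _] [<-].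
  by rewrite mem_filter mem_sqfs s_sep s0 sm sc /= prednK ?monic_size_gt0.
case=> s; rewrite mem_filter mem_sqfs => /and5P[sc s_sep s0 sm /eqP sn] ->.
rewrite rootM root_XsubC eqxx [_ * s]mulrC separable_root s_sep sc monicMl ?monicXsubC //= size_prod_monic ?monicXsubC //.
rewrite (_ : (size ('X - c%:P)).-1 = 1%N) ?size_XsubC // addn1 sn eqxx.
by rewrite coef0M coefB coefX coefC /= sub0r mulf_neq0 ?oppr_eq0.
Qed.

End SquarefreeDecomposition.

(** * Character sums over monic polynomials *)

Section CharacterSums.
Variable F : finFieldType.
Implicit Types (f g h s t u v T : {poly F}) (n m k : nat).

(* The factor ['X] only serves to give the constant polynomial [1] the value [0]. *)
Definition subleading g := ('X * g)`_(size g).-1.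

Lemma subleadingE g n : g \is monic -> size g = n.+1 ->
  exists2 u, g = 'X^n + u & (size u <= n)%N /\ subleading g = ('X * u)`_n.
Proof.
move=> gm gn; have : g \in monics F n by rewrite mem_monics gm gn eqxx.
move=> /mapP[u]; rewrite mem_polys => un ->; exists u; split => //.
rewrite /subleading size_polyDl size_polyXn ?ltnS //= mulrDr -exprS coefD coefXn.
by rewrite ltn_eqF ?add0r.
Qed.

(** This additivity makes [g |-> chi (subleading g)] multiplicative on monic polynomials, the source
    of all the convolution identities. *)
Lemma subleadingM s t : s \is monic -> t \is monic ->
  subleading (s * t) = subleading s + subleading t.
Proof.
move=> sm tm.
have := subleadingE sm (esym (prednK (monic_size_gt0 sm))).
have := subleadingE tm (esym (prednK (monic_size_gt0 tm))).
move: (size_prod_monic sm tm); rewrite /subleading => -> /=.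
move: (size s).-1 (size t).-1 => m n [v -> [vn ->]] [u -> [um ->]].
rewrite mulrDl !mulrDr -exprD -exprS !coefD coefXn ltn_eqF // add0r.
rewrite [_ * v]mulrC !mulrA [_ * v * _]mulrC.
have -> : ('X^m * ('X * v))`_(m + n) = ('X * v)`_n.
  by rewrite coefXnM ltnNge leq_addr /= addKn.
have -> : ('X * u * 'X^n)`_(m + n) = ('X * u)`_m.
  by rewrite coefMXn ltnNge leq_addl /= addnK.
rewrite [('X * u * v)`__]nth_default ?addr0 1?addrC //.
have [->|u0] := eqVneq u 0; first by rewrite mulr0 mul0r size_poly0.
have [->|v0] := eqVneq v 0; first by rewrite mulr0 size_poly0.
rewrite (leq_trans (size_polyMleq _ _)) // size_mul ?polyX_eq0 // size_polyX /=.
by rewrite add0n leq_add.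
Qed.

Lemma subleading1 : subleading 1 = 0.
Proof. by rewrite /subleading size_poly1 mulr1 coefX. Qed.

Variables (C : numFieldType) (chi : F -> C).
Hypotheses (chi0 : chi 0 = 1) (chiD : forall a b, chi (a + b) = chi a * chi b).

Lemma chi_natmul a k : chi (a *+ k) = chi a ^+ k.
Proof. by elim: k => [|k IH]; rewrite ?mulr0n // mulrS chiD IH exprS. Qed.

Lemma sum_nontrivial_char : (exists y, chi y != 1) -> \sum_a chi a = 0.
Proof.
case=> y y1; have : (chi y - 1) * \sum_a chi a = 0.
  rewrite mulrBl mul1r mulr_sumr [X in _ - X](reindex_inj (addrI y)) /=.
  by under eq_bigr do rewrite -chiD; rewrite subrr.
by move=> /eqP; rewrite mulf_eq0 subr_eq0 (negPf y1) => /eqP.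
Qed.

Definition Eunits n : C := \sum_(g <- units F n) chi (subleading g).

Lemma units0 : units F 0 = [:: 1].
Proof.
apply: perm_small_eq => //; apply: uniq_perm => //; first exact: uniq_units.
move=> g; rewrite mem_units inE; apply/and3P/eqP => [[_ gm /eqP g1]|->].
  by have /size_poly1P[c c0 gE] := introT eqP g1; move: gm; rewrite gE monicE lead_coefC => /eqP ->.
by rewrite coef1 oner_neq0 monic1 size_poly1.
Qed.

Lemma sum_units1 (V : nmodType) (f : {poly F} -> V) :
  \sum_(g <- units F 1) f g = \sum_(c | c != 0) f ('X - c%:P).
Proof.
rewrite -[RHS]big_filter -[RHS](big_map (fun c => 'X - c%:P) predT f).
apply: perm_big; apply: uniq_perm; first exact: uniq_units.
  rewrite map_inj_uniq ?filter_uniq ?index_enum_uniq //.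
  by move=> a b /addrI/oppr_inj/polyC_inj.
move=> g; rewrite mem_units; apply/and3P/mapP => [[g0 gm /eqP g2]|[c]].
  exists (- g`_0); first by rewrite mem_filter mem_index_enum oppr_eq0 g0.
  apply/polyP => i; rewrite polyCN opprK coefD coefX coefC.
  case: i => [|[|i]]; rewrite ?add0r ?addr0 //=.
    by move: gm; rewrite monicE /lead_coef g2 => /eqP.
  by rewrite nth_default ?g2.
rewrite mem_filter => /andP[c0 _ ->].
by rewrite coefB coefX coefC /= sub0r oppr_eq0 c0 monicXsubC size_XsubC.
Qed.

Lemma subleading_XsubC c : subleading ('X - c%:P) = - c.
Proof. by rewrite /subleading size_XsubC coefXM coefB coefX coefC /= sub0r. Qed.

Lemma Eunits0 : Eunits 0 = 1.
Proof. by rewrite /Eunits units0 big_seq1 subleading1 chi0. Qed.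

Lemma Eunits1 : (exists y, chi y != 1) -> Eunits 1 = - 1.
Proof.
move=> nt; rewrite /Eunits sum_units1.
under eq_bigr do rewrite subleading_XsubC.
rewrite (reindex_inj oppr_inj) /=.
have := sum_nontrivial_char nt; rewrite (bigD1 0) //= chi0 addrC => /eqP.
rewrite addr_eq0 => /eqP <-.
by apply: eq_big => c; rewrite ?oppr_eq0 ?opprK.
Qed.

(** From degree 2 on, the subleading and constant coefficients are distinct, so adding
    [y X ^ (n + 1)] permutes the family and multiplies the sum by [chi y != 1]. With the degrees 0
    and 1, the generating series is [1 - u]. *)
Lemma Eunits_ge2 n : (exists y, chi y != 1) -> Eunits n.+2 = 0.
Proof.
case=> y y1; have : (chi y - 1) * Eunits n.+2 = 0; last first.
  by move=> /eqP; rewrite mulf_eq0 subr_eq0 (negPf y1) => /eqP.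
rewrite mulrBl mul1r; apply/eqP; rewrite subr_eq0; apply/eqP.
rewrite /Eunits mulr_sumr.
have ym : (size (y *: 'X^(n.+1) : {poly F}) <= n.+2)%N.
  by rewrite (leq_trans (size_scale_leq _ _)) // size_polyXn.
have shift z g : g \is monic -> size g = n.+3 ->
    g + z *: 'X^(n.+1) \is monic /\ size (g + z *: 'X^(n.+1)) = n.+3.
  move=> gm gn; have zm : (size (z *: 'X^(n.+1) : {poly F}) < size g)%N.
    by rewrite gn ltnS (leq_trans (size_scale_leq _ _)) // size_polyXn.
  by rewrite monicE lead_coefDl // size_polyDl //; split => //; apply: (monicP gm).
transitivity (\sum_(g <- [seq g + y *: 'X^(n.+1) | g <- units F n.+2]) chi (subleading g)); last first.
  apply: perm_big.
  apply: uniq_perm; [by rewrite map_inj_uniq ?uniq_units //; apply: addIr | exact: uniq_units |].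
  move=> g; rewrite mem_units; apply/mapP/and3P => [[h]|[g0 gm /eqP gn]].
    rewrite mem_units => /and3P[h0 hm /eqP hn] ->.
    have [-> ->] := shift y _ hm hn.
    by rewrite coefD coefZ coefXn mulr0 addr0 h0.
  have := shift (- y) _ gm gn; rewrite scaleNr => -[hm hn].
  exists (g - y *: 'X^(n.+1)); last by rewrite subrK.
  by rewrite mem_units hm hn coefB coefZ coefXn mulr0 subr0 g0 eqxx.
rewrite big_map; apply: eq_big_seq => g; rewrite mem_units => /and3P[g0 gm /eqP gn].
have [_ hn] := shift y _ gm gn.
rewrite -chiD; congr chi; rewrite /subleading gn hn /= mulrDr coefD addrC.
by rewrite -scalerAr coefZ -exprS coefXn eqxx mulr1.
Qed.

End CharacterSums.

Lemma size_units (F : finFieldType) n :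
  size (units F n.+1) = (#|F|.-1 * #|F| ^ n)%N.
Proof.
pose r := [seq g : {poly F} <- monics F n.+1 | g`_0 == 0].
have : (size (units F n.+1) + size r = #|F| ^ n.+1)%N.
  rewrite !size_filter -[RHS](size_polys F n.+1) -(size_map (+%R 'X^(n.+1))) -/(monics F n.+1).
  rewrite -(count_predC (fun g : {poly F} => g`_0 != 0)); congr addn.
  by apply: eq_count => g /=; rewrite negbK.
have -> : size r = (#|F| ^ n)%N.
  transitivity (size [seq 'X * g | g <- monics F n]); last first.
    by rewrite size_map [LHS]size_map size_polys.
  apply: perm_size; apply: uniq_perm; first exact/filter_uniq/uniq_monics.
    by rewrite map_inj_uniq ?uniq_monics //; apply: mulfI; rewrite polyX_eq0.
  move=> g; rewrite mem_filter mem_monics; apply/and3P/mapP => [[g0 gm gn]|[h]].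
    have [h gE] : exists h, g = 'X * h.
      have : root g 0 by rewrite rootE horner_coef0.
      by move=> /factor_theorem[h ->]; exists h; rewrite subr0 mulrC.
    exists h => //; move: gm gn; rewrite gE mem_monics monicMl ?monicX // => hm.
    by rewrite size_prod_monic ?monicX // size_polyX hm add1n /= prednK ?monic_size_gt0.
  rewrite mem_monics => /andP[hm /eqP hn] ->.
  by rewrite coefXM eqxx monicMl ?monicX // hm size_prod_monic ?monicX // size_polyX hn.
move=> e; have q0 : (0 < #|F|)%N by apply/card_gt0P; exists 0.
by apply/eqP; rewrite -(eqn_add2r (#|F| ^ n)) e -[X in (_ + X)%N]mul1n -mulnDl addn1 prednK ?expnS.
Qed.

(** * Convolution with the series of a nontrivial or trivial character *)

Section Convolution.
Variable C : numFieldType.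
Implicit Types e x : nat -> C.

Lemma conv_two e x : e 0%N = 1 -> e 1%N = - 1 -> (forall n, e n.+2 = 0) ->
  forall m, \sum_(j < m.+2) e j * x (m.+1 - j)%N = x m.+1 - x m.
Proof.
move=> e0 e1 e2 m; rewrite !big_ord_recl /= e0 e1 mul1r mulN1r subn0 subn1.
by rewrite big1 ?addr0 // => i _; rewrite e2 mul0r.
Qed.

(** The series of [e] is [1 + e_1 z / (1 - q z)], so multiplication by [1 - q z] clears its
    denominator. *)
Lemma conv_geometric e x (q : C) : e 0%N = 1 -> (forall n, e n.+2 = q * e n.+1) ->
  forall m, \sum_(j < m.+2) e j * x (m.+1 - j)%N - q * \sum_(j < m.+1) e j * x (m - j)%N =
    x m.+1 + (e 1%N - q) * x m.
Proof.
move=> e0 eS m; rewrite !big_ord_recl /= e0 /bump /= !mul1r subn0 subn1.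
have -> : \sum_(i < m) e (1 + (1 + i))%N * x (m.+1 - (1 + (1 + i)))%N =
          q * \sum_(i < m) e (1 + i)%N * x (m - (1 + i))%N.
  by rewrite mulr_sumr; apply: eq_bigr => i _; rewrite !add1n eS mulrA subSS.
by rewrite subn0; ring.
Qed.

End Convolution.

(** * Character sums of the three weights *)

Section WeightedSums.
Variables (F : finFieldType) (C : numFieldType) (chi : F -> C).
Hypotheses (chi0 : chi 0 = 1) (chiD : forall a b, chi (a + b) = chi a * chi b).
Hypothesis chi_nt : exists y, chi y != 1.
Implicit Types (g s t v T : {poly F}) (n m k : nat).

Local Notation q := (#|F|%:R : C).
Local Notation Esqr := (Eunits (fun a : F => chi a ^+ 2)).

Definition Ssqf n : C := \sum_(s <- sqfs F n) chi (subleading s).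
(** The character is squared because [T] enters [g] through [T ^ 2]. *)
Definition Bsum n : C := \sum_(T <- units F n) chi (subleading T) ^+ 2 * (Phi T)%:R.

Let q_neq0 : q != 0.
Proof. by rewrite pnatr_eq0 -lt0n; apply/card_gt0P; exists 0. Qed.

Lemma sum_units_weight (w : {poly F} -> C) (wt : {poly F} -> {poly F} -> C) :
    (forall s T, s \is monic -> T \is monic -> separable_poly s ->
      w (s * T ^+ 2) = wt s T) -> forall n,
  \sum_(g <- units F n) chi (subleading g) * w g =
  \sum_(k < n./2.+1) \sum_(T <- units F k) chi (subleading T) ^+ 2 *
    \sum_(s <- sqfs F (n - k.*2)) chi (subleading s) * wt s T.
Proof.
move=> wE n; rewrite sum_units_sqf; apply: eq_bigr => k _.
apply: eq_big_seq => T; rewrite mem_units => /and3P[_ Tm _].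
rewrite mulr_sumr; apply: eq_big_seq => s; rewrite mem_sqfs => /and4P[s_sep _ sm _].
rewrite wE // expr2 !subleadingM ?monicMl // !chiD expr2.
by ring.
Qed.

(** [T ^ 2] has even degree, so [s] and [g] have degrees of the same parity [b]; for each [b] the
    decomposition becomes a plain convolution in half-degrees. *)
Lemma Eunits_sqf m (b : bool) :
  Eunits chi (m.*2 + b) = \sum_(k < m.+1) Esqr k * Ssqf ((m - k).*2 + b).
Proof.
have -> : Eunits chi (m.*2 + b) = \sum_(g <- units F (m.*2 + b)) chi (subleading g) * 1.
  by apply: eq_bigr => g _; rewrite mulr1.
rewrite (@sum_units_weight (fun=> 1) (fun _ _ => 1)) //.
rewrite (_ : (m.*2 + b)./2 = m); last by rewrite addnC half_bit_double.
apply: eq_bigr => k _; rewrite /Eunits mulr_suml; apply: eq_bigr => T _.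
congr (_ * _); rewrite doubleB addnBAC ?leq_double -1?ltnS //.
by apply: eq_bigr => s _; rewrite mulr1.
Qed.

Lemma Esqr_Bsum k : Esqr k * q ^+ k = \sum_(j < k.+1) Esqr j * Bsum (k - j).
Proof.
rewrite -natrX mulr_natr sum_units_totient; apply: eq_bigr => j _.
rewrite mulr_suml; apply: eq_big_seq => t; rewrite mem_units => /and3P[_ tm _].
rewrite mulr_sumr; apply: eq_big_seq => T; rewrite mem_units => /and3P[_ Tm _].
by rewrite subleadingM // chiD exprMn mulrA mulr_natr.
Qed.

Lemma Esqr0 : Esqr 0 = 1.
Proof. by rewrite Eunits0 // chi0 expr1n. Qed.

Lemma sqf_weight_sum (w : {poly F} -> C) :
    (forall s T, s \is monic -> T \is monic -> separable_poly s ->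
      w (s * T ^+ 2) = (size T == 1)%:R) -> forall n,
  \sum_(g <- units F n) chi (subleading g) * w g = Ssqf n.
Proof.
move=> wE n; rewrite (sum_units_weight wE) big_ord_recl [X in _ + X]big1 ?addr0.
  rewrite units0 big_seq1 subleading1 chi0 expr1n mul1r double0 subn0 size_poly1 /=.
  by apply: eq_bigr => s _; rewrite mulr1.
move=> k _; rewrite big1_seq // => T /andP[_]; rewrite mem_units => /and3P[_ _ /eqP ->].
by rewrite big1 ?mulr0 // => s _; rewrite mulr0.
Qed.

Lemma max_weight_sum (w : {poly F} -> C) :
    (forall s T, s \is monic -> T \is monic -> separable_poly s ->
      w (s * T ^+ 2) = (Phi T)%:R / q ^+ (size T).-1) -> forall m (b : bool),
  \sum_(g <- units F (m.*2 + b)) chi (subleading g) * w g =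
  \sum_(k < m.+1) Bsum k / q ^+ k * Ssqf ((m - k).*2 + b).
Proof.
move=> wE m b; rewrite (sum_units_weight wE).
rewrite (_ : (m.*2 + b)./2 = m); last by rewrite addnC half_bit_double.
apply: eq_bigr => k _; rewrite /Bsum !mulr_suml; apply: eq_big_seq => T.
rewrite mem_units => /and3P[_ _ /eqP ->].
rewrite doubleB addnBAC ?leq_double -1?ltnS //.
by rewrite -mulr_suml -/(Ssqf _) /=; ring.
Qed.

Definition Sroot c n : C := \sum_(s <- sqfs F n | ~~ root s c) chi (subleading s).

(** Splitting by whether [s] vanishes at [c] gives [(1 + chi(-c) u)] times the series of [Sroot c]
    as the squarefree series. *)
Lemma Sroot_rec c n : c != 0 -> Ssqf n.+1 = Sroot c n.+1 + chi (- c) * Sroot c n.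
Proof.
move=> c0; rewrite /Ssqf (bigID (fun s : {poly F} => root s c)) /= addrC; congr (_ + _).
rewrite sum_sqfs_root // mulr_sumr big_seq_cond [RHS]big_seq_cond; apply: eq_bigr => s.
rewrite mem_sqfs => /andP[/and4P[_ _ sm _] _].
by rewrite subleadingM ?monicXsubC // subleading_XsubC chiD.
Qed.

Lemma Ssqf0 : Ssqf 0 = 1.
Proof.
have := Eunits_sqf 0 false; rewrite Eunits0 // big_ord1 Esqr0 mul1r => <- //.
Qed.

Lemma Sroot0 c : Sroot c 0 = 1.
Proof.
rewrite -Ssqf0 /Ssqf /Sroot big_mkcond; apply: eq_big_seq => s.
rewrite mem_filter units0 inE => /andP[_ /eqP ->].
by rewrite root1.
Qed.

Lemma node_weight_sum (w : {poly F} -> C) d :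
    (forall s T, s \is monic -> T \is monic -> separable_poly s ->
      w (s * T ^+ 2) = ((size T == 2) && coprimep s T)%:R * d) -> forall n,
  \sum_(g <- units F n.+2) chi (subleading g) * w g =
  d * \sum_(c | c != 0) chi (- c) ^+ 2 * Sroot c n.
Proof.
move=> wE n; rewrite (sum_units_weight wE) 2!big_ord_recl [X in _ + (_ + X)]big1 ?addr0; last first.
  move=> k _; rewrite big1_seq // => T /andP[_]; rewrite mem_units => /and3P[_ _ /eqP ->].
  by rewrite big1 ?mulr0 // => s _; rewrite mul0r mulr0.
rewrite units0 big_seq1 [X in _ * X]big1 ?mulr0 ?add0r; last first.
  by move=> s _; rewrite size_poly1 mul0r mulr0.
rewrite /bump /= -[1%N.*2]/2%N subSS subn1 /= sum_units1 mulr_sumr; apply: eq_bigr => c c0.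
rewrite subleading_XsubC /Sroot size_XsubC eqxx /= mulrCA; congr (_ * _).
rewrite mulr_sumr [RHS]big_mkcond; apply: eq_bigr => s _.
by rewrite coprimep_XsubC; case: root => /=; ring.
Qed.

Lemma sum_char_exp j : \sum_(c | c != 0) chi (- c) ^+ j = q * (j%:R == 0 :> F)%:R - 1.
Proof.
have -> : \sum_(c | c != 0) chi (- c) ^+ j = \sum_c chi (- c) ^+ j - 1.
  by rewrite [X in _ = X - _](bigD1 0) //= oppr0 chi0 expr1n [1 + _]addrC addrK.
congr (_ - 1); rewrite (reindex_inj oppr_inj) /=.
have [j0|j0] := eqVneq (j%:R : F) 0.
  rewrite mulr1 -sum1_card natr_sum; apply: eq_bigr => c _.
  by rewrite opprK -chi_natmul // (_ : c *+ j = 0) ?chi0 // -mulr_natr j0 mulr0.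
rewrite mulr0 -[RHS](sum_nontrivial_char chiD chi_nt) [RHS](reindex_inj (mulIf j0)) /=.
by apply: eq_bigr => c _; rewrite opprK -chi_natmul // mulr_natr.
Qed.

Section Odd.
Hypothesis chi2_nt : exists y, chi y ^+ 2 != 1.

Let e1 : Esqr 1 = - 1.
Proof. by apply: Eunits1 => //; rewrite ?chi0 ?expr1n // => a b; rewrite chiD exprMn. Qed.
Let e2 n : Esqr n.+2 = 0.
Proof. by apply: Eunits_ge2 => //; rewrite ?chi0 ?expr1n // => a b; rewrite chiD exprMn. Qed.

(** Coefficients of [(1 - u) / (1 - u ^ 2) = 1 / (1 + u)]. *)
Lemma Ssqf_odd n : Ssqf n = (-1) ^+ n.
Proof.
have H m (b : bool) : Ssqf (m.*2 + b) = (-1) ^+ b.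
  elim: m => [|m IH].
    have := Eunits_sqf 0 b; rewrite big_ord1 Esqr0 mul1r => <-.
    by case: b; rewrite ?Eunits0 ?Eunits1 // expr1.
  have := Eunits_sqf m.+1 b; rewrite doubleS !addSn Eunits_ge2 //.
  rewrite (conv_two (fun i => Ssqf (i.*2 + b)) Esqr0 e1 e2) IH => /esym/eqP.
  by rewrite subr_eq0 doubleS !addSn => /eqP.
rewrite -{1}(odd_double_half n) addnC H -[in RHS](odd_double_half n) exprD -mul2n exprM.
by rewrite sqrrN !expr1n mulr1.
Qed.

(** Coefficients of [(1 - q z) / (1 - z)]. *)
Lemma Bsum_odd k : Bsum k.+1 = 1 - q.
Proof.
have B0 : Bsum 0 = 1 by have := Esqr_Bsum 0; rewrite big_ord1 Esqr0 !mul1r => <-; rewrite expr0.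
elim: k => [|k IH].
  have := Esqr_Bsum 1; rewrite (conv_two Bsum Esqr0 e1 e2) e1 B0 expr1 mulN1r => /eqP.
  by rewrite eq_sym subr_eq addrC => /eqP.
have := Esqr_Bsum k.+2; rewrite (conv_two Bsum Esqr0 e1 e2) e2 IH mul0r => /esym/eqP.
by rewrite subr_eq0 => /eqP.
Qed.

Lemma max_weight_odd (w : {poly F} -> C) :
    (forall s T, s \is monic -> T \is monic -> separable_poly s ->
      w (s * T ^+ 2) = (Phi T)%:R / q ^+ (size T).-1) -> forall n,
  \sum_(g <- units F n) chi (subleading g) * w g = (-1) ^+ n / q ^+ n./2.
Proof.
move=> wE n; rewrite -{1}(odd_double_half n) addnC max_weight_sum //.
(* With [B_0 = 1] and [B_k = 1 - q] afterwards, the sum telescopes. *)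
have H m : \sum_(k < m.+1) Bsum k / q ^+ k = (q ^+ m)^-1.
  elim: m => [|m IH].
    rewrite big_ord1; have := Esqr_Bsum 0; rewrite big_ord1 Esqr0 !mul1r => <-.
    by rewrite expr0 divr1 invr1.
  rewrite big_ord_recr /= IH Bsum_odd exprS; field.
  by rewrite expf_neq0 ?q_neq0.
under eq_bigr => k _ do rewrite Ssqf_odd exprD -mul2n exprM sqrrN !expr1n mul1r signr_odd.
by rewrite -mulr_suml H mulrC.
Qed.

Lemma node_weight_odd (w : {poly F} -> C) d :
    (forall s T, s \is monic -> T \is monic -> separable_poly s ->
      w (s * T ^+ 2) = ((size T == 2) && coprimep s T)%:R * d) -> forall n,
  \sum_(g <- units F n.+2) chi (subleading g) * w g =
  d * ((-1) ^+ n * \sum_(k < n.+1) (q * (k.+2%:R == 0 :> F)%:R - 1)).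
Proof.
move=> wE n; rewrite (node_weight_sum wE); congr (_ * _).
(* These are the coefficients of [1 / ((1 + u) (1 + chi(-c) u))]. *)
have H c : c != 0 -> Sroot c n = (-1) ^+ n * \sum_(k < n.+1) chi (- c) ^+ k.
  move=> c0; elim: n => [|n IH]; first by rewrite Sroot0 big_ord1 !expr0 mulr1.
  have -> : Sroot c n.+1 = (-1) ^+ n.+1 - chi (- c) * Sroot c n.
    by rewrite -Ssqf_odd (Sroot_rec n c0) addrK.
  rewrite IH.
  rewrite [in RHS]big_ord_recl expr0 mulrDr mulr1; congr (_ + _).
  rewrite [in RHS]exprS mulN1r mulNr; congr (- _); rewrite mulrCA; congr (_ * _).
  by rewrite mulr_sumr; apply: eq_bigr => i _; rewrite -exprS.
transitivity ((-1) ^+ n * \sum_(c | c != 0) \sum_(k < n.+1) chi (- c) ^+ k.+2).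
  rewrite mulr_sumr; apply: eq_bigr => c c0; rewrite H // mulrCA; congr (_ * _).
  by rewrite mulr_sumr; apply: eq_bigr => k _; rewrite -exprD add2n.
congr (_ * _); rewrite exchange_big; apply: eq_bigr => k _; exact: sum_char_exp.
Qed.

End Odd.

Section Two.
Hypotheses (chi2 : forall y, chi y ^+ 2 = 1) (F2 : #|F| = 2).

Let eS n : Esqr n.+1 = 2 ^+ n.
Proof.
rewrite /Eunits; under eq_bigr do rewrite chi2.
by rewrite big_const_seq count_predT iter_addr_0 size_units F2 mul1n natrX.
Qed.
Let eSS n : Esqr n.+2 = 2 * Esqr n.+1.
Proof. by rewrite !eS exprS. Qed.

Lemma Ssqf_two_small (b : bool) : Ssqf b = (-1) ^+ b.
Proof.
have := Eunits_sqf 0 b; rewrite big_ord1 Esqr0 mul1r => <-.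
by case: b; rewrite ?Eunits0 ?Eunits1 // expr1.
Qed.

(** The series is now [(1 - 2 u ^ 2) / (1 + u)]: compared with the odd case, the sign flips from
    degree 2 on. *)
Lemma Ssqf_two m (b : bool) : Ssqf (m.+1.*2 + b) = - (-1) ^+ b.
Proof.
have c0 : \sum_(j < 1) Esqr j * Ssqf ((0 - j).*2 + b) = (-1) ^+ b.
  by rewrite big_ord1 Esqr0 mul1r Ssqf_two_small.
have cS k : \sum_(j < k.+2) Esqr j * Ssqf ((k.+1 - j).*2 + b) = 0.
  by rewrite -Eunits_sqf doubleS !addSn Eunits_ge2.
elim: m => [|m IH].
  have := conv_geometric (fun i => Ssqf (i.*2 + b)) Esqr0 eSS 0.
  rewrite cS c0 eS expr0 Ssqf_two_small => /eqP; rewrite -subr_eq => /eqP <-.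
  by ring.
have := conv_geometric (fun i => Ssqf (i.*2 + b)) Esqr0 eSS m.+1.
rewrite !cS eS expr0 IH => /eqP; rewrite -subr_eq => /eqP <-.
by ring.
Qed.

(** Coefficients of [(1 - 2 z) ^ 2 / ((1 - z) (1 - 4 z))]. *)
Lemma Bsum_two k : Bsum k.+1 = (4 ^+ k.+1 - 1) / 3.
Proof.
have B0 : Bsum 0 = 1 by have := Esqr_Bsum 0; rewrite big_ord1 Esqr0 !mul1r => <-; rewrite expr0.
have q2 : q = 2 by rewrite F2.
elim: k => [|k IH].
  have := conv_geometric Bsum Esqr0 eSS 0.
  rewrite -!Esqr_Bsum q2 eS Esqr0 B0 !expr0 => /eqP; rewrite -subr_eq => /eqP <-.
  by field.
have := conv_geometric Bsum Esqr0 eSS k.+1.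
rewrite -!Esqr_Bsum q2 !eS IH expr0 => /eqP; rewrite -subr_eq => /eqP <-.
have -> : (4 : C) = 2 * 2 by ring.
by rewrite !exprMn !exprS; field.
Qed.

Lemma sqf_weight_two n : Ssqf n.+2 = - (-1) ^+ n.+2.
Proof.
have nE : n.+2 = (n./2.+1.*2 + odd n)%N by rewrite doubleS !addSn addnC odd_double_half.
by rewrite {1}nE Ssqf_two signr_odd !exprS !mulN1r opprK.
Qed.

Lemma max_weight_two (w : {poly F} -> C) :
    (forall s T, s \is monic -> T \is monic -> separable_poly s ->
      w (s * T ^+ 2) = (Phi T)%:R / q ^+ (size T).-1) -> forall n,
  \sum_(g <- units F n.+2) chi (subleading g) * w g = - ((-1) ^+ n / q ^+ n.+2./2).
Proof.
move=> wE n.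
have nE : n.+2 = (n./2.+1.*2 + odd n)%N by rewrite doubleS !addSn addnC odd_double_half.
(* The last term is set apart: there [s] has degree 0 or 1, where [Ssqf] has the sign opposite to
   all other terms. *)
rewrite {1}nE max_weight_sum // big_ord_recr /= subnn Ssqf_two_small.
under eq_bigr => k _ do rewrite subSn ?leq_ord // Ssqf_two.
rewrite -mulr_suml signr_odd.
have B0 : Bsum 0 = 1 by have := Esqr_Bsum 0; rewrite big_ord1 Esqr0 !mul1r => <-; rewrite expr0.
have q2 : q = 2 by rewrite F2.
have H m : Bsum m.+1 / q ^+ m.+1 - \sum_(k < m.+1) Bsum k / q ^+ k = - (q ^+ m.+1)^-1.
  rewrite q2; elim: m => [|m IH].
    by rewrite big_ord1 Bsum_two B0 !expr0 expr1; field.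
  rewrite big_ord_recr /=.
  have -> : \sum_(k < m.+1) Bsum k / 2 ^+ k = Bsum m.+1 / 2 ^+ m.+1 + (2 ^+ m.+1)^-1
    by move/eqP: IH; rewrite subr_eq => /eqP ->; ring.
  rewrite !Bsum_two [4 ^+ m.+2]exprS [2 ^+ m.+2]exprS; field.
  by rewrite expf_neq0 ?pnatr_eq0.
rewrite -mulrN1 mulrCA.
have -> : \sum_(k < n./2.+1) Bsum k / q ^+ k = Bsum n./2.+1 / q ^+ n./2.+1 + (q ^+ n./2.+1)^-1.
  by have := H n./2 => /eqP; rewrite subr_eq => /eqP ->; ring.
ring.
Qed.

End Two.

End WeightedSums.

(** * Characters of [F_p] and Fourier inversion *)

Section Characters.
Variables (R : realType) (p : nat) (p_pr : prime p).
Local Notation C := R[i].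

(** [R[i]] is algebraically closed, so [1 + X + ... + X ^ (p - 1)] has a root; it is not 1, where
    the value is [p]. *)
Lemma exists_prim_root : exists2 z : C, z != 1 & z ^+ p = 1.
Proof.
have p1 := prime_gt1 p_pr.
have [z] : exists z : C, root (\poly_(i < p) 1) z.
  apply/closed_rootP; rewrite size_poly_eq ?oner_neq0 //.
  by rewrite neq_ltn p1 orbT.
rewrite rootE horner_poly => /eqP z0; exists z.
  apply/eqP => z1; move: z0; rewrite z1.
  under eq_bigr do rewrite expr1n mulr1.
  rewrite sumr_const card_ord => /eqP; rewrite pnatr_eq0 => /eqP p0.
  by rewrite p0 in p1.
apply/eqP; rewrite -subr_eq0 subrX1.
under eq_bigr do rewrite -[_ ^+ _]mul1r.
by rewrite z0 mulr0.
Qed.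

Definition additive_char : 'F_p -> C :=
  let z := sval (cid2 exists_prim_root) in fun a => z ^+ (a : nat).

Local Notation e := additive_char.

Lemma charF_expn (z : C) n : z ^+ p = 1 -> z ^+ ((n%:R : 'F_p) : nat) = z ^+ n.
Proof.
move=> zp; rewrite val_Fp_nat // {2}(divn_eq n p) exprD mulnC exprM zp.
by rewrite expr1n mul1r.
Qed.

Lemma is_character_additive_char : is_character e.
Proof.
rewrite /e; case: cid2 => z z1 zp /=; split => // a b.
by rewrite -exprD -[RHS](charF_expn _ zp) natrD !natr_Zp.
Qed.

Lemma additive_char_mul (a : 'F_p) n : e (a *+ n) = e a ^+ n.
Proof.
have [e0 eD] := is_character_additive_char.
by elim: n => [|n IH]; rewrite ?mulr0n // mulrS eD IH exprS.
Qed.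

Lemma additive_char1 : e 1 != 1.
Proof. by rewrite /e; case: cid2 => z z1 zp /=; rewrite modn_small ?expr1 // Fp_cast ?prime_gt1. Qed.

Lemma additive_char_eq1 a : (e a == 1) = (a == 0).
Proof.
have [e0 eD] := is_character_additive_char.
have [->|a0] := eqVneq a 0; first by rewrite e0 eqxx.
apply/negbTE; apply: contraNneq additive_char1 => ea.
by rewrite -(mulVf a0) -[X in X * _]natr_Zp mulr_natl additive_char_mul ea expr1n.
Qed.

Lemma is_character_mul k : is_character (fun a : 'F_p => e (k * a)).
Proof.
have [e0 eD] := is_character_additive_char.
by split=> [|a b]; rewrite ?mulr0 // mulrDr eD.
Qed.

(** A character is determined by its value at 1, a [p]-th root of unity and hence a power of the
    primitive root that defines [e]. *)
Lemma characterE (chi : 'F_p -> C) :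
  is_character chi -> exists k, chi = fun a => e (k * a).
Proof.
move=> [c0 cD]; have cM a n : chi (a *+ n) = chi a ^+ n.
  by elim: n => [|n IH]; rewrite ?mulr0n // mulrS cD IH exprS.
have c1p : chi 1 ^+ p = 1 by rewrite -cM pchar_Fp_0.
have [k ck] : exists k : 'F_p, chi 1 = e k.
  rewrite /e; case: cid2 => z z1 zp /=.
  have z_prim : p.-primitive_root z.
    have [m mp dm] := prim_order_exists (prime_gt0 p_pr) zp.
    suff <- : m = p by [].
    apply/(prime_nt_dvdP p_pr) => //; apply: contraNneq z1 => m1.
    by have := prim_expr_order mp; rewrite m1 expr1 => ->.
  have [i ->] := prim_rootP z_prim c1p.
  by exists i%:R; rewrite charF_expn.
exists k; apply/funext => a.
by rewrite -[a in LHS]natr_Zp cM ck -additive_char_mul -mulr_natr natr_Zp.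
Qed.

(** Nonzero [k] parametrize the nontrivial characters, turning the sum over a set of functions into
    a finite sum over [F_p]. *)
Lemma eta_sum (b : 'F_p) : Defs.eta R b = \sum_(k : 'F_p | k != 0) e (k * - b).
Proof.
have [e0 eD] := is_character_additive_char.
rewrite /Defs.eta (reindex_fsbig (fun k a => e (k * a)) [set` (fun k : 'F_p => k != 0)]); last first.
  split => [k /= k0|k l _ _ /= kl|chi [/= /characterE[k ->]] /= k0].
  - split; first exact: is_character_mul.
    move=> /(congr1 (fun f => f 1)) /=; rewrite mulr1 => /eqP.
    by rewrite additive_char_eq1 (negPf k0).
  - have /(congr1 (fun f => f 1)) := kl; rewrite !mulr1 => ekl.
    apply/eqP; rewrite -subr_eq0 -additive_char_eq1 eD ekl -eD.
    by rewrite subrr e0.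
  - exists k => //=; apply/eqP => k00; apply: k0; apply/funext => a.
    by rewrite k00 mul0r e0.
rewrite -(@bigfs _ _ _ _ (index_enum 'F_p)) ?index_enum_uniq // => [|k _]; last by rewrite mem_index_enum.
apply: eq_bigr => k _; have ekb : e (k * b) != 0.
  by apply/eqP => ekb; have := e0; rewrite -(subrr (k * b)) eD ekb mul0r => /esym/eqP; rewrite oner_eq0.
by apply: (mulfI ekb); rewrite mulfV // -eD mulrN subrr.
Qed.

Lemma sum_additive_char (b : 'F_p) :
  \sum_(k : 'F_p | k != 0) e (k * b) = p%:R * (b == 0)%:R - 1.
Proof.
have [e0 eD] := is_character_additive_char.
have -> : \sum_(k : 'F_p | k != 0) e (k * b) = \sum_(k : 'F_p) e (k * b) - 1.
  by rewrite [X in _ = X - _](bigD1 0) //= mul0r e0 [1 + _]addrC addrK.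
congr (_ - 1); have [->|b0] := eqVneq b 0.
  under eq_bigr do rewrite mulr0 e0.
  by rewrite sumr_const card_Fp // mulr1.
rewrite mulr0 -[RHS](sum_nontrivial_char (chi := e)) //; last by exists 1; rewrite additive_char1.
by rewrite [RHS](reindex_inj (mulIf b0)).
Qed.

Lemma etaE (b : 'F_p) : Defs.eta R b = if b == 0 then p%:R - 1 else - 1.
Proof.
rewrite eta_sum sum_additive_char oppr_eq0.
by case: eqP => _; rewrite ?mulr1 ?mulr0 ?add0r.
Qed.

(* Fourier inversion on [F_p], when all nontrivial coefficients coincide. *)
Lemma sum_fiber_eta (I : Type) (r : seq I) (f : I -> 'F_p) (w : I -> C) (K : C) :
    (forall chi : 'F_p -> C, is_character chi -> (exists y, chi y != 1) ->
      \sum_(i <- r) chi (f i) * w i = K) ->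
  forall b, p%:R * \sum_(i <- r | f i == b) w i - \sum_(i <- r) w i = K * Defs.eta R b.
Proof.
move=> HK b; have [e0 eD] := is_character_additive_char.
rewrite eta_sum [RHS]mulr_sumr.
have E k : k != 0 -> K * e (k * - b) = \sum_(i <- r) e (k * (f i - b)) * w i.
  move=> k0; rewrite -(HK (fun a => e (k * a))); [|exact: is_character_mul|]; last first.
    by exists k^-1; rewrite mulfV // additive_char1.
  by rewrite mulr_suml; apply: eq_bigr => i _; rewrite mulrAC -eD -mulrDr.
rewrite (eq_bigr _ E).
rewrite [RHS]exchange_big /= [in LHS]big_mkcond [in LHS]mulr_sumr -sumrB; apply: eq_bigr => i _.
rewrite -mulr_suml sum_additive_char subr_eq0.
by case: eqP => _; rewrite ?mulr1 ?mulr0 ?add0r ?sub0r ?mulN1r // mulrBl mul1r.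
Qed.

End Characters.

(** * Reduction modulo p *)

Section PadicIntegers.
Variables (p : nat) (p_pr : prime p).
Local Notation Zp := (padic_int p_pr).
Local Notation red := (@reduction p p_pr).
Implicit Types x y : Zp.

Lemma intr_modFp (m : int) : ((m %% (p ^ 1)%N)%Z)%:~R = m%:~R :> 'F_p.
Proof.
rewrite [in RHS](divz_eq m (p ^ 1)%N) [in RHS]intrD [in RHS]intrM expn1.
by rewrite -[(Posz p)%:~R]/(p%:R) pchar_Fp_0 // mulr0 add0r.
Qed.

Fact reduction_is_additive : zmod_morphism red.
Proof. by move=> x y; rewrite /reduction /= intr_modFp intrD intr_modFp intrN. Qed.
Fact reduction_is_multiplicative : monoid_morphism red.
Proof. by split=> [|x y]; rewrite /reduction /= intr_modFp ?intrM. Qed.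
HB.instance Definition _ := GRing.isZmodMorphism.Build Zp 'F_p red reduction_is_additive.
HB.instance Definition _ := GRing.isMonoidMorphism.Build Zp 'F_p red reduction_is_multiplicative.

Definition plift (a : 'F_p) : Zp := (a : nat)%:R.

Lemma pliftK : cancel plift red.
Proof. by move=> a; rewrite /plift rmorph_nat natr_Zp. Qed.

Lemma plift0 : plift 0 = 0.
Proof. by []. Qed.

Lemma plift1 : plift 1 = 1.
Proof. by rewrite /plift /= modn_small // Fp_cast // prime_gt1. Qed.

Lemma residue_natr n k : (n%:R : Zp) k = (Posz n %% (p ^ k)%N)%Z.
Proof.
elim: n => [|n IH]; first by [].
by rewrite -addn1 natrD /= IH modzDm.
Qed.

Lemma residueM x y k : (x * y) k = (x k * y k %% (p ^ k)%N)%Z.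
Proof. by []. Qed.

Lemma natr_padic_eq0 n : ((n%:R : Zp) == 0) = (n == 0%N).
Proof.
case: n => [|n]; first by rewrite mulr0n !eqxx.
apply/eqP => /(congr1 (fun x : Zp => x n.+1)); rewrite residue_natr [RHS]mod0z.
by rewrite modz_small // ltz_nat /= ltn_expl // prime_gt1.
Qed.

Lemma p_neq0 : (p%:R : Zp) != 0.
Proof. by rewrite natr_padic_eq0 -lt0n prime_gt0. Qed.

Fact padic_shift_subproof x k :
  (((x k.+2 %/ p)%Z %% (p ^ k)%N)%Z = ((x k.+1 %/ p)%Z %% (p ^ k)%N)%Z).
Proof.
rewrite (padic_residueE x k.+1) [in LHS](divz_eq (x k.+2) (p ^ k.+1)%N).
have -> : (Posz (p ^ k.+1) = Posz (p ^ k) * Posz p) by rewrite -PoszM expnSr.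
by rewrite mulrA divzMDl ?modzMDl // -lt0n prime_gt0.
Qed.

(** Division by [p]; its residue mod [p ^ k] needs one more digit of [x]. *)
Definition padic_shift x : Zp :=
  @padic_of p p_pr (fun k => (x k.+1 %/ p)%Z) (padic_shift_subproof x).

Lemma reduction_eq0 x : (red x == 0) = `[< pdvd 1 x >].
Proof.
apply/idP/asboolP => [/eqP x0|[y ->]]; last first.
  by rewrite rmorphM rmorphXn rmorph_nat pchar_Fp_0 // expr1 mul0r.
exists (padic_shift x); apply: padic_eqP => k.
rewrite expr1 residueM residue_natr modzMml [padic_shift x k]/= modzMmr.
have : (p %| x k.+1)%Z.
  have x1 : (x k.+1 %% (p ^ 1)%N)%Z = x 1%N by rewrite -[in RHS](padic_residueD x 1 k) addn1.
  apply/dvdz_mod0P; rewrite -[X in (_ %% Posz X)%Z]expn1 x1.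
  have : (x 1%N %% p)%Z = x 1%N by have := padic_modz x 1; rewrite expn1.
  move: x0; rewrite /reduction; case: (x 1%N) => m //.
    rewrite -[(Posz m)%:~R]/(m%:R) => /(congr1 val) /=; rewrite val_Fp_nat // => m0.
    by rewrite modz_nat m0 => <-.
  by move=> _ H; have := @modz_ge0 (Negz m) p; rewrite H -lt0n prime_gt0 // => /(_ isT).
move=> pd; rewrite mulrC divzK //; apply: padic_residueE.
Qed.

Lemma reduction_eq0P x : red x = 0 <-> exists y, x = p%:R * y.
Proof.
split=> [/eqP|[y ->]].
  by rewrite reduction_eq0 => /asboolP[y]; rewrite expr1; exists y.
by rewrite rmorphM rmorph_nat pchar_Fp_0 // mul0r.
Qed.

Lemma padic_decomp x : exists y, x = plift (red x) + p%:R * y.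
Proof.
have /reduction_eq0P[y yE] : red (x - plift (red x)) = 0 by rewrite rmorphB /= pliftK subrr.
by exists y; rewrite -yE addrC subrK.
Qed.

Lemma padic_unitE x : red x != 0 -> exists y, y * x = 1.
Proof.
move=> x0.
have cop k : coprimez (x k) (p ^ k)%N.
  rewrite /coprimez; case: k => [|k]; first by rewrite gcdz1.
  rewrite -/(coprimez _ _) coprimezE /= coprime_sym coprimeXl //.
  rewrite prime_coprime //; apply: contra x0 => pd; rewrite reduction_eq0.
  have x1 : (x k.+1 %% (p ^ 1)%N)%Z = x 1%N by rewrite -[in RHS](padic_residueD x 1 k) addn1.
  rewrite -reduction_eq0 /reduction -x1 intr_modFp.
  have /dvdzP[m ->] : (p %| x k.+1)%Z by rewrite dvdzE.
  by rewrite intrM [(Posz p)%:~R]pchar_Fp_0 // mulr0.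
have inv k : exists u, (u * x k %% (p ^ k)%N)%Z = (1 %% (p ^ k)%N)%Z.
  have [u [v e]] := Bezoutz (x k) (p ^ k)%N; exists u.
  by move/eqP: (cop k) => /= g1; rewrite -(modzMDl v) addrC e g1.
have [u uE] := choice inv.
(* Both residues are inverses of [x k] modulo [p ^ k], and such an inverse is unique. *)
have coh k : (u k.+1 %% (p ^ k)%N)%Z = (u k %% (p ^ k)%N)%Z.
  have e1 : (u k.+1 * x k %% (p ^ k)%N)%Z = (1 %% (p ^ k)%N)%Z.
    have /(congr1 (fun m => (m %% (p ^ k)%N)%Z)) := uE k.+1.
    rewrite !modz_exp // => <-; rewrite (padic_residueE x k) modzMmr; by [].
  transitivity ((u k.+1 * (u k * x k)) %% (p ^ k)%N)%Z.
    by rewrite -modzMmr uE modzMmr mulr1.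
  by rewrite mulrCA -modzMmr e1 modzMmr mulr1.
exists (@padic_of p p_pr u coh); apply: padic_eqP => k.
by rewrite residueM [padic_of _ _ _]/= modzMml uE.
Qed.

(** If [x] is nonzero mod [p ^ K], at most [K] divisions by [p] reach a unit. *)
Lemma padic_factor x : x != 0 -> exists k u, x = p%:R ^+ k * u /\ red u != 0.
Proof.
move=> x0; have [K xK] : exists K, x K != 0.
  apply: contrapT => H; move/eqP: x0; apply; apply: padic_eqP => k /=; rewrite mod0z.
  by apply/eqP/negPn/negP => xk; apply: H; exists k.
elim: K x xK {x0} => [|K IH] x xK.
  by move: xK; rewrite -padic_modz expn0 modz1.
have [xr|] := eqVneq (red x) 0; last by exists 0%N, x; rewrite expr0 mul1r.
have [y yE] := (reduction_eq0P x).1 xr.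
have /IH[k [u [yu u0]]] : y K != 0.
  apply: contraNneq xK; rewrite yE residueM residue_natr modzMml padic_residueE => /eqP yK.
  apply/eqP/dvdz_mod0P; rewrite expnS PoszM; apply: dvdz_mul => //.
  exact/dvdz_mod0P/eqP.
by exists k.+1, u; rewrite yE yu exprS mulrA.
Qed.

End PadicIntegers.

(** * Polynomials modulo [p] and the square of the ideal [(p, t)] *)

Section PolyReduction.
Variables (p : nat) (p_pr : prime p).
Local Notation Zp := (padic_int p_pr).
Local Notation red := (@reduction p p_pr).
Local Notation plift := (@plift p p_pr).
Implicit Types (f g h : {poly Zp}) (s t u v T : {poly 'F_p}).

Definition redp f : {poly 'F_p} := map_poly red f.
Definition liftp t : {poly Zp} := map_poly plift t.

Lemma plift_eq0 a : (plift a == 0) = (a == 0).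
Proof.
apply/eqP/eqP => [a0|->]; last exact: plift0.
by rewrite -[a](pliftK p_pr) a0 rmorph0.
Qed.

Lemma coef_liftp t i : (liftp t)`_i = plift t`_i.
Proof. by rewrite coef_map_id0 // plift0. Qed.

Lemma coef_redp f i : (redp f)`_i = red f`_i.
Proof. exact: coef_map. Qed.

Lemma liftpK : cancel liftp redp.
Proof. by move=> t; apply/polyP => i; rewrite coef_redp coef_liftp pliftK. Qed.

Lemma size_liftp t : size (liftp t) = size t.
Proof.
have [->|t0] := eqVneq t 0; first by rewrite /liftp map_polyE polyseq0 size_poly0.
by rewrite size_map_poly_id0 // plift_eq0 lead_coef_eq0.
Qed.

Lemma liftp_monic t : t \is monic -> liftp t \is monic.
Proof.
by move=> /monicP tm; rewrite monicE /lead_coef size_liftp coef_liftp -[_`__]/(lead_coef t) tm plift1.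
Qed.

Lemma size_redp f : f \is monic -> size (redp f) = size f.
Proof.
by move=> /monicP fm; rewrite /redp size_map_poly_id0 // fm rmorph1 oner_neq0.
Qed.

Lemma redp_monic f : f \is monic -> redp f \is monic.
Proof.
move=> fm; rewrite monicE /lead_coef size_redp // coef_redp.
by move/monicP: fm; rewrite /lead_coef => ->; rewrite rmorph1.
Qed.

Lemma redp_p f : redp (p%:R * f) = 0.
Proof.
by rewrite /redp rmorphM /= rmorph_nat -polyC_natr pchar_Fp_0 // mul0r.
Qed.

Lemma redp_eq0 f : redp f = 0 -> exists2 g, f = p%:R * g & (size g <= size f)%N.
Proof.
move=> f0; have H i : exists y, f`_i = p%:R * y.
  by apply/reduction_eq0P; rewrite -coef_redp f0 coef0.
have [y yE] := choice H.
exists (\poly_(i < size f) y i); last exact: size_poly.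
apply/polyP => i; rewrite mulr_natl coefMn coef_poly -mulr_natl.
case: ltnP => // fi; by rewrite mulr0 nth_default.
Qed.

Lemma redp_eq f g : redp f = redp g -> exists h, f = g + p%:R * h.
Proof.
move=> fg; have /redp_eq0[h hE _] : redp (f - g) = 0 by rewrite /redp rmorphB /= -/(redp f) fg subrr.
by exists h; rewrite -hE addrC subrK.
Qed.

Lemma redp_decomp f : exists h, f = liftp (redp f) + p%:R * h.
Proof. by apply: redp_eq; rewrite liftpK. Qed.

Lemma p_polyI f g : p%:R * f = p%:R * g -> f = g.
Proof.
by apply: mulfI; rewrite -polyC_natr polyC_eq0 p_neq0.
Qed.

(* [f] belongs to the square of the ideal [(p, t)] of [Z_p[x]]. *)
Definition in_sqr_ideal t f := exists a b c,
  f = liftp t ^+ 2 * a + p%:R * (liftp t * b) + p%:R ^+ 2 * c.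

Lemma in_sqr_ideal_add t f g : in_sqr_ideal t f -> in_sqr_ideal t g -> in_sqr_ideal t (f + g).
Proof.
move=> [a [b [c ->]]] [a' [b' [c' ->]]].
by exists (a + a'), (b + b'), (c + c'); ring.
Qed.

Lemma in_sqr_ideal_opp t f : in_sqr_ideal t f -> in_sqr_ideal t (- f).
Proof.
move=> [a [b [c ->]]]; exists (- a), (- b), (- c); ring.
Qed.

Lemma in_sqr_ideal_p t f : t != 0 -> in_sqr_ideal t (p%:R * f) -> t %| redp f.
Proof.
move=> t0 [a [b [c fE]]].
have a0 : redp a = 0.
  have /(congr1 redp) := fE; rewrite redp_p /redp !rmorphD !rmorphM /= rmorph_nat.
  rewrite -[map_poly red (liftp t)]/(redp _) liftpK.
  rewrite -!polyC_natr pchar_Fp_0 // !mul0r !addr0 => /esym/eqP.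
  by rewrite mulf_eq0 mulf_eq0 (negPf t0) /= => /eqP.
have [a' aE _] := redp_eq0 a0.
have -> : f = liftp t ^+ 2 * a' + liftp t * b + p%:R * c.
  by apply: p_polyI; rewrite fE aE; ring.
rewrite /redp !rmorphD !rmorphM /= rmorph_nat -polyC_natr pchar_Fp_0 // mul0r addr0.
rewrite -[map_poly red (liftp t)]/(redp _) liftpK.
by rewrite dvdp_add // ?dvdp_mulr.
Qed.

(** Membership read mod [p] gives [t ^ 2 | s T ^ 2], so [t | T]. The first term then lies in
    [(p, t) ^ 2], hence so does [p v], which means [t | v]. Conversely the monic gcd of [T] and [v]
    serves as [t]. *)
Lemma in_sqr_ideal_criterion s T v f c : s \is monic -> T \is monic -> separable_poly s ->
  f = liftp s * liftp T ^+ 2 + p%:R * liftp v + p%:R ^+ 2 * c ->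
  (exists t, [/\ t \is monic, (1 < size t)%N & in_sqr_ideal t f]) <-> ~~ coprimep T v.
Proof.
move=> sm Tm s_sep fE.
have redf : redp f = s * T ^+ 2.
  rewrite fE /redp !rmorphD !rmorphM /= !rmorph_nat -polyC_natr pchar_Fp_0 //.
  by rewrite !mul0r !addr0 -/(redp _) -/(redp _) !liftpK.
have dvd_in t : t %| T -> in_sqr_ideal t (liftp s * liftp T ^+ 2).
  move=> /dvdpP[T' TE]; have [h ->] : exists h, liftp T = liftp T' * liftp t + p%:R * h.
    by apply: redp_eq; rewrite /redp rmorphM /= -!/(redp _) !liftpK.
  by exists (liftp s * liftp T' ^+ 2), (liftp s * liftp T' * h *+ 2), (liftp s * h ^+ 2); ring.
have pp_in t : in_sqr_ideal t (p%:R ^+ 2 * c) by exists 0, 0, c; ring.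
split=> [[t [tm t1 tf]]|].
  have t0 := monic_neq0 tm.
  have tT : t %| T.
    rewrite -(sqr_dvd_sqf t s_sep) ?monic_neq0 // -redf.
    case: tf => [a [b [d ->]]]; rewrite /redp !rmorphD !rmorphM /= !rmorph_nat -polyC_natr pchar_Fp_0 //.
    by rewrite !mul0r !addr0 -/(redp _) -/(redp _) liftpK dvdp_mulr.
  have tv : t %| v.
    rewrite -[v]liftpK; apply: in_sqr_ideal_p => //.
    have -> : p%:R * liftp v = f + - (liftp s * liftp T ^+ 2) + - (p%:R ^+ 2 * c).
      by rewrite fE; ring.
    apply: in_sqr_ideal_add; last exact: in_sqr_ideal_opp.
    by apply: in_sqr_ideal_add => //; apply/in_sqr_ideal_opp/dvd_in.
  rewrite coprimep_def neq_ltn; apply/orP; right; apply: leq_trans t1 _.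
  by apply: dvdp_leq; rewrite ?dvdp_gcd ?tT // gcdp_eq0 negb_and monic_neq0.
rewrite coprimep_def => g1; have g0 : gcdp T v != 0 by rewrite gcdp_eq0 negb_and monic_neq0.
have [d d0 tm] := monic_scale g0.
exists (d *: gcdp T v); split => //.
  by rewrite size_scale // ltn_neqAle eq_sym g1 size_poly_gt0.
rewrite fE; apply: in_sqr_ideal_add => //; apply: in_sqr_ideal_add.
  by apply: dvd_in; rewrite dvdpZl // dvdp_gcdl.
have /dvdpP[w vE] : d *: gcdp T v %| v by rewrite dvdpZl // dvdp_gcdr.
have [h ->] : exists h, liftp v = liftp w * liftp (d *: gcdp T v) + p%:R * h.
  by apply: redp_eq; rewrite /redp rmorphM /= -!/(redp _) !liftpK.
by exists 0, (liftp w), h; ring.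
Qed.

End PolyReduction.

(** * Dedekind's criterion *)

Section FractionPolynomials.
Variable A : idomainType.
Implicit Types (f g h : {poly A}).

Lemma fraction_denominator (x : {fraction A}) :
  exists d n : A, d != 0 /\ tofrac d * x = tofrac n.
Proof.
elim/quotW: x => y; exists (y : A * A).2, (y : A * A).1; split; first exact: denom_ratioP.
rewrite -[LHS]/(FracField.mul _ _) !piE; apply/eqmodP.
rewrite /= FracField.equivfE /FracField.mulf !numden_Ratio ?mulf_neq0 ?oner_neq0 ?denom_ratioP //.
by rewrite mulr1 mul1r mulrC.
Qed.

Lemma fraction_poly_denominator (s : {poly {fraction A}}) :
  exists (d : A) g, d != 0 /\ tofrac d *: s = map_poly (@tofrac A) g.
Proof.
elim/poly_ind: s => [|s c [d [g [d0 dg]]]].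
  by exists 1, 0; rewrite oner_neq0 scaler0 rmorph0.
have [e [n [e0 en]]] := fraction_denominator c.
exists (d * e), (e *: g * 'X + (d * n)%:P); split; first by rewrite mulf_neq0.
rewrite [RHS]rmorphD [X in _ = X + _]rmorphM /= map_polyX map_polyC map_polyZ /= -dg.
rewrite scalerDr scale_polyC rmorphM /= -mulrA en tofracM; congr (_ + _).
by rewrite -!scalerAl scalerA [tofrac e * _]mulrC.
Qed.

Lemma size_map_tofrac g : size (map_poly (@tofrac A) g) = size g.
Proof. by rewrite size_map_inj_poly ?tofrac0 // => x y /eqP; rewrite tofrac_eq => /eqP. Qed.

End FractionPolynomials.

(** * Irreducible factors over a field *)

Section PrimeFactor.
Variable F : fieldType.
Implicit Types (f g h s t u v : {poly F}).

Lemma irreducible_factor f : (1 < size f)%N ->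
  exists s, [/\ s \is monic, irreducible_poly s & s %| f].
Proof.
have [n] := ubnP (size f); elim: n f => // n IH f f_n f1.
have f0 : f != 0 by rewrite -size_poly_gt0 ltnW.
have [irr|nirr] := pselect (irreducible_poly f).
  have l0 : (lead_coef f)^-1 != 0 by rewrite invr_eq0 lead_coef_eq0.
  exists ((lead_coef f)^-1 *: f); split.
  - by rewrite monicE lead_coefZ mulVf // lead_coef_eq0.
  - split=> [|q q1 qf]; first by rewrite size_scale.
    rewrite (eqp_rtrans (eqp_scale _ l0)); apply: irr.2 => //.
    by rewrite -(dvdpZr _ _ l0).
  - by rewrite dvdpZl.
have [q [q1 qf nq]] : exists q : {poly F}, [/\ size q != 1, q %| f & ~~ (q %= f)].
  apply: contrapT => H; apply: nirr; split=> // q q1 qf.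
  by apply: contrapT => nq; apply: H; exists q; split => //; apply/negP.
have q0 : q != 0 by apply: contraTneq qf => ->; rewrite dvd0p.
have q_gt1 : (1 < size q)%N by rewrite ltn_neqAle eq_sym q1 size_poly_gt0.
have qlt : (size q < size f)%N.
  by rewrite ltn_neqAle (dvdp_leq f0 qf) andbT (dvdp_size_eqp qf) nq.
have [||s [sm sirr sq]] := IH q => //; first exact: leq_trans qlt _.
by exists s; split => //; apply: dvdp_trans qf.
Qed.

Lemma irreducible_dvdM s u v : irreducible_poly s -> (s %| u * v) = (s %| u) || (s %| v).
Proof.
move=> sirr; apply/idP/orP => [suv|[su|sv]]; [|exact: dvdp_mulr|exact: dvdp_mull].
have [co|nco] := boolP (coprimep s u).
  by right; rewrite -(Gauss_dvdpr _ co).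
left; have := sirr.2 (gcdp s u); rewrite -coprimep_def nco dvdp_gcdl => /(_ isT isT) e.
by rewrite -(eqp_dvdl _ e) dvdp_gcdr.
Qed.

Lemma irreducible_dvdX s u n : irreducible_poly s -> s %| u ^+ n -> s %| u.
Proof.
move=> sirr; elim: n => [|n IH].
  by rewrite expr0 dvdp1 => /eqP s1; have := sirr.1; rewrite s1.
by rewrite exprS irreducible_dvdM // => /orP[].
Qed.

(** Some irreducible [s] has larger multiplicity in [f] than in [h]: any irreducible factor of the
    cofactor of [f] over the gcd will do, since it is prime to the cofactor of [h]. *)
Lemma not_dvdp_irreducible f h : f != 0 -> ~~ (f %| h) ->
  exists s j, [/\ s \is monic, irreducible_poly s, s ^+ j %| h, ~~ (s ^+ j.+1 %| h) & s ^+ j.+1 %| f].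
Proof.
move=> f0 fh; have h0 : h != 0 by apply: contraNneq fh => ->; rewrite dvdp0.
have g0 : gcdp f h != 0 by rewrite gcdp_eq0 (negPf f0).
have /dvdpP[f' fE] := dvdp_gcdl f h.
have /dvdpP[h' hE] := dvdp_gcdr f h.
have f'0 : f' != 0 by apply: contraNneq f0 => f'0; rewrite fE f'0 mul0r.
have f'1 : (1 < size f')%N.
  rewrite ltnNge; apply: contra fh => f'1.
  rewrite fE (eqp_dvdl _ (_ : _ %= gcdp f h)) ?dvdp_gcdr //.
  have /size_poly1P[c c0 ->] : size f' == 1 by rewrite eqn_leq f'1 size_poly_gt0.
  by rewrite mul_polyC eqp_scale.
have co : coprimep f' h'.
  have : gcdp f' h' * gcdp f h %= 1 * gcdp f h.
    by rewrite mul1r (eqp_trans (mulp_gcdl _ _ _)) // -fE -hE eqpxx.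
  by rewrite eqp_mul2r // gcdp_eqp1.
have [s [sm sirr sf']] := irreducible_factor f'1.
have exj : exists j, s ^+ j %| h by exists 0%N; rewrite expr0 dvd1p.
have bnd j : s ^+ j %| h -> (j <= size h)%N.
  move=> /(dvdp_leq h0); apply: leq_trans.
  have := size_exp s j; case: (size (s ^+ j)) => [|k] /= ->.
    by have := sirr.1; case: (size s) => [|[|k]] //= _; rewrite mulSn leq_addr.
  have := sirr.1; case: (size s) => [|[|l]] //= _; rewrite mulSn.
  by rewrite -addSn (leq_trans (leqnSn _)) // leq_addr.
case: (ex_maxnP exj bnd) => j sj jmax.
exists s, j; split => //; first by apply/negP => /jmax; rewrite ltnn.
have sh' : coprimep (s ^+ j) h'.
  by rewrite coprimep_expl //; rewrite coprimep_sym (coprimep_dvdl sf') // coprimep_sym.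
rewrite fE exprS dvdp_mul // -(Gauss_dvdpr _ sh') -hE //.
Qed.

End PrimeFactor.

(** * The order [Z_p[x] / (f)] inside [Q_p[x] / (f)] *)

Section EquationOrder.
Variables (p : nat) (p_pr : prime p).
Local Notation Zp := (padic_int p_pr).
Implicit Types (g h r : {poly Zp}).
Variables (n : nat) (f : {poly Zp}).
Hypotheses (f_monic : f \is monic) (size_f : size f = n.+2).

Local Notation K := {poly %/ frac_poly f}.
Definition cls g : K := in_qpoly (frac_poly f) (frac_poly g).

Lemma clsD g h : cls (g + h) = cls g + cls h.
Proof. by rewrite /cls /frac_poly rmorphD rmorphD. Qed.
Lemma clsN g : cls (- g) = - cls g.
Proof. by rewrite /cls /frac_poly rmorphN rmorphN. Qed.
Lemma clsM g h : cls (g * h) = cls g * cls h.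
Proof. by rewrite /cls /frac_poly rmorphM rmorphM. Qed.
Lemma cls1 : cls 1 = 1.
Proof. by rewrite /cls /frac_poly rmorph1 rmorph1. Qed.
Lemma cls0 : cls 0 = 0.
Proof. by rewrite /cls /frac_poly rmorph0 rmorph0. Qed.
Lemma clsX g k : cls (g ^+ k) = cls g ^+ k.
Proof. by rewrite /cls /frac_poly rmorphXn rmorphXn. Qed.
Lemma clsZ c g : cls (c *: g) = tofrac c *: cls g.
Proof. by rewrite /cls /frac_poly map_polyZ linearZ. Qed.
Lemma cls_sum (I : Type) (s : seq I) (F : I -> {poly Zp}) :
  cls (\sum_(i <- s) F i) = \sum_(i <- s) cls (F i).
Proof. by rewrite /cls /frac_poly rmorph_sum rmorph_sum. Qed.

(** The quotient construction guards its modulus with [mk_monic]; for monic [f] of positive degree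
    the modulus really is [f]. *)
Lemma mk_monic_frac : mk_monic (frac_poly f) = frac_poly f.
Proof.
rewrite /mk_monic /frac_poly size_map_tofrac size_f /= monicE lead_coef_map_eq //.
  by rewrite (monicP f_monic) /= tofrac1 eqxx.
by rewrite (monicP f_monic) /= tofrac1 oner_neq0.
Qed.

Lemma cls_f : cls f = 0.
Proof. apply: val_inj => /=; have := monic_mk_monic (frac_poly f).
by rewrite mk_monic_frac => fm; rewrite Pdiv.RingMonic.rmodpp. Qed.

Lemma cls_mod g : exists2 r, cls g = cls r & exists h, g = h * f + r /\ (size r < size f)%N.
Proof.
exists (Pdiv.Ring.rmodp g f).
  rewrite {1}(Pdiv.RingMonic.rdivp_eq f_monic g) clsD clsM cls_f mulr0 add0r //.
exists (Pdiv.Ring.rdivp g f); rewrite -Pdiv.RingMonic.rdivp_eq //; split => //.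
by apply: Pdiv.Ring.ltn_rmodpN0; rewrite monic_neq0.
Qed.

Lemma cls_eq0 g : cls g = 0 -> exists h, g = h * f.
Proof.
have [r -> [h [gE rf]]] := cls_mod g.
move=> /(congr1 (fun x : K => x : {poly _})); rewrite /cls in_qpoly_small; last first.
  by rewrite mk_monic_frac /frac_poly !size_map_tofrac.
move=> r0; exists h; rewrite gE (_ : r = 0) ?addr0 //.
by apply/eqP; rewrite -size_poly_eq0 -(size_map_tofrac r) -/(frac_poly r) r0 size_poly0.
Qed.

Lemma cls_denominator (x : K) : exists d g, d != 0 /\ tofrac d *: x = cls g.
Proof.
have [d [g [d0 dg]]] := fraction_poly_denominator x.
exists d, g; split => //; rewrite /cls /frac_poly -dg linearZ /=; congr (_ *: _).
apply/esym/val_inj; exact: in_qpoly_small (size_mk_monic x).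
Qed.

Definition zspan (s : seq K) : set K :=
  [set x | exists c : 'I_(size s) -> Zp, x = \sum_(i < size s) tofrac (c i) *: s`_i].

Lemma zspanP s x : zspan s x <-> exists c : nat -> Zp, x = \sum_(0 <= i < size s) tofrac (c i) *: s`_i.
Proof.
split=> -[c ->]; last by exists (fun i => c i); rewrite big_mkord.
exists (fun i => if insub i is Some j then c j else 0); rewrite big_mkord.
by apply: eq_bigr => i _; rewrite valK.
Qed.

Lemma zspan_cat s t : zspan (s ++ t) = [set x | exists y z, [/\ zspan s y, zspan t z & x = y + z]].
Proof.
apply/seteqP; split=> x /=.
  move=> /zspanP[c ->]; rewrite size_cat.
  rewrite (@big_cat_nat _ _ _ (size s)) ?leq_addr //=.
  exists (\sum_(0 <= i < size s) tofrac (c i) *: s`_i), (\sum_(0 <= i < size t) tofrac (c (size s + i)%N) *: t`_i).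
  split; [by apply/zspanP; exists c | by apply/zspanP; exists (fun i => c (size s + i)%N) |].
  congr (_ + _); first by apply: eq_big_nat => i /andP[_ i_s]; rewrite nth_cat i_s.
  rewrite -{1}[size s]add0n big_addn addKn; apply: eq_big_nat => i _.
  by rewrite nth_cat addnC ltnNge leq_addr /= addKn.
move=> [y [z [/zspanP[c ->] /zspanP[d ->] ->]]]; apply/zspanP.
exists (fun i => if (i < size s)%N then c i else d (i - size s)%N).
rewrite size_cat [RHS](@big_cat_nat _ _ _ (size s)) ?leq_addr //=.
congr (_ + _); first by apply: eq_big_nat => i /andP[_ i_s]; rewrite nth_cat i_s.
rewrite -{1}[size s]add0n big_addn addKn; apply: eq_big_nat => i _.
by rewrite nth_cat addnC ltnNge leq_addr /= addKn.
Qed.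

Lemma zspan_scale_mul (y : K) s : zspan [seq x * y | x <- s] = [set x * y | x in zspan s].
Proof.
have E (c : nat -> Zp) : \sum_(0 <= i < size [seq x * y | x <- s]) tofrac (c i) *: [seq x * y | x <- s]`_i =
    (\sum_(0 <= i < size s) tofrac (c i) *: s`_i) * y.
  rewrite size_map mulr_suml; apply: eq_big_nat => i /andP[_ i_s].
  by rewrite (nth_map 0) // scalerAl.
apply/seteqP; split=> x /=.
  move=> /zspanP[c ->]; exists (\sum_(0 <= i < size s) tofrac (c i) *: s`_i); last by rewrite E.
  by apply/zspanP; exists c.
by move=> [_ /zspanP[c ->] <-]; apply/zspanP; exists c.
Qed.

Definition power_basis : seq K := [seq cls 'X^i | i <- iota 0 n.+1].

Lemma equation_order_span : equation_order f = zspan power_basis.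
Proof.
have E (c : nat -> Zp) : \sum_(0 <= i < size power_basis) tofrac (c i) *: power_basis`_i = cls (\poly_(i < n.+1) c i).
  rewrite size_map size_iota poly_def -(big_mkord xpredT (fun i => c i *: 'X^i)) cls_sum.
  apply: eq_big_nat => i /andP[_ ni].
  by rewrite (nth_map 0%N) ?size_iota // nth_iota // clsZ.
apply/seteqP; split=> x; last by move=> /zspanP[c ->]; rewrite E; exists (\poly_(i < n.+1) c i).
move=> [g _ <-]; rewrite -/(cls g); have [r -> [h [_ rf]]] := cls_mod g.
apply/zspanP; exists (fun i => r`_i); rewrite E; congr cls.
apply/polyP => i; rewrite coef_poly; case: ltnP => // ni.
by rewrite nth_default // (leq_trans _ ni) // -ltnS -size_f.
Qed.

Lemma equation_orderP x : equation_order f x <-> exists g, x = cls g.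
Proof. by split=> [[g _ <-]|[g ->]]; exists g. Qed.

Lemma equation_order_is_order : is_order (equation_order f).
Proof.
split.
- by apply/equation_orderP; exists 1; rewrite cls1.
- move=> _ _ /equation_orderP[g ->] /equation_orderP[h ->]; apply/equation_orderP.
  by exists (g - h); rewrite clsD clsN.
- move=> _ _ /equation_orderP[g ->] /equation_orderP[h ->]; apply/equation_orderP.
  by exists (g * h); rewrite clsM.
- by exists power_basis; rewrite equation_order_span.
- move=> x; have [d [g [d0 dg]]] := cls_denominator x.
  by exists d => //; rewrite dg; apply/equation_orderP; exists g.
Qed.

End EquationOrder.

(** * Both directions of Dedekind's criterion *)

Section Dedekind.
Variables (p : nat) (p_pr : prime p).
Local Notation Zp := (padic_int p_pr).
Implicit Types (g h r : {poly Zp}) (s t u v : {poly 'F_p}).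

Lemma redpD g h : redp (g + h) = redp g + redp h. Proof. exact: rmorphD. Qed.
Lemma redpB g h : redp (g - h) = redp g - redp h. Proof. exact: rmorphB. Qed.
Lemma redpM g h : redp (g * h) = redp g * redp h. Proof. exact: rmorphM. Qed.
Lemma redpX g k : redp (g ^+ k) = redp g ^+ k. Proof. exact: rmorphXn. Qed.

(** Each division by [p] lowers the valuation of the leading coefficient, so it must stop. *)
Lemma poly_factor_p g : g != 0 -> exists k h, [/\ g = p%:R ^+ k * h, redp h != 0 & size h = size g].
Proof.
move=> g0; have l0 : lead_coef g != 0 by rewrite lead_coef_eq0.
have [k [u [gu u0]]] := padic_factor l0.
elim: k g g0 gu {l0} => [|k IH] g g0 gu.
  exists 0%N, g; rewrite expr0 mul1r; split => //.
  apply: contraNneq u0 => /(congr1 (fun v : {poly 'F_p} => v`_(size g).-1)).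
  by rewrite coef_redp coef0 -[g`__]/(lead_coef g) gu expr0 mul1r => ->.
have [r0|] := eqVneq (redp g) 0; last by exists 0%N, g; rewrite expr0 mul1r.
have [g' gE _] := redp_eq0 r0.
have gE' : g = (p%:R : Zp) *: g' by rewrite gE -mul_polyC polyC_natr.
have p0 := p_neq0 p_pr.
have g'0 : g' != 0 by apply: contraNneq g0 => g'0; rewrite gE g'0 mulr0.
have lE : lead_coef g' = p%:R ^+ k * u.
  by apply: (mulfI p0); rewrite mulrA -exprS -gu gE' lead_coefZ.
have [l [h [g'E h0 hs]]] := IH g' g'0 lE.
exists l.+1, h; split => //; first by rewrite gE g'E exprS mulrA.
by rewrite hs gE' size_scale.
Qed.

(** Suppose the remainder of [c] by the lift [S] is nonzero and write it [p ^ k h] with [h] nonzero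
    mod [p]. Powers of [p] cancel against the monic [S], so [s] divides [r h] mod [p]; it divides
    neither [r] nor, by degree, [h]. *)
Lemma irreducible_cancel s r c w : s \is monic -> irreducible_poly s -> ~~ (s %| redp r) ->
  liftp p_pr s * w = p%:R * r * c -> exists c', c = liftp p_pr s * c'.
Proof.
move=> sm sirr sr e; set S := liftp p_pr s.
have Sm : S \is monic by exact: liftp_monic.
have cE := Pdiv.RingMonic.rdivp_eq Sm c.
set q := Pdiv.Ring.rdivp c S in cE; set d := Pdiv.Ring.rmodp c S in cE.
have dS : (size d < size S)%N by apply: Pdiv.Ring.ltn_rmodpN0; rewrite monic_neq0.
have [d0|d0] := eqVneq d 0; first by exists q; rewrite mulrC {1}cE d0 addr0.
have [k [h [dE h0 hd]]] := poly_factor_p d0.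
have {e} : exists w', S * w' = p%:R ^+ k.+1 * (r * h).
  exists (w - p%:R * r * q); rewrite mulrBr e {1}cE dE exprS; ring.
have pS w' x : S * w' = p%:R * x -> exists w'', S * w'' = x.
  move=> e; have /redp_eq0[w'' w'E _] : redp w' = 0.
    have /eqP := congr1 (@redp p p_pr) e; rewrite redp_p redpM liftpK mulf_eq0.
    by rewrite (negPf (monic_neq0 sm)) => /eqP.
  by exists w''; apply: (@p_polyI _ p_pr); rewrite -e w'E; ring.
have pSk j x : (exists w', S * w' = p%:R ^+ j * x) -> exists w', S * w' = x.
  elim: j x => [|j IH] x [w' e]; first by exists w'; rewrite e expr0 mul1r.
  by apply: IH; apply: (pS w'); rewrite e exprS mulrA.
move=> /pSk[w' /(congr1 (@redp p p_pr))]; rewrite !redpM liftpK => e.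
have : s %| redp r * redp h by rewrite -e dvdp_mulr.
rewrite irreducible_dvdM // (negPf sr) /= => /(dvdp_leq h0).
rewrite leqNgt => /negP[]; apply: leq_ltn_trans (_ : size h < size s)%N.
  exact: size_poly.
by rewrite hd -(size_liftp p_pr).
Qed.

(** The lift of [s] is not a zero divisor modulo [f]: modulo it, [f] becomes [p r], which
    [irreducible_cancel] removes. *)
Lemma irreducible_cancelX s j f1 r f N b c : s \is monic -> irreducible_poly s ->
  ~~ (s %| redp r) -> f = liftp p_pr s ^+ j.+1 * f1 + p%:R * r ->
  liftp p_pr s ^+ N * b = f * c -> exists c', b = f * c'.
Proof.
move=> sm sirr sr fE; elim: N c => [|N IH] c e.
  by exists c; rewrite -e expr0 mul1r.
have [] := @irreducible_cancel s r c (liftp p_pr s ^+ N * b - liftp p_pr s ^+ j * f1 * c) sm sirr sr.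
  rewrite mulrBr mulrA -exprS e fE exprS; ring.
move=> c' cE; apply: (IH c'); apply: (mulfI (monic_neq0 (liftp_monic p_pr sm))).
by rewrite mulrA -exprS e cE; ring.
Qed.

Variables (n : nat) (f : {poly Zp}).
Hypotheses (f_monic : f \is monic) (size_f : size f = n.+2).
Local Notation K := {poly %/ frac_poly f}.
Local Notation cls := (@cls p p_pr f).

Lemma scale_cls (c : Zp) (x : K) : tofrac c *: x = cls c%:P * x.
Proof.
by rewrite -[c%:P]mulr1 mul_polyC clsZ cls1 -scalerAl mul1r.
Qed.

Lemma cls_p (x : K) : cls (p%:R) * x = tofrac (p%:R) *: x.
Proof. by rewrite scale_cls polyC_natr. Qed.

Lemma scale_p_inj (x y : K) : tofrac (p%:R : Zp) *: x = tofrac (p%:R : Zp) *: y -> x = y.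
Proof. by apply: scalerI; rewrite tofrac_eq0 p_neq0. Qed.

(** If [f = S ^ 2 a + p S b + p ^ 2 c], then [beta = S a / p] is integral, with
    [beta ^ 2 + b beta + a c = 0] in the quotient. Adjoining it yields a strictly larger order. *)
Lemma maximal_order_dedekind t : t \is monic -> (1 < size t)%N ->
  in_sqr_ideal t f -> ~ is_maximal_order (equation_order f).
Proof.
move=> tm t1 [a [b [c fE]]] [_ maxO]; set S := liftp p_pr t in fE.
pose pi := tofrac (p%:R : Zp).
have pi0 : pi != 0 by rewrite tofrac_eq0 p_neq0.
pose beta : K := pi^-1 *: cls (S * a).
have pbeta : cls p%:R * beta = cls (S * a).
  by rewrite cls_p scalerA mulfV // scale1r.
have Sbeta : cls S * beta = - cls (S * b + p%:R * c).
  apply: scale_p_inj; rewrite -!cls_p mulrCA pbeta -clsN -!clsM.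
  have -> : S * (S * a) = f + p%:R * (- (S * b + p%:R * c)) by rewrite fE; ring.
  by rewrite clsD (cls_f f_monic size_f) add0r.
have beta2 : beta * beta = - (cls b * beta + cls (a * c)).
  apply: scale_p_inj; rewrite -!cls_p mulrA pbeta clsM [cls S * _]mulrC -mulrA Sbeta.
  rewrite !mulrN; congr (- _); rewrite mulrDr [in RHS]mulrCA pbeta -!clsM -clsD.
  by congr cls; ring.
pose O' : set K := [set x | exists g h, x = cls g + cls h * beta].
have OO' : equation_order f `<=` O'.
  by move=> x /equation_orderP[g ->]; exists g, 0; rewrite cls0 mul0r addr0.
have O'ord : is_order O'.
  have [_ _ _ _ Od] := equation_order_is_order f_monic size_f.
  split.
  - by exists 1, 0; rewrite cls1 cls0 mul0r addr0.
  - move=> _ _ [g [h ->]] [g' [h' ->]]; exists (g - g'), (h - h').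
    by rewrite !clsD !clsN; ring.
  - move=> _ _ [g [h ->]] [g' [h' ->]].
    exists (g * g' - h * h' * (a * c)), (g * h' + h * g' - h * h' * b).
    have -> : (cls g + cls h * beta) * (cls g' + cls h' * beta) =
      cls g * cls g' + (cls g * cls h' + cls h * cls g') * beta + cls h * cls h' * (beta * beta) by ring.
    by rewrite beta2 !clsD !clsN !clsM; ring.
  - exists (power_basis n f ++ [seq x * beta | x <- power_basis n f]).
    rewrite -/(zspan _) zspan_cat zspan_scale_mul -equation_order_span //.
    apply/seteqP; split=> x.
      move=> [g [h ->]]; exists (cls g), (cls h * beta); split => //.
        by apply/equation_orderP; exists g.
      by exists (cls h) => //; apply/equation_orderP; exists h.
    by move=> [_ [_ [/equation_orderP[g ->] [_ /equation_orderP[h ->] <-] ->]]]; exists g, h.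
  - by move=> x; have [d d0 dx] := Od x; exists d => //; apply: OO'.
have : O' beta by exists 0, 1; rewrite cls0 cls1 add0r mul1r.
rewrite (maxO O') // => /equation_orderP[g gE].
(* If [beta] were the class of [g], then [p g - S a = h f]; mod [p], cancelling [t a] leaves [t]
   dividing 1. *)
have /(cls_eq0 f_monic size_f)[h hE] : cls (p%:R * g - S * a) = 0.
  by rewrite clsD clsN clsM -gE pbeta subrr.
have fr : redp f = t ^+ 2 * redp a.
  rewrite (_ : f = S ^+ 2 * a + p%:R * (S * b + p%:R * c)); last by rewrite fE; ring.
  by rewrite redpD redp_p addr0 [LHS]redpM redpX liftpK.
have := congr1 (@redp p p_pr) hE; rewrite redpB redp_p redpM liftpK redpM fr sub0r => /eqP.
have ta0 : t * redp a != 0.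
  have : redp f != 0 by rewrite monic_neq0 // redp_monic.
  by rewrite fr expr2 -mulrA mulf_eq0 negb_or => /andP[].
rewrite -subr_eq0 (_ : - (t * redp a) - redp h * (t ^+ 2 * redp a) = (- 1 - redp h * t) * (t * redp a)); last by ring.
rewrite mulf_eq0 (negPf ta0) orbF subr_eq0 => /eqP e.
have : t %| 1 by rewrite (_ : 1 = - redp h * t) ?dvdp_mull // mulNr -e opprK.
by rewrite dvdp1 => /eqP t1'; rewrite t1' in t1.
Qed.

Lemma common_denominator (s : seq K) : exists2 d : Zp, d != 0 &
  forall y, zspan s y -> exists g, tofrac d *: y = cls g.
Proof.
have [d d0 ds] : exists2 d : Zp, d != 0 & forall i, exists g, tofrac d *: s`_i = cls g.
  elim: s => [|y s [d d0 ds]].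
    by exists 1; rewrite ?oner_neq0 // => i; exists 0; rewrite nth_nil scaler0 cls0.
  have [e [g [e0 eg]]] := cls_denominator y.
  exists (d * e); first by rewrite mulf_neq0.
  move=> [|i] /=; first by exists (d *: g); rewrite tofracM -scalerA eg clsZ.
  by have [h hE] := ds i; exists (e *: h); rewrite mulrC tofracM -scalerA hE clsZ.
exists d => // y /zspanP[c ->]; have [g gE] := choice ds.
exists (\sum_(0 <= i < size s) c i *: g i).
rewrite scaler_sumr cls_sum; apply: eq_bigr => i _.
by rewrite clsZ -gE !scalerA mulrC.
Qed.

(** Suppose [x] lies in a larger order, [x] is not in [O] but [p x], the class of [h0], is. Some
    irreducible [t] divides [f] mod [p] more often than [h0]. All powers of [x] have a common
    denominator, so a large power of [h0] is divisible by a high power of [p] in [O]. Converting [p]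
    into powers of the lift [S] of [t] through the relation [f = 0], and cancelling them,
    contradicts the multiplicity of [t]. *)
Lemma dedekind_maximal_order :
  (forall t, t \is monic -> (1 < size t)%N -> ~ in_sqr_ideal t f) ->
  is_maximal_order (equation_order f).
Proof.
move=> nsq; split; first exact: (equation_order_is_order f_monic size_f).
move=> O' [_ _ mulO' [s sE] _] OO'; apply/seteqP; split=> //; move=> x0 O'x0.
apply: contrapT => nOx0.
have O'Z c x : O' x -> O' (tofrac (c : Zp) *: x).
  by move=> O'x; rewrite scale_cls; apply: mulO' => //; apply: OO'; apply/equation_orderP; exists c%:P.
have OZ c x : equation_order f x -> equation_order f (tofrac (c : Zp) *: x).
  by move=> /equation_orderP[g ->]; apply/equation_orderP; exists (c *: g); rewrite clsZ.
have OD x y : equation_order f x -> equation_order f y -> equation_order f (x + y).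
  by move=> /equation_orderP[g ->] /equation_orderP[h ->]; apply/equation_orderP; exists (g + h); rewrite clsD.
(* Some [x] in [O' \ O] satisfies [p x \in O]. *)
have [x [xO' nOx [h0 px]]] : exists x, [/\ O' x, ~ equation_order f x & exists h, tofrac (p%:R : Zp) *: x = cls h].
  have [d [g [d0 dg]]] := cls_denominator x0.
  have [k [u [dE u0]]] := padic_factor d0.
  have [v vu] := padic_unitE u0.
  have : tofrac (p%:R ^+ k : Zp) *: x0 = cls (v *: g).
    by rewrite clsZ -dg scalerA -tofracM dE mulrCA vu mulr1.
  elim: k {d d0 dg dE u u0 vu} x0 O'x0 nOx0 (v *: g) => [|k IH] y O'y nOy h e.
    by case: nOy; apply/equation_orderP; exists h; rewrite -e expr0 tofrac1 scale1r.
  have [Opy|nOpy] := pselect (equation_order f (tofrac (p%:R : Zp) *: y)).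
    by exists y; split => //; apply/equation_orderP.
  apply: (IH (tofrac (p%:R : Zp) *: y)) => //; first exact: O'Z.
  by rewrite scalerA -tofracM -exprSr e.
have fh : ~~ (redp f %| redp h0).
  apply/negP => /dvdpP[v hE].
  have [e hE'] : exists e, h0 = liftp p_pr v * f + p%:R * e.
    by apply: redp_eq; rewrite redpM liftpK.
  apply: nOx; apply/equation_orderP; exists e.
  apply: scale_p_inj; rewrite px hE' clsD clsM (cls_f f_monic size_f) mulr0 add0r.
  by rewrite clsM cls_p.
have rf0 : redp f != 0 by rewrite monic_neq0 // redp_monic.
have [t [j [tm tirr tj tj1 tf]]] := not_dvdp_irreducible rf0 fh.
set S := liftp p_pr t.
have /dvdpP[eta hE] := tj.
have [h2 h0E] : exists h2, h0 = liftp p_pr eta * S ^+ j + p%:R * h2.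
  by apply: redp_eq; rewrite redpM redpX !liftpK.
have te : ~~ (t %| eta).
  by apply: contra tj1 => te; rewrite hE exprSr mulrC dvdp_mul.
have /dvdpP[v fE] := tf.
have [r f0E] : exists r, f = liftp p_pr v * S ^+ j.+1 + p%:R * r.
  by apply: redp_eq; rewrite redpM redpX !liftpK.
have [d d0 Hd] := common_denominator s.
have [N [u [dE u0]]] := padic_factor d0.
have O'X k : O' (x ^+ k).
  elim: k => [|k IH]; last by rewrite exprS; apply: mulO'.
  by apply: OO'; apply/equation_orderP; exists 1; rewrite cls1.
(* With this exponent [k - N = j N + 1], and [(j + 1) (j N + 1) = j k + 1] exceeds [j k] by exactly
   one factor [S]. *)
set k := (j.+1 * N).+1.
have [g gE] : exists g, tofrac d *: x ^+ k = cls g.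
  by apply: Hd; have := O'X k; rewrite sE.
have kN : k = (N + (j * N).+1)%N by rewrite /k mulSn addnS.
have pNinj : injective (fun y : K => tofrac (p%:R ^+ N : Zp) *: y).
  by apply: scalerI; rewrite tofrac_eq0 expf_neq0 // p_neq0.
have uhk : cls (u%:P * h0 ^+ k) = cls (p%:R ^+ (j * N).+1 * g).
  apply: pNinj; rewrite -!clsZ; transitivity (tofrac (p%:R ^+ k : Zp) *: cls g).
    rewrite -gE scalerA [tofrac _ * tofrac _]mulrC -scalerA (_ : tofrac (p%:R ^+ k) *: x ^+ k = cls (h0 ^+ k)); last first.
      by rewrite clsX -px exprZn tofracXn.
    rewrite -clsZ dE.
    by rewrite -mul_polyC mulrA -polyCM mul_polyC.
  rewrite -clsZ kN exprD -scalerA (_ : p%:R ^+ (j * N).+1 = (p%:R ^+ (j * N).+1)%:P) ?mul_polyC //.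
  by rewrite rmorphXn /= polyC_natr.
have tu w : t %| redp u%:P * redp w -> t %| redp w.
  rewrite irreducible_dvdM // => /orP[|//]; rewrite /redp map_polyC /= => tu.
  have := dvdp_leq _ tu; rewrite polyC_eq0 u0 size_polyC u0 => /(_ isT).
  by rewrite leqNgt tirr.1.
(* For [j > 0], [t | r] would put [f = V S ^ (j + 1) + p r] in [(p, t) ^ 2], against the
   hypothesis. *)
have tr_or : j = 0%N \/ ~~ (t %| redp r).
  case: j @k f0E {tj tj1 tf h0E hE gE kN uhk fE} => [|j] k f0E; first by left.
  right; apply/negP => /dvdpP[w rE].
  have [e rE'] : exists e, r = liftp p_pr w * S + p%:R * e.
    by apply: redp_eq; rewrite redpM !liftpK.
  apply: (nsq t tm tirr.1); exists (liftp p_pr v * S ^+ j), (liftp p_pr w), e.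
  by rewrite f0E rE' -/S !exprS; ring.
case: tr_or => [j0|tr].
  move: uhk; rewrite j0 mul0n expr1 => e.
  have /(cls_eq0 f_monic size_f)[c] : cls (u%:P * h0 ^+ k - p%:R * g) = 0.
    by rewrite clsD clsN e subrr.
  move=> /(congr1 (@redp p p_pr)); rewrite redpB redp_p subr0 !redpM => e'.
  have : t %| redp u%:P * redp (h0 ^+ k).
    by rewrite e' dvdp_mull //; move: tf; rewrite j0 expr1.
  move=> /tu; rewrite redpX => /(irreducible_dvdX tirr).
  by apply/negP; move: tj1; rewrite j0 expr1.
set V := liftp p_pr v in f0E; set E := liftp p_pr eta in h0E.
have clsf := cls_f f_monic size_f.
have pr : cls (p%:R * r) = cls (- (V * S ^+ j.+1)).
  have -> : p%:R * r = f + - (V * S ^+ j.+1) by rewrite f0E; ring.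
  by rewrite clsD clsf add0r.
(* In the quotient [p r = - V S ^ (j + 1)], so [r h0] becomes [S ^ j H]; mod [t] and [p], [H] is
   [r eta], which is nonzero. *)
pose H := r * E - V * S * h2.
have rh : cls (r * h0) = cls (S ^+ j * H).
  have -> : r * h0 = r * E * S ^+ j + (p%:R * r) * h2 by rewrite h0E; ring.
  by rewrite clsD [cls (p%:R * r * h2)]clsM pr -clsM -clsD; congr cls; rewrite /H exprS; ring.
pose G := r ^+ N * (- V) ^+ (j * N).+1 * g.
have /(cls_eq0 f_monic size_f)[c cE] : cls (S ^+ (j * k) * (u%:P * H ^+ k - S * G)) = 0.
  have e1 : cls (u%:P * (S ^+ j * H) ^+ k) = cls (r ^+ N * (- (V * S ^+ j.+1)) ^+ (j * N).+1 * g).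
    transitivity (cls (r ^+ k * (u%:P * h0 ^+ k))).
      have e2 : cls ((S ^+ j * H) ^+ k) = cls ((r * h0) ^+ k) by rewrite [LHS]clsX [RHS]clsX rh.
      by rewrite [LHS]clsM e2 -[LHS]clsM; congr cls; rewrite exprMn; ring.
    rewrite clsM uhk -clsM; transitivity (cls (r ^+ N * (p%:R * r) ^+ (j * N).+1 * g)).
      congr cls; rewrite kN exprD [(p%:R * r) ^+ _]exprMn -!mulrA; congr (_ * _).
      by rewrite mulrCA.
    by rewrite clsM clsM [cls ((p%:R * r) ^+ _)]clsX pr -clsX -clsM -clsM.
  have -> : S ^+ (j * k) * (u%:P * H ^+ k - S * G) = u%:P * (S ^+ j * H) ^+ k - r ^+ N * (- (V * S ^+ j.+1)) ^+ (j * N).+1 * g.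
    have -> : (- (V * S ^+ j.+1)) ^+ (j * N).+1 = (- V) ^+ (j * N).+1 * S ^+ (j * k).+1.
      by rewrite -mulNr exprMn -exprM; congr (_ * _ ^+ _); rewrite /k !mulnS mulnCA addSn.
    have -> : (S ^+ j * H) ^+ k = S ^+ (j * k) * H ^+ k by rewrite exprMn -exprM.
    by rewrite [S ^+ (j * k).+1]exprS /G mulrBr; congr (_ - _); ring.
  by rewrite clsD clsN e1 subrr.
(* Cancelling [S ^ (j k)] modulo [f] leaves [u H ^ k = S G], which forces [t | H] mod [p]. *)
have [c' bE] : exists c', u%:P * H ^+ k - S * G = f * c'.
  apply: (irreducible_cancelX (f1 := V) tm tirr tr (N := (j * k)%N) (c := c) (j := j)).
    by rewrite f0E mulrC.
  by rewrite cE mulrC.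
have : t %| redp u%:P * redp (H ^+ k).
  have /(congr1 (@redp p p_pr)) := bE; rewrite redpB !redpM liftpK => /eqP.
  rewrite subr_eq => /eqP ->; rewrite dvdp_add ?dvdp_mulr //.
  by apply: dvdp_trans tf; rewrite exprS dvdp_mulr.
move=> /tu; rewrite redpX => /(irreducible_dvdX tirr).
rewrite /H redpB !redpM !liftpK dvdp_addl; last by rewrite dvdpNr dvdp_mulr // dvdp_mull.
by rewrite irreducible_dvdM // (negPf tr) (negPf te).
Qed.

End Dedekind.

(** * Valuation of the discriminant *)

Section RowReplacement.
Variables (A : comNzRingType) (N : nat).
Implicit Types (M : 'M[A]_N) (y w : 'rV[A]_N).

Definition set_row i y M : 'M[A]_N := \matrix_(k, j) if k == i then y 0 j else M k j.

Lemma det_set_row1 i w : \det (set_row i w 1%:M) = w 0 i.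
Proof.
rewrite (expand_det_row _ i).
have adj1 : \adj (1%:M : 'M[A]_N) = 1%:M by rewrite -[LHS]mul1mx mul_mx_adj det1.
transitivity (\sum_j w 0 j * (\adj (1%:M : 'M[A]_N)) j i).
  apply: eq_bigr => j _; rewrite !mxE eqxx; congr (_ * _); rewrite /cofactor; congr (_ * \det _).
  by apply/matrixP => k l; rewrite !mxE eq_sym (negPf (neq_lift _ _)).
rewrite adj1 (bigD1 i) //= mxE eqxx mulr1 big1 ?addr0 // => j ji.
by rewrite mxE (negPf ji) mulr0.
Qed.

Lemma det_set_row i w M : \det (set_row i (w *m M) M) = w 0 i * \det M.
Proof.
rewrite -(det_set_row1 i w) -det_mulmx; congr (\det _).
apply/matrixP => k j; rewrite !mxE; case: eqP => [->|/eqP ki].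
  by apply: eq_bigr => l _; rewrite !mxE eqxx.
rewrite (bigD1 k) //= mxE (negPf ki) mxE eqxx mul1r big1 ?addr0 // => l lk.
by rewrite mxE (negPf ki) mxE eq_sym (negPf lk) mul0r.
Qed.

Lemma det_set_rowZ i a y M : \det (set_row i (a *: y) M) = a * \det (set_row i y M).
Proof.
rewrite (expand_det_row _ i) (expand_det_row (set_row i y M) i) mulr_sumr.
apply: eq_bigr => j _; rewrite !mxE eqxx -mulrA; congr (_ * (_ * _)).
rewrite /cofactor; congr (_ * \det _).
by apply/matrixP => k l; rewrite !mxE eq_sym (negPf (neq_lift _ _)).
Qed.

(** Replacing row [i] of [M] by the combination [w M] multiplies the determinant by [w_i]. A
    combination of rows divisible by [a] thus pulls [a] out of the determinant. *)
Lemma det_row_relation i a w y M : w *m M = a *: y ->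
  w 0 i * \det M = a * \det (set_row i y M).
Proof. by move=> wM; rewrite -det_set_row wM det_set_rowZ. Qed.

Lemma mul_set_row i w y M :
  w *m set_row i y M = (w - w 0 i *: delta_mx 0 i) *m M + w 0 i *: y.
Proof.
apply/rowP => j; rewrite !mxE (bigD1 i) //= [X in _ = X + _](bigD1 i) //=.
rewrite !mxE !eqxx mulr1 subrr mul0r add0r addrC; congr (_ + _).
by apply: eq_bigr => k ki; rewrite !mxE (negPf ki) andbF mulr0 subr0.
Qed.

End RowReplacement.

Section PadicDeterminant.
Variables (p : nat) (p_pr : prime p) (N : nat).
Local Notation Zp := (padic_int p_pr).
Local Notation red := (@reduction p p_pr).
Implicit Types (M : 'M[Zp]_N) (y w : 'rV[Zp]_N).

Lemma det_reduction_neq0 M :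
  (forall w, map_mx red (w *m M) = 0 -> map_mx red w = 0) -> red (\det M) != 0.
Proof.
move=> H; rewrite -det_map_mx; apply/negP => /det0P[v v0 vM].
move/negP: v0; apply; have vE : v = map_mx red (map_mx (@plift p p_pr) v).
  by apply/matrixP => i j; rewrite !mxE pliftK.
by rewrite vE; apply/eqP/H; rewrite map_mxM -vE.
Qed.

Lemma pdvd_unit_mul k (u x : Zp) : red u != 0 -> pdvd k (u * x) -> pdvd k x.
Proof.
move=> u0 [y e]; have [v vu] := padic_unitE u0; exists (v * y).
by rewrite mulrCA -e mulrA vu mul1r.
Qed.

End PadicDeterminant.

(** * Sylvester matrices and the [p]-divisibility of resultants *)

Section Resultant.
Variables (p : nat) (p_pr : prime p).
Local Notation Zp := (padic_int p_pr).
Local Notation red := (@reduction p p_pr).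
Variables (n : nat) (f q : {poly Zp}).
Hypotheses (f_monic : f \is monic) (size_f : size f = n.+2) (size_q : size q = n.+1).
Implicit Types (u v : {poly Zp}) (g a b : {poly 'F_p}).
Local Notation S := (Sylvester_mx f q).

Definition sylv_row u v : 'rV[Zp]_((size q).-1 + (size f).-1) :=
  row_mx (poly_rV u) (poly_rV v).

Lemma sylv_rowM u v : (size u <= n)%N -> (size v <= n.+1)%N ->
  sylv_row u v *m S = poly_rV (u * f + v * q).
Proof.
move=> un vn; rewrite mul_row_col !mul_rV_lin1 /= !poly_rV_K ?size_q ?size_f //.
by rewrite linearD.
Qed.

Lemma sylv_rowP (w : 'rV[Zp]_((size q).-1 + (size f).-1)) :
  exists u v, [/\ w = sylv_row u v, (size u <= n)%N & (size v <= n.+1)%N].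
Proof.
exists (rVpoly (lsubmx w)), (rVpoly (rsubmx w)); split.
- by rewrite /sylv_row !rVpolyK hsubmxK.
- by rewrite (leq_trans (size_poly _ _)) // size_q.
- by rewrite (leq_trans (size_poly _ _)) // size_f.
Qed.

Lemma size_comb u v : (size u <= n)%N -> (size v <= n.+1)%N ->
  (size (u * f + v * q)%R <= (size q).-1 + (size f).-1)%N.
Proof.
move=> un vn; rewrite size_q size_f /= (leq_trans (size_polyD _ _)) // geq_max.
apply/andP; split; apply: leq_trans (size_polyMleq _ _) _; rewrite ?size_f ?size_q.
  by rewrite addnS /= leq_add2r.
by rewrite addnS /= addnC leq_add2l.
Qed.

Lemma red_poly_rV d u : map_mx red (poly_rV u : 'rV_d) = poly_rV (redp u).
Proof. by apply/rowP => i; rewrite !mxE coef_redp. Qed.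

Lemma poly_rV_eq0 d a : (size a <= d)%N -> poly_rV a = 0 :> 'rV_d -> a = 0.
Proof. by move=> ad a0; rewrite -(poly_rV_K ad) a0 linear0. Qed.

Lemma size_redp_le u k : (size u <= k)%N -> (size (redp u) <= k)%N.
Proof. by move=> uk; rewrite (leq_trans (size_poly _ _)). Qed.

Lemma sylv_row_red0 u v : map_mx red (sylv_row u v) = 0 <->
  poly_rV (redp u) = 0 :> 'rV_((size q).-1) /\ poly_rV (redp v) = 0 :> 'rV_((size f).-1).
Proof.
rewrite map_row_mx !red_poly_rV; split=> [|[-> ->]]; last by rewrite row_mx0.
by rewrite -[0]row_mx0 => /eq_row_mx.
Qed.

Lemma resultant_coprime : coprimep (redp f) (redp q) -> red (resultant f q) != 0.
Proof.
move=> co; apply: det_reduction_neq0 => w.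
have [u [v [-> un vn]]] := sylv_rowP w; rewrite sylv_rowM // red_poly_rV.
move/(poly_rV_eq0 (size_redp_le (size_comb un vn))); rewrite redpD !redpM => e.
have fv : redp f %| redp v.
  rewrite -(Gauss_dvdpl _ co); have -> : redp v * redp q = - redp u * redp f.
    by move/eqP: e; rewrite addr_eq0 mulNr => /eqP ->; rewrite opprK.
  by rewrite dvdp_mull.
have v0 : redp v = 0.
  apply/eqP/contraT => v0; have := dvdp_leq v0 fv.
  by rewrite size_redp // size_f leqNgt ltnS (size_redp_le vn).
move: e; rewrite v0 mul0r addr0 => /eqP; rewrite mulf_eq0.
rewrite [redp f == 0](negPf (monic_neq0 (redp_monic f_monic))) orbF => /eqP u0.
by apply/sylv_row_red0; rewrite u0 v0 !linear0.
Qed.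

(* The syzygy replaces the row of [x^k q] in the Sylvester matrix; it is applied with [v`_k] a unit. *)
Lemma resultant_syzygy (d : Zp) k u v y : (size u <= n)%N -> (size v <= n.+1)%N ->
  u * f + v * q = d *: y -> forall kn : (k < (size f).-1)%N,
  v`_k * resultant f q =
    d * \det (set_row (rshift (size q).-1 (Ordinal kn)) (poly_rV y) S).
Proof.
move=> un vn e kn.
rewrite -(@det_row_relation _ _ (rshift _ (Ordinal kn)) d (sylv_row u v)); last first.
  by rewrite sylv_rowM // e linearZ.
by rewrite /sylv_row row_mxEr mxE.
Qed.

Lemma resultant_syzygy_pdvd m k u v y : (size u <= n)%N -> (size v <= n.+1)%N ->
  u * f + v * q = (p%:R ^+ m : Zp) *: y -> red v`_k != 0 -> pdvd m (resultant f q).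
Proof.
move=> un vn e vk; have kn : (k < (size f).-1)%N.
  rewrite ltnNge size_f; apply: contra vk => /= nk.
  by rewrite nth_default ?rmorph0 // (leq_trans vn).
apply: (pdvd_unit_mul vk); rewrite (resultant_syzygy un vn e kn).
by eexists.
Qed.

Section CommonFactor.
Variables (g a b : {poly 'F_p}).
Hypotheses (fE : redp f = g * a) (qE : redp q = g * b).

Let g0 : g != 0.
Proof.
have : redp f != 0 by rewrite monic_neq0 // redp_monic.
by rewrite fE mulf_eq0 negb_or => /andP[].
Qed.
Let a0 : a != 0.
Proof.
have : redp f != 0 by rewrite monic_neq0 // redp_monic.
by rewrite fE mulf_eq0 negb_or => /andP[].
Qed.

Let size_a : ((size g).-1 + size a = n.+2)%N.
Proof.
have := size_redp f_monic; rewrite fE size_mul // size_f => <-.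
by rewrite -[in RHS](prednK (_ : 0 < size g)%N) ?size_poly_gt0.
Qed.

Let size_b : b != 0 -> ((size g).-1 + size b <= n.+1)%N.
Proof.
move=> b0; have : (size (redp q) <= n.+1)%N by rewrite size_redp_le ?size_q.
rewrite qE size_mul // -[in X in (X <= _)%N](prednK (_ : 0 < size g)%N) ?size_poly_gt0 //.
Qed.

(** Mod [p], [f = g a] and [q = g b], so [b c f - a c q] vanishes; [deg c < deg g] keeps both
    multipliers within the Sylvester degree bounds. *)
Lemma syzygy (c : {poly 'F_p}) : (size c < size g)%N -> [/\ (size (liftp p_pr (b * c)) <= n)%N,
  (size (liftp p_pr (- (a * c))) <= n.+1)%N &
  exists2 y, liftp p_pr (b * c) * f + liftp p_pr (- (a * c)) * q = (p%:R : Zp) *: y &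
    (size y <= (size q).-1 + (size f).-1)%N].
Proof.
move=> cg.
have H1 : (size (liftp p_pr (b * c)) <= n)%N.
  rewrite size_liftp; have [->|b0] := eqVneq b 0; first by rewrite mul0r size_poly0.
  by have := size_polyMleq b c; have := size_b b0; lia.
have H2 : (size (liftp p_pr (- (a * c))) <= n.+1)%N.
  rewrite size_liftp size_polyN (leq_trans (size_polyMleq _ _)) //.
  have := size_a; move: cg; move: (size g) (size a) (size c) => i j k; lia.
split => //.
have /redp_eq0[y yE ys] : redp (liftp p_pr (b * c) * f + liftp p_pr (- (a * c)) * q) = 0.
  by rewrite redpD !redpM !liftpK fE qE; ring.
exists y; first by rewrite yE -mul_polyC polyC_natr.
by rewrite (leq_trans ys) // size_comb.
Qed.

Lemma resultant_common_factor : (1 < size g)%N -> pdvd 1 (resultant f q).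
Proof.
move=> g1; have [] := @syzygy 1; first by rewrite size_poly1.
rewrite !mulr1 => un vn [y e _].
apply: (resultant_syzygy_pdvd (k := (size a).-1) un vn (y := y)); first by rewrite expr1.
by rewrite coef_liftp pliftK coefN oppr_eq0 lead_coef_eq0.
Qed.

(** A common factor of degree at least 2 leaves room for two syzygies, with [c] constant and linear,
    and each extracts one factor [p]. *)
Lemma resultant_common_factor2 : (2 < size g)%N -> pdvd 2 (resultant f q).
Proof.
move=> g2; have [] := @syzygy 1; first by rewrite size_poly1 ltnW.
rewrite !mulr1 => un vn [y e ys].
set k := (size a).-1.
have kn : (k.+1 < (size f).-1)%N.
  have sa : (0 < size a)%N by rewrite size_poly_gt0.
  by rewrite size_f /k; have := size_a; move: g2 sa; move: (size g) (size a) => i j; lia.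
have kn' := ltnW kn.
have := resultant_syzygy un vn e kn'.
set i := rshift _ (Ordinal kn'); set M := set_row i _ _ => e1.
apply: (pdvd_unit_mul (u := (liftp p_pr (- a))`_k)).
  by rewrite coef_liftp pliftK coefN oppr_eq0 lead_coef_eq0.
rewrite e1; suff [z ->] : pdvd 1 (\det M) by exists z; rewrite expr1 expr2 mulrA.
(* A second syzygy with no [x^k] coefficient, so that it is one for [M] too. *)
pose lam := ('X * a)`_k / lead_coef a.
have lamE : lam * lead_coef a = ('X * a)`_k by rewrite divfK ?lead_coef_eq0.
pose c : {poly 'F_p} := 'X - lam%:P.
have sc : size c = 2 by rewrite size_XsubC.
have [] := @syzygy c; first by rewrite sc.
set u2 := liftp _ (b * c); set v2 := liftp _ (- (a * c)) => un2 vn2 [y2 e2 _].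
have ack : (a * c)`_k = 0.
  by rewrite mulrC mulrBl coefB coefCM -[a`_k]/(lead_coef a) lamE subrr.
have ak1 : a`_k.+1 = 0 by apply: nth_default; rewrite /k prednK ?size_poly_gt0.
have ack1 : (a * c)`_k.+1 = lead_coef a.
  by rewrite mulrC mulrBl coefB coefCM ak1 mulr0 subr0 coefXM.
pose w := sylv_row u2 v2.
have wM : w *m M = (p%:R : Zp) *: poly_rV y2.
  have wi : w 0 i = 0.
    by rewrite /w /sylv_row row_mxEr mxE /= coef_liftp coefN ack oppr0 plift0.
  have wS := sylv_rowM un2 vn2; rewrite e2 linearZ in wS.
  by rewrite mul_set_row wi scale0r subr0 scale0r addr0.
have := det_row_relation (rshift _ (Ordinal kn)) wM.
rewrite {1}/w /sylv_row row_mxEr mxE /= => e3.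
apply: (pdvd_unit_mul (u := v2`_k.+1)).
  by rewrite coef_liftp pliftK coefN oppr_eq0 ack1 lead_coef_eq0.
by rewrite e3; eexists; rewrite expr1.
Qed.

End CommonFactor.

(** The syzygy [G f - f1 q = p (e0 G - p e1 f1)] extracts one factor [p]. The new row is [e0 G] mod
    [p], and if [e0] is a unit the modified matrix is invertible mod [p]; if [p | e0], the syzygy
    extracts [p ^ 2]. *)
Lemma resultant_node (c : Zp) (f1 G : {poly Zp}) (e0 e1 : Zp) :
  f1 \is monic -> size f1 = n.+1 -> (size G <= n)%N ->
  f = ('X - c%:P) * f1 + (p%:R * e0)%:P ->
  q = ('X - c%:P) * G + (p%:R ^+ 2 * e1)%:P ->
  red G.[c] != 0 -> coprimep (redp f1) (redp G) ->
  pdvd 1 (resultant f q) /\ (pdvd 2 (resultant f q) <-> red e0 = 0).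
Proof.
move=> f1m sf1 sG fE qE Gc co.
pose L := redp ('X - c%:P).
have LE : L = 'X - (red c)%:P by rewrite /L redpB /redp map_polyX map_polyC.
have rC (m : nat) (x : Zp) : redp (p%:R ^+ m.+1 * x)%:P = 0.
  by rewrite /redp map_polyC /= rmorphM rmorphXn /= rmorph_nat pchar_Fp_0 // expr0n mul0r.
have rf : redp f = L * redp f1.
  by rewrite fE redpD redpM -[p%:R]expr1 rC addr0.
have rq : redp q = L * redp G by rewrite qE redpD redpM rC addr0.
have L0 : L != 0 by rewrite LE polyXsubC_eq0.
pose y := e0 *: G - (p%:R * e1) *: f1.
have syz : G * f + (- f1) * q = (p%:R : Zp) *: y.
  rewrite fE qE /y scalerBr !scalerA -!mul_polyC !rmorphM /=; ring.
have sv : (size (- f1) <= n.+1)%N by rewrite size_polyN sf1.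
have vn : (- f1)`_n = -1.
  by rewrite coefN; move/monicP: f1m; rewrite /lead_coef sf1 => ->.
have rvn : red (- f1)`_n != 0 by rewrite vn rmorphN rmorph1 oppr_eq0 oner_neq0.
split; first exact: (resultant_syzygy_pdvd (m := 1) sG sv syz rvn).
split=> [[z zE]|/reduction_eq0P[e0' e0E]]; last first.
  apply: (resultant_syzygy_pdvd (m := 2) (y := e0' *: G - e1 *: f1) sG sv _ rvn).
  by rewrite syz /y e0E !scalerBr !scalerA expr2 -!mulrA.
apply/eqP/contraT => e0r.
have kn : (n < (size f).-1)%N by rewrite size_f.
have := resultant_syzygy sG sv syz kn.
set i := rshift _ (Ordinal kn); set M := set_row i _ _; rewrite vn zE => e.
have dM : \det M = p%:R * (- z).
  by apply: (mulfI (p_neq0 p_pr)); rewrite -e; ring.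
suff : red (\det M) != 0 by rewrite dM rmorphM rmorph_nat pchar_Fp_0 // mul0r eqxx.
apply: det_reduction_neq0 => w; have [u [v [-> un vs]]] := sylv_rowP w.
have wi : sylv_row u v 0 i = v`_n by rewrite /sylv_row row_mxEr mxE.
have di : delta_mx 0 i = sylv_row 0 'X^n.
  apply/rowP => l; rewrite !mxE /=; case: splitP => k lk; rewrite !mxE ?coef0 ?coefXn.
    by rewrite -val_eqE /= lk eqn_leq [(_ + n <= k)%N]leqNgt (leq_trans (ltn_ord k)) ?leq_addr ?andbF.
  by rewrite -val_eqE /= lk eqn_add2l.
(* The replaced row is the one of [x ^ n q]; [v'] drops its coefficient, which now multiplies
   [y]. *)
set v' := v - v`_n *: 'X^n.
have v's : (size v' <= n)%N.
  apply/leq_sizeP => j nj; rewrite coefB coefZ coefXn.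
  have [->|jn] := eqVneq j n; first by rewrite mulr1 subrr.
  by rewrite mulr0 subr0 nth_default // (leq_trans vs) // ltn_neqAle eq_sym jn.
have -> : sylv_row u v *m M = poly_rV (u * f + v' * q + v`_n *: y).
  rewrite mul_set_row wi di [RHS]linearD [X in _ = _ + X]linearZ /=; congr (_ + _).
  rewrite -sylv_rowM //; last exact: leqW.
  congr (_ *m _); rewrite /sylv_row scale_row_mx opp_row_mx add_row_mx.
  congr row_mx; first by rewrite [poly_rV 0]linear0 scaler0 subr0.
  by apply/rowP => l; rewrite !mxE coefB coefZ.
have bnd : (size (redp (u * f + v' * q + v`_n *: y)) <= (size q).-1 + (size f).-1)%N.
  apply: size_redp_le; rewrite (leq_trans (size_polyD _ _)) // geq_max size_comb //=; last exact: leqW.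
  rewrite (leq_trans (size_scale_leq _ _)) // /y (leq_trans (size_polyD _ _)) // geq_max size_polyN.
  rewrite !(leq_trans (size_scale_leq _ _)) // ?sf1 size_f size_q.
    by rewrite leq_addl.
  by rewrite (leq_trans sG) // leq_addr.
rewrite red_poly_rV => /(poly_rV_eq0 bnd).
rewrite redpD redpD !redpM rf rq => e2.
have yr : redp y = (red e0)%:P * redp G.
  by rewrite /y redpB -!mul_polyC !redpM -[p%:R]expr1 rC mul0r subr0 /redp map_polyC.
(* At the common root [c] of the reductions only [v_n e0 G(c)] survives. *)
have v_n0 : red v`_n = 0.
  have := congr1 (fun s : {poly 'F_p} => s.[red c]) e2; rewrite -mul_polyC redpM yr.
  have Lc : L.[red c] = 0 by rewrite LE hornerXsubC subrr.
  have Gc' : (redp G).[red c] = red G.[c] by rewrite /redp horner_map.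
  rewrite !(hornerD, hornerM) Lc Gc' !(mul0r, mulr0, add0r) horner0 hornerC.
  rewrite /redp map_polyC hornerC => /eqP.
  by rewrite !mulf_eq0 (negPf Gc) (negPf e0r) !orbF => /eqP.
have rvC : redp (v`_n)%:P = 0 by rewrite /redp map_polyC /= v_n0.
move: e2; rewrite -mul_polyC redpM rvC mul0r addr0 => e2.
have {}e2 : redp u * redp f1 = - (redp v' * redp G).
  apply: (mulfI L0); rewrite mulrN; apply/eqP; rewrite -addr_eq0; apply/eqP.
  by rewrite -[RHS]e2; ring.
have fv : redp f1 %| redp v'.
  by rewrite -(Gauss_dvdpl _ co) -dvdpNr -e2 dvdp_mull.
have v'0 : redp v' = 0.
  apply/eqP/contraT => v0; have := dvdp_leq v0 fv.
  by rewrite size_redp // sf1 leqNgt ltnS (size_redp_le v's).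
move: e2; rewrite v'0 mul0r oppr0 => /eqP; rewrite mulf_eq0.
rewrite [redp f1 == 0](negPf (monic_neq0 (redp_monic f1m))) orbF => /eqP u0.
have v0 : redp v = 0.
  have -> : v = v' + (v`_n)%:P * 'X^n by rewrite mul_polyC /v' subrK.
  by rewrite redpD redpM v'0 rvC mul0r addr0.
by apply/sylv_row_red0; rewrite u0 v0 !linear0.
Qed.

End Resultant.

(** * Discriminant in terms of the decomposition [s T ^ 2 + p v] mod [p ^ 2] *)

Section Discriminant.
Variables (p : nat) (p_pr : prime p).
Local Notation Zp := (padic_int p_pr).
Local Notation red := (@reduction p p_pr).
Variables (n : nat) (f : {poly Zp}).
Hypotheses (f_monic : f \is monic) (size_f : size f = n.+3).

Lemma size_deriv_padic : size f^`() = n.+2.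
Proof.
apply/eqP; rewrite eqn_leq; apply/andP; split.
  by rewrite -ltnS -size_f lt_size_deriv // monic_neq0.
rewrite ltnNge; apply/negP => /leq_sizeP/(_ n.+1 (leqnn _)) /eqP; rewrite coef_deriv.
have -> : f`_n.+2 = 1 by move/monicP: f_monic; rewrite /lead_coef size_f.
by rewrite natr_padic_eq0.
Qed.

Lemma pdvd_discriminant k : pdvd k (discriminant f) <-> pdvd k (resultant f f^`()).
Proof.
rewrite /discriminant; split=> -[y e].
  exists ((-1) ^+ 'C((size f).-1, 2) * y); rewrite mulrCA -e mulrA -exprD addnn -mul2n exprM.
  by rewrite sqrrN !expr1n mul1r.
by exists ((-1) ^+ 'C((size f).-1, 2) * y); rewrite e mulrCA.
Qed.

Lemma redp_deriv : redp f^`() = (redp f)^`().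
Proof. by rewrite /redp deriv_map. Qed.

Lemma separable_polyE (g : {poly 'F_p}) : separable_poly g = coprimep g g^`().
Proof. by rewrite unlock. Qed.

Lemma discriminant_unit : ~ pdvd 1 (discriminant f) <-> separable_poly (redp f).
Proof.
rewrite pdvd_discriminant; split=> [nd|sep].
  apply/contraT => nsep; exfalso; apply: nd.
  have /dvdpP[a fE] := dvdp_gcdl (redp f) (redp f^`()).
  have /dvdpP[b qE] := dvdp_gcdr (redp f) (redp f^`()).
  rewrite mulrC in fE; rewrite mulrC in qE.
  apply: (resultant_common_factor f_monic size_f size_deriv_padic fE qE).
  rewrite ltn_neqAle eq_sym -coprimep_def redp_deriv -separable_polyE nsep size_poly_gt0.
  by rewrite gcdp_eq0 negb_and monic_neq0 // redp_monic.
have : red (resultant f f^`()) != 0.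
  by apply: (resultant_coprime f_monic size_f size_deriv_padic); rewrite redp_deriv -separable_polyE.
by rewrite reduction_eq0 => /asboolP.
Qed.

Lemma divide_XsubC m (h : {poly Zp}) (c : Zp) : size h = m.+2 ->
  exists2 h1, h = ('X - c%:P) * h1 + (h.[c])%:P & size h1 = m.+1 /\ lead_coef h1 = lead_coef h.
Proof.
move=> hm; have /factor_theorem[h1 h1E] : root (h - (h.[c])%:P) c.
  by rewrite rootE hornerD hornerN hornerC subrr.
have small : (size (- (h.[c])%:P : {poly Zp}) < size h)%N.
  by rewrite size_polyN hm (leq_ltn_trans (size_polyC_leq1 _)).
exists h1; first by rewrite mulrC -h1E subrK.
have sz : size (h1 * ('X - c%:P)) = m.+2 by rewrite -h1E size_polyDl.
have h10 : h1 != 0 by apply/eqP => h10; move: sz; rewrite h10 mul0r size_poly0.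
split; first by move: sz; rewrite size_Mmonic ?monicXsubC // size_XsubC addn2 => -[].
by rewrite -(lead_coef_Mmonic h1 (monicXsubC c)) -h1E lead_coefDl.
Qed.

Section Decomposition.
Variables (s T v : {poly 'F_p}) (c0 : {poly Zp}).
Hypotheses (s_monic : s \is monic) (T_monic : T \is monic) (s_sep : separable_poly s).
Hypothesis fE : f = liftp p_pr s * liftp p_pr T ^+ 2 + p%:R * liftp p_pr v + p%:R ^+ 2 * c0.

Lemma redp_sqf_decomposition : redp f = s * T ^+ 2.
Proof.
rewrite fE (_ : _ + _ = liftp p_pr s * liftp p_pr T ^+ 2 + p%:R * (liftp p_pr v + p%:R * c0)); last by ring.
by rewrite redpD redp_p addr0 redpM redpX !liftpK.
Qed.

Lemma discriminant_unit_sqf : ~ pdvd 1 (discriminant f) <-> size T = 1.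
Proof.
rewrite discriminant_unit redp_sqf_decomposition; split=> [sep|T1].
  apply/eqP/contraT => T1; have := separable_nosquare sep (isT : 1 < 2)%N T1.
  by rewrite dvdp_mull.
have /eqP/size_poly1P[a a0 TE] := T1.
by move: T_monic; rewrite TE monicE lead_coefC => /eqP ->; rewrite expr1n mulr1.
Qed.

Let derivE : redp f^`() = T * (s^`() * T + (s * T^`()) *+ 2).
Proof. by rewrite redp_deriv redp_sqf_decomposition expr2 !derivM; ring. Qed.

(** Mod [p], [T] divides both [f] and [f']. If [deg T > 1], or [T | s], or [2 = 0], they share a
    factor of degree at least 2 ([T] itself or [T ^ 2]), so [p ^ 2] divides the discriminant. *)
Lemma has_valuation1_node : has_valuation (discriminant f) 1 ->
  [/\ size T = 2, coprimep s T & (2 : 'F_p) != 0].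
Proof.
move=> [d1 nd2].
have T2 : size T = 2.
  apply/eqP; rewrite eqn_leq; apply/andP; split.
    rewrite leqNgt; apply/negP => T2; apply/nd2/pdvd_discriminant.
    apply: (resultant_common_factor2 f_monic size_f size_deriv_padic (g := T) (a := s * T) _ derivE T2).
    by rewrite redp_sqf_decomposition; ring.
  rewrite ltn_neqAle monic_size_gt0 // andbT eq_sym; apply/eqP => T1.
  by have := d1; apply/discriminant_unit_sqf.
have Tirr (u : {poly 'F_p}) : ~~ coprimep u T -> T %| u.
  rewrite coprimep_def => gu; rewrite -(eqp_dvdl _ (_ : gcdp u T %= T)) ?dvdp_gcdl //.
  rewrite -(dvdp_size_eqp (dvdp_gcdr u T)) T2 eqn_leq.
  have := dvdp_leq (monic_neq0 T_monic) (dvdp_gcdr u T); rewrite T2 => -> /=.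
  rewrite ltn_neqAle eq_sym gu size_poly_gt0 gcdp_eq0 negb_and.
  by rewrite (monic_neq0 T_monic) orbT.
have nT2 a b : redp f = T ^+ 2 * a -> redp f^`() = T ^+ 2 * b -> False.
  move=> ea eb; apply/nd2/pdvd_discriminant.
  apply: (resultant_common_factor2 f_monic size_f size_deriv_padic ea eb).
  have := size_exp T 2; rewrite T2; case: (size (T ^+ 2)) => // k /= ->.
  by [].
split => //.
  apply/contraT => /Tirr/dvdpP[w sE]; exfalso.
  apply: (nT2 s (s^`() + (w * T^`()) *+ 2)).
    by rewrite redp_sqf_decomposition mulrC.
  by rewrite derivE {2}sE; ring.
apply/eqP => two0; apply: (nT2 s s^`()); first by rewrite redp_sqf_decomposition mulrC.
rewrite derivE (_ : (s * T^`()) *+ 2 = 0); first by ring.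
by rewrite -mulr_natl -polyC_natr two0 mul0r.
Qed.

(** With [T = X - gam], choose a lift [c] of [gam] such that [p ^ 2 | f'(c)]. Dividing [f] and [f']
    by [X - c] puts them in the shape of [resultant_node], where [e0 = f(c) / p] reduces to
    [v(gam)]. *)
Lemma node_has_valuation1 : size T = 2 -> coprimep s T -> (2 : 'F_p) != 0 ->
  has_valuation (discriminant f) 1 <-> coprimep T v.
Proof.
move=> T2 sT two0.
have [gam TE] : exists gam : 'F_p, T = 'X - gam%:P.
  exists (- T`_0); apply/polyP => i; rewrite polyCN opprK coefD coefX coefC.
  case: i => [|[|i]]; rewrite ?add0r ?addr0 //=.
    by move/monicP: T_monic; rewrite /lead_coef T2.
  by rewrite nth_default ?T2.
have sg : s.[gam] != 0 by move: sT; rewrite TE coprimep_XsubC rootE.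
pose c1 : Zp := plift p_pr gam.
have sf' := size_deriv_padic.
have [G0 f'E _] := divide_XsubC c1 sf'.
have redX (c : Zp) : red c = gam -> redp ('X - c%:P) = T.
  by move=> rc; rewrite TE redpB /redp map_polyX map_polyC /= rc.
have rhorner (h : {poly Zp}) (c : Zp) : red h.[c] = (redp h).[red c].
  by rewrite /redp horner_map.
have Tg : T.[gam] = 0 by rewrite TE hornerXsubC subrr.
have G0g : (redp G0).[gam] = 2 * s.[gam].
  have := congr1 (@redp p p_pr) f'E; rewrite redpD redpM redX ?pliftK // derivE.
  have -> : redp (f^`().[c1])%:P = 0.
    by rewrite /redp map_polyC /= rhorner pliftK derivE hornerM Tg mul0r.
  rewrite addr0 => /(mulfI (monic_neq0 T_monic)) <-.
  rewrite hornerD hornerM Tg mulr0 add0r hornerMn hornerM TE derivXsubC hornerC mulr1.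
  by rewrite mulr_natl.
have G00 : (redp G0).[gam] != 0 by rewrite G0g mulf_neq0.
have [d dE] : exists d, f^`().[c1] = p%:R * d.
  by apply/reduction_eq0P; rewrite rhorner pliftK derivE hornerM Tg mul0r.
(* One Newton step makes [f'(c)] divisible by [p ^ 2]. *)
pose c : Zp := c1 + p%:R * plift p_pr (- red d / (redp G0).[gam]).
have redc : red c = gam.
  by rewrite rmorphD rmorphM /= !pliftK rmorph_nat pchar_Fp_0 // mul0r addr0.
have [e1 e1E] : exists e1, f^`().[c] = p%:R ^+ 2 * e1.
  pose t := plift p_pr (- red d / (redp G0).[gam]).
  have -> : f^`().[c] = p%:R * (t * G0.[c] + d).
    by rewrite f'E hornerD hornerM hornerXsubC hornerC dE /c addrAC subrr add0r; ring.
  have /reduction_eq0P[y ->] : red (t * G0.[c] + d) = 0.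
    by rewrite rmorphD rmorphM /= pliftK rhorner redc divfK // addNr.
  by exists y; rewrite expr2 mulrA.
have [G qE [sG _]] := divide_XsubC c sf'; rewrite e1E in qE.
have [f1 f1E [sf1 lf1]] := divide_XsubC c size_f.
have [e0 e0E] : exists e0, f.[c] = p%:R * e0.
  by apply/reduction_eq0P; rewrite rhorner redc redp_sqf_decomposition hornerM horner_exp Tg expr0n mulr0.
rewrite e0E in f1E.
have f1m : f1 \is monic by rewrite monicE lf1; exact: f_monic.
have rC (m : nat) (x : Zp) : redp (p%:R ^+ m.+1 * x)%:P = 0.
  by rewrite /redp map_polyC /= rmorphM rmorphXn /= rmorph_nat pchar_Fp_0 // expr0n mul0r.
have rf1 : redp f1 = s * T.
  apply: (mulfI (monic_neq0 T_monic)); have := congr1 (@redp p p_pr) f1E.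
  rewrite redpD redpM redX // -[p%:R]expr1 rC addr0 => <-.
  by rewrite redp_sqf_decomposition; ring.
have rG : redp G = s^`() * T + (s * T^`()) *+ 2.
  apply: (mulfI (monic_neq0 T_monic)); have := congr1 (@redp p p_pr) qE.
  by rewrite redpD redpM redX // rC addr0 derivE => <-.
have Gg : (redp G).[gam] = 2 * s.[gam].
  rewrite rG hornerD hornerM Tg mulr0 add0r hornerMn hornerM TE derivXsubC hornerC mulr1.
  by rewrite mulr_natl.
have Gc : red G.[c] != 0 by rewrite rhorner redc Gg mulf_neq0.
have co : coprimep (redp f1) (redp G).
  rewrite rf1 coprimepMl; apply/andP; split.
    rewrite rG TE derivXsubC mulr1 -TE addrC -mulr_natl.
    rewrite coprimep_addl_mul coprimepMr sT andbT.
    by have := s_sep; rewrite separable_polyE.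
  by rewrite coprimep_sym TE coprimep_XsubC rootE Gg mulf_neq0.
have [r1 r2] := resultant_node size_f sf' f1m sf1 (eq_leq sG) f1E qE Gc co.
(* [T(c)] is a multiple of [p], so [s T ^ 2] contributes a multiple of [p ^ 2] to [f(c)]. *)
have e0v : red e0 = v.[gam].
  have TL : exists y, (liftp p_pr T).[c] = p%:R * y.
    by apply/reduction_eq0P; rewrite rhorner liftpK redc Tg.
  have [y yE] := TL.
  have -> : e0 = p%:R * ((liftp p_pr s).[c] * y ^+ 2) + (liftp p_pr v).[c] + p%:R * c0.[c].
    apply: (mulfI (p_neq0 p_pr)); rewrite -e0E fE !(hornerD, hornerM, horner_exp) yE -polyC_natr !hornerC.
    by ring.
  rewrite !rmorphD !rmorphM /= rmorph_nat pchar_Fp_0 // !mul0r add0r addr0.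
  by rewrite rhorner liftpK redc.
rewrite /has_valuation !pdvd_discriminant r2 e0v coprimep_sym TE coprimep_XsubC rootE.
by split=> [[_ /eqP]|/eqP].
Qed.

End Decomposition.
End Discriminant.

(** * Haar measure and residues modulo p^2 *)

Section Digits.
Variables (p : nat) (p_pr : prime p).
Local Notation Zp := (padic_int p_pr).
Local Notation red := (@reduction p p_pr).
Local Notation plift := (@plift p p_pr).

(** The second digit with respect to the representatives [plift]; [digit1E] shows that the chosen
    decomposition does not matter. *)
Definition digit1 (x : Zp) : 'F_p := red (sval (cid (padic_decomp x))).

Lemma digit1E (x y : Zp) : x = plift (red x) + p%:R * y -> digit1 x = red y.
Proof.
rewrite /digit1; case: cid => z /= xz xy; congr red.
by apply: (mulfI (p_neq0 p_pr)); apply: (addrI (plift (red x))); rewrite -xz -xy.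
Qed.

Lemma digit_expansion (x : Zp) :
  exists z, x = plift (red x) + p%:R * plift (digit1 x) + p%:R ^+ 2 * z.
Proof.
have [y xy] := padic_decomp x; rewrite (digit1E xy).
by have [z yz] := padic_decomp y; exists z; rewrite {1}xy {1}yz; ring.
Qed.

Lemma red_digits (a b : 'F_p) (z : Zp) :
  red (plift a + p%:R * plift b + p%:R ^+ 2 * z) = a.
Proof.
by rewrite expr2 -mulrA -addrA -mulrDr rmorphD rmorphM /= pliftK rmorph_nat pchar_Fp_0 // mul0r addr0.
Qed.

Lemma digit1_digits (a b : 'F_p) (z : Zp) :
  digit1 (plift a + p%:R * plift b + p%:R ^+ 2 * z) = b.
Proof.
rewrite (@digit1E _ (plift b + p%:R * z)); last by rewrite red_digits; ring.
by rewrite rmorphD rmorphM /= pliftK rmorph_nat pchar_Fp_0 // mul0r addr0.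
Qed.

Lemma residueD (x y : Zp) k : (x + y) k = ((x k + y k) %% (p ^ k)%N)%Z.
Proof. by []. Qed.

Lemma residue1_eq0 (x : Zp) : (x 1%N = 0) <-> exists y, x = p%:R * y.
Proof.
split=> [x1|[y ->]]; first by apply/reduction_eq0P; rewrite /reduction x1.
by rewrite residueM residue_natr modzMml expn1 modzMr.
Qed.

Lemma residue2_eq0 (x : Zp) : (x 2%N = 0) <-> exists z, x = p%:R ^+ 2 * z.
Proof.
split=> [x2|[z ->]]; last first.
  by rewrite residueM -natrX residue_natr modzMml modzMr.
have /residue1_eq0[y xy] : x 1%N = 0 by rewrite padic_residueE x2 mod0z.
have /residue1_eq0[z yz] : y 1%N = 0.
  move: x2; rewrite xy residueM residue_natr modzMml => /dvdz_mod0P.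
  rewrite expnS expn1 PoszM dvdz_mul2l; last by rewrite -lt0n prime_gt0.
  by rewrite (padic_residueE y 1) expn1 => /dvdz_mod0P.
by exists z; rewrite xy yz expr2 mulrA.
Qed.

Lemma residue2_eq (x y : Zp) : x 2%N = y 2%N <-> exists z, x = y + p%:R ^+ 2 * z.
Proof.
split=> [xy|[z ->]].
  have /residue2_eq0[z e] : (x - y) 2%N = 0.
    by rewrite /= xy modzDmr subrr mod0z.
  by exists z; rewrite -e addrC subrK.
have /residue2_eq0 e : exists w, p%:R ^+ 2 * z = p%:R ^+ 2 * w by exists z.
by rewrite residueD e addr0 padic_modz.
Qed.

Lemma digits_ball (a b : 'F_p) :
  [set x : Zp | red x = a /\ digit1 x = b] = padic_ball (plift a + p%:R * plift b) 2.
Proof.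
apply/seteqP; split=> x; rewrite /padic_ball.
  by case=> xa xb; have [z xz] := digit_expansion x; apply/residue2_eq; exists z; rewrite -xa -xb -xz.
by move=> /residue2_eq[z ->]; split; [apply: red_digits|apply: digit1_digits].
Qed.

End Digits.

(** * Haar measure of sets given by digits mod [p ^ 2] *)

Section HaarMeasure.
Variables (R : realType) (p : nat) (p_pr : prime p) (m : nat).
Local Notation Zp := (padic_int p_pr).
Local Notation red := (@reduction p p_pr).
Local Notation plift := (@plift p p_pr).
Local Notation T := (m.-tuple Zp).
Local Notation D := (m.-tuple 'F_p * m.-tuple 'F_p)%type.

Definition digits (a : T) : D :=
  ([tuple red (tnth a i) | i < m], [tuple digit1 (tnth a i) | i < m]).

Definition fiber (d : D) : set T := [set a | digits a = d].

Lemma fiberP (d : D) (a : T) : fiber d a <->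
  forall i, red (tnth a i) = tnth d.1 i /\ digit1 (tnth a i) = tnth d.2 i.
Proof.
case: d => d1 d2; rewrite /fiber /digits /=; split=> [[<- <-] i|H].
  by rewrite !tnth_mktuple.
by congr pair; apply: eq_from_tnth => i; rewrite tnth_mktuple; have [] := H i.
Qed.

Lemma measurable_fiber d : measurable (fiber d).
Proof.
have -> : fiber d = \bigcap_(i in [set: 'I_m]) ((@tnth m Zp)^~ i @^-1`
    padic_ball (plift (tnth d.1 i) + p%:R * plift (tnth d.2 i)) 2).
  apply/seteqP; split=> a.
    by move=> /fiberP H i _ /=; rewrite -digits_ball; apply: H.
  by move=> H; apply/fiberP => i; have := H i I; rewrite /= -digits_ball.
apply: fin_bigcap_measurable => // i _.
rewrite -[X in measurable X]setTI; apply: measurable_tnth => //.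
by apply: sub_sigma_algebra; exists (plift (tnth d.1 i) + p%:R * plift (tnth d.2 i)), 2%N.
Qed.

Variable mu : {measure set T -> \bar R}.
Hypothesis mu_haar : is_haar mu.

Let z0 : D := ([tuple of nseq m 0], [tuple of nseq m 0]).

Let zero_digits i : tnth z0.1 i = 0.
Proof. by rewrite (tnth_nth 0) /= nth_nseq ltn_ord. Qed.

(** Each fiber is a translate of the zero fiber: elements of the latter are multiples of [p ^ 2], so
    adding them causes no carry in the first two digits. *)
Lemma mu_fiber d : mu (fiber d) = mu (fiber z0).
Proof.
have [_ _ trans] := mu_haar.
pose t : T := [tuple plift (tnth d.1 i) + p%:R * plift (tnth d.2 i) | i < m].
rewrite -[RHS](trans t); last exact: measurable_fiber.
congr (mu _).
apply/seteqP; split=> [a /fiberP H|_ [b /fiberP H <-]] /=.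
  exists [tuple tnth a i - tnth t i | i < m]; last first.
    by apply: eq_from_tnth => i; rewrite /translate !tnth_mktuple addrC subrK.
  apply/fiberP => i; have [e1 e2] := H i; have [z e] := digit_expansion (tnth a i).
  rewrite zero_digits !tnth_mktuple e e1 e2 addrAC subrr add0r.
  split; first by have := red_digits 0 0 z; rewrite plift0 mulr0 addr0 add0r.
  by have := digit1_digits 0 0 z; rewrite plift0 mulr0 addr0 add0r.
apply/fiberP => i; have [] := H i; rewrite zero_digits => e1 e2.
have [z e] := digit_expansion (tnth b i).
rewrite /translate !tnth_mktuple e e1 e2 plift0 mulr0 !add0r.
by rewrite red_digits digit1_digits.
Qed.

Lemma mu_digits (Q : {pred D}) :
  mu [set a | Q (digits a)] = ((#|Q|%:R)%:E * mu (fiber z0))%E.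
Proof.
have -> : [set a | Q (digits a)] = \bigcup_(d in [set` Q]) fiber d.
  by apply/seteqP; split=> [a Qa|a [d Qd] ad] /=; [exists (digits a)|rewrite [digits a]ad].
rewrite measure_fin_bigcup //; first last.
- by move=> d _; apply: measurable_fiber.
- by move=> d d' _ _ [a [<- <-]].
rewrite (eq_fsbigr (fun=> mu (fiber z0))); last by move=> d _; apply: mu_fiber.
rewrite -(@bigfs _ _ _ _ (index_enum _)) ?index_enum_uniq //; last by move=> d; rewrite mem_index_enum.
by rewrite mule_natl big_const; elim: #|_| => [|[|k] IH] //; [rewrite /= addr0|rewrite iterS IH].
Qed.

(** All fibers share one finite nonzero measure, which cancels together with the normalization of
    [mu]. *)
Lemma haar_ratio (Q1 Q2 : {pred D}) :
  fine (mu [set a | Q1 (digits a)]) / fine (mu [set a | Q2 (digits a)]) =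
  #|Q1|%:R / #|Q2|%:R.
Proof.
have [mu0 mufin _] := mu_haar.
have := mu_digits predT.
have -> : [set a | predT (digits a)] = setT by apply/seteqP; split.
move=> muT; rewrite !mu_digits.
have c_fin : mu (fiber z0) \is a fin_num.
  rewrite ge0_fin_numE // (le_lt_trans _ mufin) // le_measure ?inE //; exact: measurable_fiber.
rewrite -(fineK c_fin) /=; set c := fine _.
have c0 : c != 0.
  apply/eqP => c0; move: mu0; rewrite muT -(fineK c_fin) -/c c0 mule0.
  by rewrite ltxx.
by rewrite -mulf_div divff // mulr1.
Qed.

End HaarMeasure.

(** * Densities *)

Section CoprimeCount.
Variable F : finFieldType.
Implicit Types (g s t u v T : {poly F}) (n m k d : nat).

Lemma sum_polysE (V : nmodType) m (f : {poly F} -> V) :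
  \sum_(e <- polys F m) f e = \sum_(t : m.-tuple F) f (Poly (rev t)).
Proof. by rewrite /polys big_image. Qed.

Lemma PhiE T : Phi T = count (coprimep T) (polys F (size T).-1).
Proof. by rewrite /Phi size_filter. Qed.

Lemma sum_polys_divmod (V : nmodType) T d k (f : {poly F} -> V) : size T = d.+1 ->
  \sum_(e <- polys F (k + d)) f e =
  \sum_(h <- polys F k) \sum_(r <- polys F d) f (h * T + r).
Proof.
move=> sT; have T0 : T != 0 by rewrite -size_poly_gt0 sT.
rewrite -(big_allpairs_dep (h := fun h r : {poly F} => h * T + r) (r2 := fun=> polys F d)).
apply: perm_big; apply: uniq_perm; first exact: uniq_polys.
  apply: allpairs_uniq_dep => [|h _|[h r] [h' r'] /=]; try exact: uniq_polys.
  move=> /allpairsPdep[h1 [r1 [_ + [-> ->]]]] /allpairsPdep[h2 [r2 [_ + [-> ->]]]].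
  rewrite !mem_polys => s1 s2 /= E.
  have lt (r0 : {poly F}) : (size r0 <= d)%N -> (size r0 < size T)%N by rewrite sT.
  have := congr1 (fun u => u %/ T) E; have := congr1 (fun u => u %% T) E.
  rewrite /= !modpD !divpD // !modp_mull !add0r !modp_small ?lt // => ->.
  by rewrite !mulpK // !divp_small ?lt // !addr0 => ->.
move=> e; rewrite mem_polys; apply/idP/allpairsPdep => [e_k|[h [r []]]].
  exists (e %/ T), (e %% T); rewrite !mem_polys -divp_eq.
  have := ltn_modp e T; rewrite T0 sT ltnS => ->; split=> //.
  by rewrite size_divp // sT leq_subLR addnC.
rewrite !mem_polys => h_k r_d ->; rewrite (leq_trans (size_polyD _ _)) // geq_max.
rewrite (leq_trans (size_polyMleq _ _)) ?(leq_trans r_d) ?leq_addl //.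
by rewrite sT addnS /= leq_add2r.
Qed.

Lemma sum_polys_shift (V : nmodType) d u (f : {poly F} -> V) : (size u <= d)%N ->
  \sum_(r <- polys F d) f (r + u) = \sum_(r <- polys F d) f r.
Proof.
move=> u_d; rewrite -(big_map (fun r => r + u) xpredT).
apply: perm_big; apply: uniq_perm; rewrite ?uniq_polys //.
  by rewrite map_inj_uniq ?uniq_polys //; apply: addIr.
move=> r; rewrite mem_polys; apply/mapP/idP => [[v]|r_d].
  by rewrite mem_polys => v_d ->; rewrite (leq_trans (size_polyD _ _)) // geq_max v_d.
exists (r - u); rewrite ?subrK // mem_polys.
by rewrite (leq_trans (size_polyD _ _)) // geq_max size_polyN r_d.
Qed.

(** Coprimality to [T] depends only on the residue mod [T], and Euclidean division distributes
    residues evenly. The shift [u] only permutes them; it absorbs carries and the digits of fixed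
    coefficients. *)
Lemma count_coprime T u d k : size T = d.+1 ->
  count (fun e => coprimep T (e + u)) (polys F (k + d)) = (#|F| ^ k * Phi T)%N.
Proof.
move=> sT; rewrite -sum1_count big_mkcond.
rewrite [LHS](sum_polys_divmod k (fun e => if coprimep T (e + u) then 1%N else 0%N) sT).
have H h : (\sum_(r <- polys F d) if coprimep T (h * T + r + u)%R then 1 else 0)%N = Phi T.
  rewrite PhiE sT -sum1_count [in RHS]big_mkcond.
  rewrite -[RHS](@sum_polys_shift _ d (u %% T) (fun r => if coprimep T r then 1%N else 0%N)); last first.
    by rewrite -ltnS -sT ltn_modp -size_poly_gt0 sT.
  apply: eq_bigr => r _; congr (if _ then _ else _).
  rewrite {1}(divp_eq u T) (_ : h * T + r + _ = (h + u %/ T) * T + (r + u %% T)); last by ring.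
  by rewrite coprimep_addl_mul.
rewrite (eq_bigr (fun=> Phi T)) => [|h _]; last exact: H.
by rewrite big_const_seq count_predT iter_addn_0 size_polys mulnC.
Qed.

Lemma Phi_linear T : size T = 2 -> Phi T = #|F|.-1.
Proof.
move=> T2; rewrite PhiE T2 /= (@eq_in_count _ _ (predC (pred1 0))) => [|v]; last first.
  rewrite mem_polys /= => v1; have [->|v0] := eqVneq v 0; first by rewrite coprimep0 -size_poly_eq1 T2.
  have /size_poly1P[c c0 ->] : size v == 1 by rewrite eqn_leq v1 size_poly_gt0.
  by rewrite -[c%:P]mulr1 mul_polyC coprimepZr ?coprimep1.
have := count_predC (pred1 0) (polys F 1); rewrite size_polys expn1 => <-.
by rewrite count_uniq_mem ?uniq_polys // mem_polys size_poly0.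
Qed.

End CoprimeCount.

Section SquareFreeWeight.
Variable F : finFieldType.
Implicit Types (g s t T : {poly F}).

Definition is_sqf_decomposition g (sT : {poly F} * {poly F}) :=
  [/\ g = sT.1 * sT.2 ^+ 2, sT.1 \is monic, sT.2 \is monic & separable_poly sT.1].

Lemma sqf_decomposition_uniq g sT sT' :
  is_sqf_decomposition g sT -> is_sqf_decomposition g sT' -> sT = sT'.
Proof.
case: sT sT' => [s T] [s' T'] [-> /= sm Tm ss] [/= E s'm T'm ss'].
have e : T = T'.
  apply: dvdp_monic_eq => //.
    by rewrite -(sqr_dvd_sqf T ss' (monic_neq0 T'm)) -E dvdp_mull.
  by rewrite -(sqr_dvd_sqf T' ss (monic_neq0 Tm)) E dvdp_mull.
move: E; rewrite -e => /(mulIf (expf_neq0 2 (monic_neq0 Tm))) -> //.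
Qed.

(** A weight on pairs [(s, T)] seen as a function of [g = s T ^ 2], legitimate by uniqueness of the
    pair; the default 0 is taken where no decomposition exists. *)
Definition sqf_weight (V : nmodType) (w : {poly F} -> {poly F} -> V) g : V :=
  if pselect (exists sT, is_sqf_decomposition g sT) is left h
  then w (sval (cid h)).1 (sval (cid h)).2 else 0.

Lemma sqf_weightE (V : nmodType) (w : {poly F} -> {poly F} -> V) s T :
  s \is monic -> T \is monic -> separable_poly s -> sqf_weight w (s * T ^+ 2) = w s T.
Proof.
move=> sm Tm ss; rewrite /sqf_weight; case: pselect => [h|[]]; last by exists (s, T).
case: cid => sT /= dec; by rewrite (@sqf_decomposition_uniq _ sT (s, T) dec).
Qed.

End SquareFreeWeight.

(** * Local weights of the three properties *)

Section LocalWeights.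
Variables (R : realType) (p : nat) (p_pr : prime p) (n : nat).
Local Notation Zp := (padic_int p_pr).
Local Notation redp := (@redp p p_pr).
Local Notation liftp := (@liftp p p_pr).
Hypothesis n1 : (1 < n)%N.
Implicit Types (f z : {poly Zp}) (e g s t u T : {poly 'F_p}).

(* The property [W] of monic polynomials of degree [n] depends only on their reduction modulo *)
(* [p^2], and [w g] is the density of [W] among the lifts of [g].                             *)
Definition local_weight (W : set {poly Zp}) (w : {poly 'F_p} -> R) :=
  forall g, exists E : pred {poly 'F_p}, g \is monic -> size g = n.+1 ->
    (forall f e z, f \is monic -> size f = n.+1 ->
       f = liftp g + p%:R * liftp e + p%:R ^+ 2 * z -> (W f <-> E e)) /\
    (forall m u, (n.-1 <= m)%N ->
       (count (fun e => E (e + u)) (polys 'F_p m))%:R = p%:R ^+ m * w g).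

(** Lifting is not multiplicative; mod [p ^ 2] the error only shifts the second digits by a [d]
    depending on [s] and [T] alone. *)
Lemma liftp_sqf_shift s T : exists d, forall e z, exists z',
  liftp (s * T ^+ 2) + p%:R * liftp e + p%:R ^+ 2 * z =
  liftp s * liftp T ^+ 2 + p%:R * liftp (e + d) + p%:R ^+ 2 * z'.
Proof.
have [h hE] : exists h, liftp (s * T ^+ 2) = liftp s * liftp T ^+ 2 + p%:R * h.
  by apply: redp_eq; rewrite redpM redpX !liftpK.
have [r [h1 h1E]] : exists r h1, h = liftp r + p%:R * h1.
  by have [h1 ?] := redp_decomp h; exists (redp h), h1.
exists r => e z.
have [h2 h2E] : exists h2, liftp e + liftp r = liftp (e + r) + p%:R * h2.
  by apply: redp_eq; rewrite redpD !liftpK.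
exists (h1 + h2 + z); rewrite hE h1E (canRL (addKr _) h2E); ring.
Qed.

(** As [deg T <= n / 2 <= n - 1], even with [a_1] fixed there are enough free coefficients to reach
    every residue mod [T]. *)
Lemma local_weight_sqf (W : set {poly Zp}) (E : {poly 'F_p} -> {poly 'F_p} -> pred {poly 'F_p}) w :
  (forall f s T v z, f \is monic -> size f = n.+1 -> s \is monic -> T \is monic ->
     separable_poly s -> f = liftp s * liftp T ^+ 2 + p%:R * liftp v + p%:R ^+ 2 * z ->
     W f <-> E s T v) ->
  (forall s T m u, s \is monic -> T \is monic -> ((size T).-1 <= m)%N ->
     (count (fun e => E s T (e + u)) (polys 'F_p m))%:R = p%:R ^+ m * w s T) ->
  local_weight W (sqf_weight w).
Proof.
move=> WE Ew g.
have [gm|ngm] := boolP (g \is monic); last by exists xpredT.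
have [s [T [gE sm Tm ss]]] := sqf_decomposition gm; have [d dP] := liftp_sqf_shift s T.
exists (fun e => E s T (e + d)) => _ sg; split=> [f e z fm sf fE|m u nm].
  have [z' z'E] := dP e z; apply: (WE f s T (e + d) z') => //.
  by rewrite fE gE z'E.
under eq_count do rewrite -addrA.
rewrite Ew // ?gE ?sqf_weightE //; apply: leq_trans nm.
move: sg; rewrite gE size_prod_sqr // => -[<-].
by have := monic_size_gt0 sm; move: n1; move: (size s) (size T) => i j; lia.
Qed.

Lemma count_coprime_density T m u : T \is monic -> ((size T).-1 <= m)%N ->
  (count (fun e => coprimep T (e + u)) (polys 'F_p m))%:R =
  p%:R ^+ m * ((Phi T)%:R / p%:R ^+ (size T).-1) :> R.
Proof.
move=> Tm Tsm; rewrite -{1}(subnK Tsm) (@count_coprime _ T u (size T).-1); last first.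
  by rewrite prednK // monic_size_gt0.
rewrite card_Fp // natrM natrX -[in RHS](subnK Tsm) exprD; field.
by rewrite expf_neq0 // pnatr_eq0 -lt0n prime_gt0.
Qed.

Lemma local_weight_unit_discriminant :
  local_weight [set f | ~ pdvd 1 (discriminant f)] (sqf_weight (fun _ T => (size T == 1)%:R)).
Proof.
apply: (local_weight_sqf (E := fun _ T _ => size T == 1)) => //.
  move=> f s T v z fm sf sm Tm ss fE; have nE : n = n.-2.+2 by move: n1; clear; lia.
  rewrite nE in sf; rewrite /= (discriminant_unit_sqf fm sf Tm ss fE).
  by split=> /eqP.
move=> s T m u _ _ _; case: (size T == 1); last by rewrite count_pred0 mulr0.
by rewrite count_predT size_polys card_Fp // natrX mulr1.
Qed.

Lemma local_weight_maximal :
  local_weight [set f | is_maximal_order (equation_order f)]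
    (sqf_weight (fun _ T => (Phi T)%:R / p%:R ^+ (size T).-1)).
Proof.
apply: (local_weight_sqf (E := fun _ T v => coprimep T v)) => //; last first.
  by move=> s T m u _ Tm; apply: count_coprime_density.
move=> f s T v z fm sf sm Tm ss fE; have nE : n = n.-1.+1 by move: n1; clear; lia.
rewrite nE in sf; have crit := in_sqr_ideal_criterion sm Tm ss fE; rewrite /=; split=> [maxf|Tv].
  apply/negP => /negP /crit [t [tm t1 tf]].
  exact: (maximal_order_dedekind fm sf tm t1 tf maxf).
apply: (dedekind_maximal_order fm sf) => t tm t1 tf.
by have /negP := (iffLR crit) (ex_intro _ t (And3 tm t1 tf)).
Qed.

Lemma local_weight_valuation1 : odd p ->
  local_weight [set f | has_valuation (discriminant f) 1]
    (sqf_weight (fun s T => ((size T == 2) && coprimep s T)%:R * (1 - p%:R^-1))).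
Proof.
move=> p_odd; have two0 : (2 : 'F_p) != 0.
  rewrite -(dvdn_pcharf (pchar_Fp p_pr)); apply/negP => /dvdn_leq.
  by move: (prime_gt1 p_pr) p_odd; case: (p) => [|[|[|]]] // ? _ _ /(_ isT).
apply: (local_weight_sqf (E := fun s T v => [&& size T == 2, coprimep s T & coprimep T v])) => //.
  move=> f s T v z fm sf sm Tm ss fE; have nE : n = n.-2.+2 by move: n1; clear; lia.
  rewrite nE in sf; rewrite /=; split=> [v1|/and3P[/eqP T2 sT Tv]].
    have [T2 sT _] := has_valuation1_node fm sf Tm ss fE v1; rewrite T2 sT /=.
    exact/(node_has_valuation1 fm sf Tm ss fE).
  exact/(node_has_valuation1 fm sf Tm ss fE).
move=> s T m u _ Tm Tsm; have [T2|_] := eqVneq (size T) 2; last first.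
  by rewrite count_pred0 mul0r mulr0.
case: (coprimep s T) => /=; last by rewrite count_pred0 mul0r mulr0.
rewrite count_coprime_density // Phi_linear // T2 card_Fp // -subn1 natrB ?prime_gt0 //.
by rewrite /= expr1 mul1r [in LHS]mulrBl mul1r divff // pnatr_eq0 -lt0n prime_gt0.
Qed.

Lemma has_valuation1_two f : p = 2 -> f \is monic -> size f = n.+1 ->
  ~ has_valuation (discriminant f) 1.
Proof.
move=> p2 fm sf v1; have nE : n = n.-2.+2 by move: n1; clear; lia.
rewrite nE in sf; have gm := redp_monic fm.
have [s [T [gE sm Tm ss]]] := sqf_decomposition gm; have [d dP] := liftp_sqf_shift s T.
have [h hE] := redp_decomp f.
have [r [h1 h1E]] : exists r h1, h = liftp r + p%:R * h1.
  by have [h1 ?] := redp_decomp h; exists (redp h), h1.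
have [z zE] := dP r h1.
have fE : f = liftp s * liftp T ^+ 2 + p%:R * liftp (r + d) + p%:R ^+ 2 * z.
  by rewrite -zE -gE {1}hE h1E; ring.
have [_ _ /eqP] := has_valuation1_node fm sf Tm ss fE v1; apply.
by apply/eqP; rewrite -(dvdn_pcharf (pchar_Fp p_pr)) p2.
Qed.

End LocalWeights.

Section MonicFamilies.
Variable F : finFieldType.
Implicit Types (u v g : {poly F}) (n m : nat).

Lemma Poly_cat (A : nzRingType) (s t : seq A) :
  Poly (s ++ t) = Poly s + 'X^(size s) * Poly t.
Proof.
apply/polyP => i; rewrite coefD coefXnM !coef_Poly nth_cat.
by have [|] := ltnP i (size s) => H; rewrite ?addr0 // [_`_i]nth_default ?add0r // -?coef_Poly.
Qed.

Definition monic_tail (c a : seq F) : {poly F} := Poly (rev (1 :: c ++ a)).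

Lemma sum_monic_tail0 (V : nmodType) n (P : pred {poly F}) (h : {poly F} -> V) :
  \sum_(a : n.-tuple F | P (monic_tail [::] a)) h (monic_tail [::] a) =
  \sum_(g <- monics F n | P g) h g.
Proof.
rewrite /monics big_map [RHS]big_mkcond sum_polysE [LHS]big_mkcond; apply: eq_bigr => a _.
by rewrite /monic_tail rev_cons -cats1 Poly_cat size_rev size_tuple /= cons_poly_def mul0r add0r mulr1 addrC.
Qed.

Lemma sum_monic_tail1 (V : nmodType) m (b : F) (P : pred {poly F}) (h : {poly F} -> V) :
  \sum_(a : m.-tuple F | P (monic_tail [:: b] a)) h (monic_tail [:: b] a) =
  \sum_(g <- monics F m.+1 | P g && (subleading g == b)) h g.
Proof.
have E (a : m.-tuple F) : monic_tail [:: b] a = 'X^(m.+1) + b *: 'X^m + Poly (rev a).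
  rewrite /monic_tail !rev_cons -!cats1 -catA Poly_cat size_rev size_tuple /= !cons_poly_def.
  by rewrite polyC0 mul0r add0r polyC1 mul1r mulrDr -exprSr [_ * b%:P]mulrC mul_polyC [LHS]addrC.
rewrite [LHS]big_mkcond; under eq_bigr do rewrite E.
rewrite -(sum_polysE m (fun v => if P ('X^(m.+1) + b *: 'X^m + v) then h ('X^(m.+1) + b *: 'X^m + v) else 0)).
rewrite -(big_map (fun v => 'X^(m.+1) + b *: 'X^m + v) xpredT (fun g => if P g then h g else 0)).
rewrite -big_mkcond -big_filter -[RHS]big_filter; apply: perm_big.
apply: uniq_perm.
- by rewrite filter_uniq // map_inj_uniq ?uniq_polys //; apply: addrI.
- by rewrite filter_uniq // uniq_monics.
move=> g; rewrite !mem_filter mem_monics -andbA; congr (_ && _).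
have sb : (size (b *: 'X^m : {poly F}) <= m.+1)%N.
  by rewrite (leq_trans (size_scale_leq _ _)) // size_polyXn.
apply/mapP/idP => [[v]|/and3P[/eqP gb gm /eqP sg]].
  rewrite mem_polys => vm ->.
  have sv : (size (b *: 'X^m + v)%R <= m.+1)%N.
    by rewrite (leq_trans (size_polyD _ _)) // geq_max sb (leq_trans vm).
  rewrite -addrA -mem_monics map_f ?andbT; last by rewrite mem_polys.
  rewrite /subleading coefXM size_polyDl ?size_polyXn ?ltnS //= coefD coefXn ltn_eqF // add0r.
  by rewrite coefD coefZ coefXn eqxx mulr1 [v`_m]nth_default // addr0.
exists (g - ('X^(m.+1) + b *: 'X^m)); last by rewrite addrC subrK.
rewrite mem_polys; apply/leq_sizeP => j; rewrite leq_eqVlt => /orP[/eqP <-|].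
  move: gb; rewrite /subleading sg coefXM /= => gb.
  by rewrite coefB coefD coefZ !coefXn eqxx ltn_eqF // add0r mulr1 gb subrr.
rewrite leq_eqVlt => /orP[/eqP <-|mj].
  move: gm => /monicP; rewrite /lead_coef sg /= => gm.
  by rewrite coefB coefD coefZ !coefXn eqxx gtn_eqF // mulr0 addr0 gm subrr.
rewrite coefB coefD coefZ !coefXn !gtn_eqF ?(ltnW mj) // mulr0 addr0 subr0.
by rewrite nth_default // sg.
Qed.

End MonicFamilies.

Lemma natr_card_pair (R : pzSemiRingType) (A B : finType) (P : pred (A * B)) :
  #|P|%:R = \sum_a (count (fun b => P (a, b)) (enum B))%:R :> R.
Proof.
rewrite -sum1_card (eq_bigl (fun d => P (d.1, d.2))) => [|[]] //.
rewrite -(pair_big_dep xpredT (fun a b => P (a, b)) (fun _ _ => 1%N)) natr_sum /=.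
by apply: eq_bigr => a _; rewrite -sum1_count big_enum_cond.
Qed.

(** * Densities as averages over reductions *)

Section DensitySum.
Variables (R : realType) (p : nat) (p_pr : prime p) (n m : nat).
Local Notation Zp := (padic_int p_pr).
Local Notation red := (@reduction p p_pr).
Local Notation plift := (@plift p p_pr).
Local Notation redp := (@redp p p_pr).
Local Notation liftp := (@liftp p p_pr).
Variables (mu : {measure set m.-tuple Zp -> \bar R}) (c : seq Zp).
Hypotheses (mu_haar : is_haar mu) (size_c : (size c + m)%N = n) (nm : (n.-1 <= m)%N).

Lemma Poly_digits (s : seq Zp) : exists z,
  Poly s = liftp (Poly (map red s)) + p%:R * liftp (Poly (map (@digit1 p p_pr) s)) + p%:R ^+ 2 * z.
Proof.
have liftp0 : liftp 0 = 0 by apply/polyP => i; rewrite coef_liftp !coef0 plift0.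
elim: s => [|x s [z IH]] /=; first by exists 0; rewrite liftp0; ring.
have [y xE] := digit_expansion x.
have liftp_cons (a : 'F_p) t : liftp (cons_poly a t) = liftp t * 'X + (plift a)%:P.
  apply/polyP => i; rewrite coef_liftp cons_poly_def !coefD !coefMX !coefC coef_liftp.
  by case: i => [|i] /=; rewrite ?add0r ?addr0.
exists (z * 'X + y%:P); rewrite !liftp_cons cons_poly_def IH {1}xE.
by rewrite !polyCD !polyCM !polyC_natr; ring.
Qed.

Lemma monic_of_size (a : m.-tuple Zp) :
  monic_of (c ++ a) \is monic /\ size (monic_of (c ++ a)) = n.+1.
Proof.
have sz : size (monic_of (c ++ a)) = n.+1.
  rewrite /monic_of (@PolyK _ 0) ?size_rev /= ?size_cat ?size_tuple ?size_c //.
  by rewrite rev_cons last_rcons oner_neq0.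
split=> //; rewrite monicE /lead_coef sz /monic_of coef_Poly nth_rev /= ?size_cat ?size_tuple ?size_c //.
by rewrite subSS subnn.
Qed.

Let g (al : m.-tuple 'F_p) := monic_tail (map red c) al.
Let e (be : m.-tuple 'F_p) := Poly (rev (map (@digit1 p p_pr) (1 :: c) ++ be)).

Lemma monic_of_digits (a : m.-tuple Zp) : exists z,
  monic_of (c ++ a) = liftp (g (digits a).1) + p%:R * liftp (e (digits a).2) + p%:R ^+ 2 * z.
Proof.
have [z zE] := Poly_digits (rev (1 :: c ++ a)); exists z; rewrite /monic_of zE.
have aE (A : Type) (h : Zp -> A) : [seq h (tnth a i) | i <- enum 'I_m] = map h a.
  by rewrite map_comp map_tnth_enum.
by rewrite !map_rev /= !map_cat rmorph1 /g /e /monic_tail /= !aE.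
Qed.

Lemma redp_monic_of (a : m.-tuple Zp) : redp (monic_of (c ++ a)) = g (digits a).1.
Proof.
have [z ->] := monic_of_digits a.
by rewrite expr2 -mulrA -addrA -mulrDr redpD redp_p addr0 liftpK.
Qed.

Lemma density_sum (W W1 : set {poly Zp}) (w : {poly 'F_p} -> R) :
  (forall a : m.-tuple Zp, W (monic_of (c ++ a)) <-> (redp (monic_of (c ++ a)))`_0 != 0) ->
  local_weight n W1 w ->
  density mu c W W1 =
  (\sum_(al : m.-tuple 'F_p | (g al)`_0 != 0) w (g al)) /
  (\sum_(al : m.-tuple 'F_p | (g al)`_0 != 0) 1).
Proof.
move=> WE /choice[E EP].
pose Q2 := [pred d : m.-tuple 'F_p * m.-tuple 'F_p | (g d.1)`_0 != 0].
pose Q1 := [pred d : m.-tuple 'F_p * m.-tuple 'F_p | ((g d.1)`_0 != 0) && E (g d.1) (e d.2)].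
have gP (al : m.-tuple 'F_p) : g al \is monic /\ size (g al) = n.+1.
  have -> : g al = redp (monic_of (c ++ map_tuple plift al)).
    rewrite redp_monic_of; congr g; apply: eq_from_tnth => i.
    by rewrite tnth_mktuple tnth_map pliftK.
  by have [fm fs] := monic_of_size (map_tuple plift al); rewrite redp_monic // size_redp.
rewrite /density.
have -> : [set a : m.-tuple Zp | W (monic_of (c ++ a))] = [set a | Q2 (digits a)].
  by apply/seteqP; split=> a; rewrite /= WE redp_monic_of.
have -> : [set a : m.-tuple Zp | (W `&` W1) (monic_of (c ++ a))] = [set a | Q1 (digits a)].
  have W1E (a : m.-tuple Zp) : W1 (monic_of (c ++ a)) <-> E (g (digits a).1) (e (digits a).2).
    have [gm gs] := gP (digits a).1; have [fm fs] := monic_of_size a.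
    by have [z zE] := monic_of_digits a; apply: (EP _ gm gs).1 zE.
  apply/seteqP; split=> a; rewrite /= /setI /= WE redp_monic_of W1E; first by case=> -> ->.
  by case/andP.
rewrite haar_ratio //.
have p0 : p%:R ^+ m != 0 :> R by rewrite expf_neq0 // pnatr_eq0 -lt0n prime_gt0.
have -> : #|Q2|%:R = p%:R ^+ m * \sum_(al : m.-tuple 'F_p | (g al)`_0 != 0) 1 :> R.
  rewrite (natr_card_pair R) mulr_sumr [RHS]big_mkcond; apply: eq_bigr => al _ /=.
  case: (_ != 0); last by rewrite count_pred0.
  by rewrite count_predT -cardE card_tuple card_Fp // natrX mulr1.
have -> : #|Q1|%:R = p%:R ^+ m * \sum_(al : m.-tuple 'F_p | (g al)`_0 != 0) w (g al) :> R.
  rewrite (natr_card_pair R) mulr_sumr [RHS]big_mkcond; apply: eq_bigr => al _ /=.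
  case: (_ != 0); last by rewrite count_pred0.
  have [gm gs] := gP al; have [_ H] := EP _ gm gs.
  (* The second digits of the fixed coefficients [1 :: c] add a constant polynomial in degrees [m]
     and above, handled by the shift [u] of [local_weight]. *)
  rewrite -(H m ('X^m * Poly (rev (map (@digit1 p p_pr) (1 :: c))))) //; congr (_%:R).
  rewrite /polys -!sum1_count big_enum_cond big_image_cond; apply: eq_bigl => be /=; congr (E _ _).
  by rewrite /e rev_cat Poly_cat size_rev size_tuple.
by rewrite -mulf_div divff // mul1r.
Qed.

End DensitySum.

(** * The effect of fixing [a_1] *)

Section DensityShift.
Variables (R : realType) (p : nat) (p_pr : prime p) (n : nat) (b1 : padic_int p_pr).
Hypothesis n1 : (1 < n)%N.
Local Notation Zp := (padic_int p_pr).
Local Notation F := 'F_p.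
Local Notation units := (units 'F_p n).
Variables (mu : {measure set n.-1.-tuple Zp -> \bar R}) (mu' : {measure set n.-tuple Zp -> \bar R}).
Hypotheses (mu_haar : is_haar mu) (mu'_haar : is_haar mu').
Local Open Scope complex_scope.

Let size_b1 : (size [:: b1] + n.-1)%N = n.
Proof. by rewrite /= add1n prednK // ltnW. Qed.

Lemma Vn_anP (a : n.-tuple Zp) :
  Vn_an p_pr n (monic_of ([::] ++ a)) <-> (redp (monic_of ([::] ++ a)))`_0 != 0.
Proof.
have [fm fs] := @monic_of_size p p_pr n n [::] erefl a.
rewrite coef_redp reduction_eq0; split=> [[_ nd]|/asboolP nd]; first exact/asboolP.
by split.
Qed.

Lemma Vn_a1_anP (a : n.-1.-tuple Zp) :
  Vn_a1_an n b1 (monic_of ([:: b1] ++ a)) <-> (redp (monic_of ([:: b1] ++ a)))`_0 != 0.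
Proof.
have [fm fs] := @monic_of_size p p_pr n n.-1 [:: b1] size_b1 a.
rewrite coef_redp reduction_eq0; split=> [[_ _ nd]|/asboolP nd]; first exact/asboolP.
split=> //; rewrite /monic_of coef_Poly nth_rev /= size_tuple; last by rewrite !ltnS ltnW.
by rewrite subSS subSnn.
Qed.

(** Fourier inversion is used twice: with [w] for the numerators and with the constant weight 1 for
    the denominators. *)
Lemma density_shift (W1 : set {poly Zp}) (w : {poly F} -> R) (K : R[i]) :
  local_weight n W1 w ->
  (forall chi : F -> R[i], is_character chi -> (exists y, chi y != 1) ->
    \sum_(g <- units) chi (subleading g) * (w g)%:C = K) ->
  (density mu [:: b1] (Vn_a1_an n b1) W1)%:C =
  (density mu' [::] (Vn_an p_pr n) W1)%:C
    + K * Defs.eta R (reduction b1) / ((p%:R - 1) * p%:R ^+ n.-1).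
Proof.
move=> w1 sumK.
have p0 : p%:R != 0 :> R[i] by rewrite pnatr_eq0 -lt0n prime_gt0.
have p1 : p%:R - 1 != 0 :> R[i].
  by rewrite subr_eq0 -[1]/(1%:R) eqr_nat neq_ltn prime_gt1 ?orbT.
have pn0 : p%:R ^+ n.-1 != 0 :> R[i] by rewrite expf_neq0.
rewrite (density_sum mu'_haar (erefl : size [::] + n = n)%N (leq_pred n) Vn_anP w1).
rewrite (density_sum mu_haar size_b1 (leqnn _) Vn_a1_anP w1).
rewrite (sum_monic_tail0 n (fun g => g`_0 != 0) w) (sum_monic_tail0 n (fun g => g`_0 != 0) (fun=> 1 : R)).
rewrite (sum_monic_tail1 n.-1 (reduction b1) (fun g => g`_0 != 0) w).
rewrite (sum_monic_tail1 n.-1 (reduction b1) (fun g => g`_0 != 0) (fun=> 1 : R)) prednK 1?ltnW //.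
have fibre (h : {poly F} -> R) : \sum_(g <- monics F n | (g`_0 != 0) && (subleading g == reduction b1)) h g =
    \sum_(g <- units | subleading g == reduction b1) h g by rewrite big_filter_cond.
have full (h : {poly F} -> R) : \sum_(g <- monics F n | g`_0 != 0) h g = \sum_(g <- units) h g.
  by rewrite big_filter.
rewrite !fibre !full !rmorphM !fmorphV !rmorph_sum /= !rmorph1.
have := sum_fiber_eta p_pr sumK (reduction b1).
have sum1 : \sum_(g <- units) (1 : R[i]) = (p%:R - 1) * p%:R ^+ n.-1.
  rewrite big_const_seq count_predT iter_addr_0 -{1}(prednK (ltnW n1)) size_units card_Fp //.
  by rewrite natrM natrX -subn1 natrB // prime_gt0.
(* For the weight 1 the twisted sums vanish because [n >= 2], so every fiber of [a_1] has the same
   number of elements. *)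
have H : p%:R * \sum_(g <- units | subleading g == reduction b1) 1 = (p%:R - 1) * p%:R ^+ n.-1 :> R[i].
  have K1 (chi : F -> R[i]) : is_character chi -> (exists y, chi y != 1) ->
      \sum_(g <- units) chi (subleading g) * 1 = 0.
    move=> [chi0 chiD] chi_nt; under eq_bigr do rewrite mulr1.
    have := @Eunits_ge2 'F_p _ chi chiD n.-2 chi_nt; rewrite /Eunits.
    by rewrite (_ : n.-2.+2 = n) //; move: n1; clear; lia.
  have /eqP := sum_fiber_eta p_pr K1 (reduction b1).
  by rewrite mul0r sum1 subr_eq0 => /eqP.
have s0 : \sum_(g <- units | subleading g == reduction b1) 1 != 0 :> R[i].
  apply/eqP => s0; move: H; rewrite s0 mulr0 => /esym/eqP.
  by rewrite mulf_eq0 (negPf p1) (negPf pn0).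
by move=> <-; rewrite sum1 -mulrDl addrC subrK -H -mulf_div divff // mul1r.
Qed.

End DensityShift.

(** Counts the multiples of [p] from 2 to [k + 2]; starting at 2 misses none since [p > 1]. *)
Lemma sum_dvdn p k : prime p -> (\sum_(j < k.+1) (p %| j.+2) = k.+2 %/ p)%N.
Proof.
move=> p_pr; elim: k => [|k IH].
  by rewrite big_ord1 divnS ?prime_gt0 // (divn_small (prime_gt1 p_pr)) addn0.
by rewrite big_ord_recr /= IH [in RHS]divnS ?prime_gt0 // addnC.
Qed.

(** For [p] odd, 2 is invertible and [chi (y / 2) ^ 2 = chi y]. *)
Lemma character_sqr_odd (R : realType) p (chi : 'F_p -> R[i]) : prime p -> odd p ->
  is_character chi -> (exists y, chi y != 1) -> exists y, chi y ^+ 2 != 1.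
Proof.
move=> p_pr p_odd [chi0 chiD] [y y1]; exists (y / 2); rewrite expr2 -chiD -mulrDl -mulr2n -[y *+ 2]mulr_natr.
rewrite mulfK //= -(dvdn_pcharf (pchar_Fp p_pr)); apply/negP => /dvdn_leq.
by move: (prime_gt1 p_pr) p_odd; case: (p) => [|[|[|]]] // ? _ _ /(_ isT).
Qed.

Local Open Scope complex_scope.

Theorem theorem8p1 (R : realType) (n p : nat) (n_ge2 : (2 <= n)%N)
    (p_pr : prime p) (b1 : padic_int p_pr)
    (mu : {measure set n.-1.-tuple (padic_int p_pr) -> \bar R})
    (mu' : {measure set n.-tuple (padic_int p_pr) -> \bar R})
    (mu_haar : is_haar mu) (mu'_haar : is_haar mu') :
  let W := Vn_a1_an n b1 in
  let W' := Vn_an p_pr n in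
  let eta_b1 := eta R (reduction b1) in
  (forall b : 'F_p, eta R b = if b == 0 then p%:R - 1 else - 1) /\
  (p = 2%N ->
    [/\ P1_sqf mu [:: b1] W = 0,
        (P_max mu [:: b1] W)%:C = (P_max mu' [::] W')%:C
          - (- 1) ^+ n / 2 ^+ (n + n %/ 2 - 1) * eta_b1 &
        (P0_sqf mu [:: b1] W)%:C = (P0_sqf mu' [::] W')%:C
          - (- 1) ^+ n / 2 ^+ (n - 1) * eta_b1]) /\
  (odd p ->
    [/\ (P_max mu [:: b1] W)%:C = (P_max mu' [::] W')%:C
          + (- 1) ^+ n / ((p%:R - 1) * p%:R ^+ (n + n %/ 2 - 1)) * eta_b1,
        (P0_sqf mu [:: b1] W)%:C = (P0_sqf mu' [::] W')%:C
          + (- 1) ^+ n / ((p%:R - 1) * p%:R ^+ (n - 1)) * eta_b1 &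
        (P1_sqf mu [:: b1] W)%:C = (P1_sqf mu' [::] W')%:C
          - (- 1) ^+ n / p%:R ^+ n
            * (n%:R - 1 - p%:R * (n %/ p)%:R) * eta_b1]).
Proof.
move=> W W' eta_b1.
have p0 : p%:R != 0 :> R[i] by rewrite pnatr_eq0 -lt0n prime_gt0.
have p1 : p%:R - 1 != 0 :> R[i].
  by rewrite subr_eq0 -[1]/(1%:R) eqr_nat neq_ltn prime_gt1 ?orbT.
have pn0 k : p%:R ^+ k != 0 :> R[i] by rewrite expf_neq0.
have nE : n = n.-2.+2 by move: n_ge2; clear; lia.
have expE : (n + n %/ 2 - 1 = n.-1 + n./2)%N by rewrite -divn2; move: n_ge2; clear; lia.
have sgnE : (-1) ^+ n = (-1) ^+ n.-2 :> R[i] by rewrite [in LHS]nE 2!exprS !mulN1r opprK.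
have shift := density_shift b1 n_ge2 mu_haar mu'_haar.
have maxE (s T : {poly 'F_p}) : s \is monic -> T \is monic -> separable_poly s ->
    (sqf_weight (fun _ T => (Phi T)%:R / p%:R ^+ (size T).-1) (s * T ^+ 2) : R)%:C%C =
    (Phi T)%:R / #|'F_p|%:R ^+ (size T).-1.
  move=> sm Tm ss; rewrite sqf_weightE // card_Fp //.
  by rewrite rmorphM fmorphV rmorphXn /= !rmorph_nat.
have sqfE s T : s \is monic -> T \is monic -> separable_poly s ->
    (sqf_weight (fun _ T : {poly 'F_p} => (size T == 1)%:R) (s * T ^+ 2) : R)%:C%C = (size T == 1)%:R.
  by move=> sm Tm ss; rewrite sqf_weightE // rmorph_nat.
split; first exact: etaE.
split=> [p2|p_odd].
  have F2 : #|'F_p| = 2%N by rewrite card_Fp.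
  have chi2 (chi : 'F_p -> R[i]) : is_character chi -> forall y, chi y ^+ 2 = 1.
    move=> [chi0 chiD] y; rewrite expr2 -chiD -mulr2n -[y *+ 2]mulr_natr.
    by rewrite (_ : 2%:R = 0) ?mulr0 //; apply/eqP; rewrite -(dvdn_pcharf (pchar_Fp p_pr)) p2.
  split.
  (* For [p = 2] the discriminant never has valuation 1, so the numerator is the measure of the
     empty set. *)
  - rewrite /P1_sqf /density (_ : mkset _ = set0) ?measure0 ?mul0r //.
    apply/seteqP; split=> // a [[[fm fs] _ _]].
    exact: (has_valuation1_two n_ge2 p2 fm fs).
  - rewrite /P_max (shift _ _ (- ((-1) ^+ n.-2 / #|'F_p|%:R ^+ n./2))
      (local_weight_maximal R p_pr n_ge2)); last first.
      move=> chi chiP chi_nt; have [chi0 chiD] := chiP.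
      by rewrite nE; apply: (max_weight_two chi0 chiD chi_nt (chi2 _ chiP) F2 maxE).
    congr (_ + _); rewrite expE exprD card_Fp // -/eta_b1; move: (pn0 n.-1) (pn0 n./2); rewrite p2 => ? ?.
    by rewrite sgnE; field; apply/andP.
  - rewrite /P0_sqf (shift _ _ (- (-1) ^+ n) (local_weight_unit_discriminant R p_pr n_ge2)); last first.
      move=> chi chiP chi_nt; have [chi0 chiD] := chiP.
      rewrite (sqf_weight_sum chi0 chiD sqfE).
      by have := sqf_weight_two chi0 chiD chi_nt (chi2 _ chiP) F2 n.-2; rewrite -nE.
    congr (_ + _); rewrite subn1 -/eta_b1; move: (pn0 n.-1); rewrite p2 => ?.
    by field.
have chi2 (chi : 'F_p -> R[i]) : is_character chi -> (exists y, chi y != 1) -> exists y, chi y ^+ 2 != 1.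
  exact: character_sqr_odd.
split.
- rewrite /P_max (shift _ _ ((-1) ^+ n / #|'F_p|%:R ^+ n./2) (local_weight_maximal R p_pr n_ge2)); last first.
    move=> chi chiP chi_nt; have [chi0 chiD] := chiP.
    exact: (max_weight_odd chi0 chiD chi_nt (chi2 _ chiP chi_nt) maxE).
  congr (_ + _); rewrite expE exprD card_Fp // -/eta_b1.
  by field; rewrite ?p1 ?pn0.
- rewrite /P0_sqf (shift _ _ ((-1) ^+ n) (local_weight_unit_discriminant R p_pr n_ge2)); last first.
    move=> chi chiP chi_nt; have [chi0 chiD] := chiP.
    rewrite (sqf_weight_sum chi0 chiD sqfE).
    exact: (Ssqf_odd chi0 chiD chi_nt (chi2 _ chiP chi_nt)).
  congr (_ + _); rewrite subn1 -/eta_b1.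
  by field; rewrite ?p1 ?pn0.
- have nodeE s T : s \is monic -> T \is monic -> separable_poly s ->
      (sqf_weight (fun s T : {poly 'F_p} => ((size T == 2) && coprimep s T)%:R * (1 - p%:R^-1))
        (s * T ^+ 2) : R)%:C%C =
      ((size T == 2) && coprimep s T)%:R * (1 - p%:R^-1).
    move=> sm Tm ss; rewrite sqf_weightE //.
    by rewrite rmorphM rmorphB fmorphV rmorph1 /= !rmorph_nat.
  rewrite /P1_sqf (shift _ _ ((1 - p%:R^-1) * ((-1) ^+ n.-2 *
      \sum_(k < n.-2.+1) (#|'F_p|%:R * (k.+2%:R == 0 :> 'F_p)%:R - 1)))
    (local_weight_valuation1 R p_pr n_ge2 p_odd)); last first.
    move=> chi chiP chi_nt; have [chi0 chiD] := chiP.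
    by rewrite nE; apply: (node_weight_odd chi0 chiD chi_nt (chi2 _ chiP chi_nt) nodeE).
  congr (_ + _); rewrite -/eta_b1.
  (* The indices [k + 2] run from 2 to [n]: [n - 1] terms, of which [n %/ p] are multiples of
     [p]. *)
  have -> : \sum_(k < n.-2.+1) (#|'F_p|%:R * (k.+2%:R == 0 :> 'F_p)%:R - 1) =
            p%:R * (n %/ p)%:R - (n%:R - 1) :> R[i].
    rewrite card_Fp // big_split /= sumr_const card_ord -mulr_sumr.
    have -> : (n %/ p = \sum_(j < n.-2.+1) (p %| j.+2))%N by rewrite sum_dvdn // -nE.
    have -> : n%:R - 1 = (n.-2.+1)%:R :> R[i] by rewrite {1}nE -natr1 addrK.
    rewrite natr_sum mulNrn.
    congr (_ * _ - _); apply: eq_bigr => k _.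
    by rewrite (dvdn_pcharf (pchar_Fp p_pr)).
  have nE1 : n = n.-1.+1 by move: n_ge2; clear; lia.
  rewrite sgnE [in p%:R ^+ n]nE1 exprS.
  by field; rewrite ?p0 ?p1 ?pn0.
Qed.
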